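(* Let $d=2$ (weak or strong coupling, as in the context), fix $x_0\in\mathbb{T}^2$. There exist a subset $\Lambda''\subset\Lambda$, constants $A>1$, $c>0$ and an integer $N\ge1$ such that $$\#\{\lambda\in\Lambda'':\lambda\le x\}\gg \frac{x}{(\log x)^A}\quad (x\to\infty),$$ and such that momentum scarring holds along $\Lambda''$: every weak-$*$ limit point $\mu$ (as $\lambda\to\infty$ in $\Lambda''$) of the functionals $f\mapsto\langle\operatorname{Op}(f)g_\lambda,g_\lambda\rangle$ on $C^\infty(\mathbb{S}^1)$ satisfies $\mu\ge c\,\rho$ for some probability measure $\rho$ on $\mathbb{S}^1$ supported on at most $N$ points.
   Context: $\mathbb{T}^2=\mathbb{R}^2/2\pi\mathbb{Z}^2$. For an integer $n$, $r_2(n)=\#\{\xi\in\mathbb{Z}^2:|\xi|^2=n\}$, $\mathcal{N}_2=\{n: r_2(n)>0\}$, and $n_+(\lambda)$ is the smallest element of $\mathcal{N}_2$ larger than $\lambda$. Fix $C\in\mathbb{R}$ and (for strong coupling) $\eta\in(131/146,1)$. The set $\Lambda$ of new eigenvalues is the set of real $\lambda\notin\mathcal{N}_2$ solving weak coupling: $\sum_{n\in\mathcal{N}_2} r_2(n)\big(\frac{1}{n-\lambda}-\frac{n}{n^2+1}\big)=C$; strong coupling: $\sum_{n\in\mathcal{N}_2,\ |n-n_+(\lambda)|<n_+(\lambda)^\eta} r_2(n)\big(\frac{1}{n-\lambda}-\frac{n}{n^2+1}\big)=C$. For $\lambda\in\Lambda$, $\hat g_\lambda(\xi)=\dfrac{e^{-i\xi\cdot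 x_0}/(|\xi|^2-\lambda)}{(\sum_{n\in\mathcal{N}_2}r_2(n)/(n-\lambda)^2)^{1/2}}$ ($\xi\in\mathbb{Z}^2$) are the Fourier coefficients of the normalized eigenfunction $g_\lambda$, and for $f\in C^\infty(\mathbb{S}^1)$, $\langle\operatorname{Op}(f)g_\lambda,g_\lambda\rangle:=\sum_{\xi\in\mathbb{Z}^2\setminus\{0\}}f(\xi/|\xi|)|\hat g_\lambda(\xi)|^2$. *)

(* Defs.v *)
From Stdlib Require Import Reals Lra List ZArith ClassicalEpsilon.
Open Scope R_scope.

Definition zrange (n : nat) : list Z :=
  map (fun k => (Z.of_nat k - Z.of_nat n)%Z) (seq 0 (2 * n + 1)).

Definition rsum (l : list R) : R := fold_right Rplus 0 l.

Definition shell_sum (n : nat) (g : Z -> Z -> R) : R :=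
  rsum (map (fun a => rsum (map (fun b =>
      if Z.eqb (a * a + b * b)%Z (Z.of_nat n) then g a b else 0)
    (zrange n))) (zrange n)).

Definition r2 (n : nat) : R := shell_sum n (fun _ _ => 1).

Definition in_N2 (n : nat) : Prop := 0 < r2 n.

Definition series (s : nat -> R) : R :=
  epsilon (inhabits 0) (fun l => infinite_sum s l).

Definition is_nplus (lam : R) (m : nat) : Prop :=
  in_N2 m /\ lam < INR m /\
  forall k, in_N2 k -> lam < INR k -> (m <= k)%nat.

(* real power with 0^y = 0 (y > 0) *)
Definition rpow (x y : R) : R := if Rle_dec x 0 then 0 else Rpower x y.

Definition term (lam : R) (n : nat) : R :=
  r2 n * (/ (INR n - lam) - INR n / (INR n ^ 2 + 1)).

Inductive coupling := Weak | Strong (eta : R).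

Definition coupling_ok (cp : coupling) : Prop :=
  match cp with Weak => True | Strong eta => 131 / 146 < eta < 1 end.

(* sum over n in N_2 with |n - m| < m^eta (terms with r2 n = 0 vanish;
   all such n are < 2m+2) *)
Definition window_sum (eta lam : R) (m : nat) : R :=
  rsum (map (fun n =>
     if Rlt_dec (Rabs (INR n - INR m)) (rpow (INR m) eta) then term lam n else 0)
   (seq 0 (2 * m + 2))).

(* lam in Lambda (set of new eigenvalues) *)
Definition in_Lambda (cp : coupling) (C lam : R) : Prop :=
  (forall n, in_N2 n -> lam <> INR n) /\
  match cp with
  | Weak => infinite_sum (term lam) C
  | Strong eta => exists m, is_nplus lam m /\ window_sum eta lam m = C
  end.

Definition norm_const (lam : R) : R :=
  series (fun n => r2 n / (INR n - lam) ^ 2).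

Definition ghat_sq (lam : R) (a b : Z) : R :=
  / ((IZR (a * a + b * b) - lam) ^ 2 * norm_const lam).

Definition zabs (a b : Z) : R := sqrt (IZR a ^ 2 + IZR b ^ 2).

(* <Op(f) g_lam, g_lam> = sum_{xi != 0} f(xi/|xi|) |hat g_lam(xi)|^2,
   summed shell by shell (|xi|^2 = 1, 2, 3, ...); absolutely convergent.
   A function on S^1 is represented by f : R -> R -> R evaluated at points
   of the unit circle. *)
Definition Op (lam : R) (f : R -> R -> R) : R :=
  series (fun n => shell_sum (S n) (fun a b =>
     f (IZR a / zabs a b) (IZR b / zabs a b) * ghat_sq lam a b)).

Definition smooth (g : R -> R) : Prop :=
  exists D : nat -> R -> R, (forall x, D 0%nat x = g x) /\
    forall k x, derivable_pt_lim (D k) x (D (S k) x).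

Definition smooth_S1 (f : R -> R -> R) : Prop :=
  smooth (fun t => f (cos t) (sin t)).

Definition nonneg_S1 (f : R -> R -> R) : Prop :=
  forall t, 0 <= f (cos t) (sin t).

Definition weak_star_limit_point (L2 : R -> Prop) (mu : (R -> R -> R) -> R) : Prop :=
  exists lk : nat -> R,
    (forall k, L2 (lk k)) /\ cv_infty lk /\
    forall f, smooth_S1 f -> Un_cv (fun k => Op (lk k) f) (mu f).

(* Main.v *)
Require Import Defs.
From Stdlib Require Import Reals Lra Lia List ZArith Arith ClassicalEpsilon Rtopology.
From Coquelicot Require Import Coquelicot.
From mathcomp Require all_boot.
Open Scope R_scope.

(** Let [p] be a shell with [r2 p <= 8], and let [lm < p < lp] be the new eigenvalues in the two
    gaps adjacent to [p], with [u = lp - p] and [v = p - lm].  Subtracting the two quantization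
    conditions gives [u v S = r2 p], where [S] is the sum of [r2 n / ((n - lp) (n - lm))] over
    [n <> p], a sum of nonnegative terms.  If [u <= v], the term of the next shell alone shows that
    this shell is at distance at least a constant times [u] from [lp]; hence
    [u^2 / (n - lp)^2 <= 67 u v / ((n - lp) (n - lm))] for all [n <> p] and
    [u^2 norm_const lp] is bounded.  So every lattice point on the shell [p] carries a fixed
    proportion of the mass of [g_lp] (symmetrically for [lm] when [v <= u]), and every limit
    measure has an atom of at least that mass.

    Under strong coupling the windows of the two conditions differ by a few boundary shells.  The
    error is negligible when both gaps at [p] are at most [p^(1/100)], which excludes few [p],
    because the exceptional ones are far apart.

    Shells with [r2 p <= 8] are provided by the primes [p = 1] modulo 4.  Mertens' estimate for
    this residue class gives at least a constant times [N / log N] of them in [[N / R, N]]. *)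

(** No information on the place of an eigenvalue inside its gap is available, and the comparison of
    two neighbouring conditions avoids locating anything. The constant [C] and the regularizing
    terms n / (n^2 + 1) cancel, and [p], the only shell between [lm] and [lp], gives the only
    negative term r2 n / ((n - lp) (n - lm)). The price is that only the eigenvalue closer to [p] is
    controlled, with no choice of the side. One eigenvalue may therefore be attached to two primes,
    and the count loses a factor 2.

    The proportion obtained is 1/1081, where 1081 = 8 + 67 * 16 + 1: the shell [p] itself, the
    comparison with [S] (the bound 16 leaves room above r2 p <= 8 for the window error), and the
    shells outside the window.

    The exponent 1/100 has to be positive, so that longer gaps are rarer than primes, and small, so
    that the window errors stay below the inverse gap lengths. The strictest condition there is 2 *
    eta > 7/4 + 2/100. *)

(** * Finite sums *)

Fixpoint psum (f : nat -> R) (n : nat) : R :=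
  match n with O => 0 | S k => psum f k + f k end.

Lemma psum_ext f g n : (forall i, (i < n)%nat -> f i = g i) -> psum f n = psum g n.
Proof.
  induction n as [|n IH]; intros H; simpl; [reflexivity|].
  rewrite IH, H by (intros; try apply H; lia). reflexivity.
Qed.

Lemma psum_delta c k n : (k < n)%nat -> psum (fun i => if Nat.eqb i k then c else 0) n = c.
Proof.
  assert (Z : forall m, (m <= k)%nat -> psum (fun i => if Nat.eqb i k then c else 0) m = 0).
  { induction m as [|m IH]; intros H; simpl; [reflexivity|].
    rewrite IH by lia. destruct (Nat.eqb_spec m k); [lia|lra]. }
  induction n as [|n IH]; intros H; simpl; [lia|].
  destruct (Nat.eqb_spec n k) as [->|ne].
  - rewrite Z by lia. lra.
  - rewrite IH by lia. lra.
Qed.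

Lemma psum_plus f g n : psum (fun i => f i + g i) n = psum f n + psum g n.
Proof. induction n as [|n IH]; simpl; [lra|rewrite IH; lra]. Qed.

(** * Prime powers and the von Mangoldt function *)

Module PrimeArith.
Import all_boot.

(** A boolean test through the least prime factor, so that [mangoldt] is a plain case distinction in
    which [pdiv d] is the underlying prime. *)
Definition is_prime_power (d : nat) : bool := (1 < d)%N && (d == pdiv d ^ logn (pdiv d) d)%N.
Definition mangoldt (d : nat) : R := if is_prime_power d then ln (INR (pdiv d)) else 0.

Lemma is_prime_powerP d : reflect (exists p k, prime p /\ d = (p ^ k.+1)%N) (is_prime_power d).
Proof.
apply: (iffP andP) => [[d1 /eqP e]|[p [k [pp ->]]]].
  exists (pdiv d), (logn (pdiv d) d).-1; split; first exact: pdiv_prime.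
  rewrite prednK //; rewrite logn_gt0 mem_primes pdiv_prime // pdiv_dvd andbT /=.
  exact: ltnW.
have p1 := prime_gt1 pp.
rewrite pdiv_pfactor // pfactorK //; split=> //.
by rewrite -(exp1n k.+1) ltn_exp2r.
Qed.

Lemma mangoldt_pfactor p k : prime p -> mangoldt (p ^ k.+1)%N = ln (INR p).
Proof.
move=> pp; rewrite /mangoldt ifT; last by apply/is_prime_powerP; exists p, k.
by rewrite pdiv_pfactor.
Qed.

Lemma mangoldt_not_prime_power d : is_prime_power d = false -> mangoldt d = 0.
Proof. by rewrite /mangoldt => ->. Qed.

Lemma INR_expn p k : INR (p ^ k)%N = INR p ^ k.
Proof.
elim: k => [|k IH]; first by [].
by rewrite expnS -multE mult_INR IH.
Qed.

Lemma expn_pow p k : (p ^ k)%N = Nat.pow p k.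
Proof. by elim: k => // k IH; rewrite expnS IH -multE. Qed.

Lemma prime_INR p : prime p -> 1 < INR p.
Proof. by move=> /prime_gt1 /ltP h; rewrite -INR_1; apply: lt_INR. Qed.

Lemma mangoldt_ge0 d : 0 <= mangoldt d.
Proof.
rewrite /mangoldt; case: ifP => [/andP[d1 _]|_]; last exact: Rle_refl.
have h := prime_INR _ (pdiv_prime d1).
rewrite -ln_1; apply: Rlt_le; apply: ln_increasing => //; lra.
Qed.

Lemma mangoldt_le d : (0 < d)%coq_nat -> mangoldt d <= ln (INR d).
Proof.
move=> d0; case h : (is_prime_power d).
  move/is_prime_powerP: h => [p [k [pp ->]]]; rewrite mangoldt_pfactor // INR_expn.
  have h := prime_INR _ pp.
  have h1 : 1 <= INR p ^ k by apply: pow_R1_Rle; lra.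
  case: (Req_dec (INR p ^ k.+1) (INR p)) => [->|ne]; first exact: Rle_refl.
  apply: Rlt_le; apply: ln_increasing; first lra.
  have : INR p <= INR p ^ k.+1 by rewrite /=; nra.
  lra.
rewrite mangoldt_not_prime_power // -ln_1.
have : 1 <= INR d by apply: (le_INR 1).
case=> [hl|<-]; last exact: Rle_refl.
apply: Rlt_le; apply: ln_increasing => //; lra.
Qed.

Definition dvd (d n : nat) : bool := (d %| n)%N.

Lemma dvdE d n : dvd d n = true <-> Nat.divide d n.
Proof.
rewrite /dvd; split=> [/dvdnP[k ->]|[k ->]]; first by exists k.
by apply/dvdnP; exists k.
Qed.

(* Passing from m to p * m adds exactly one prime power divisor, the next power of p. *)
Lemma ln_eq_sum_mangoldt N n : (0 < n)%coq_nat -> (n < N)%coq_nat ->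
  psum (fun d => if dvd d n then mangoldt d else 0) N = ln (INR n).
Proof.
elim/ltn_ind: n => n IH n0 nN.
have [n1|n1] := leqP n 1.
  have -> : n = 1%N by apply/eqP; rewrite eqn_leq n1; apply/leP.
  rewrite /= ln_1.
  transitivity (psum (fun=> 0) N).
    apply: psum_ext => i _; rewrite /dvd dvdn1; case: eqP => // ->.
    by rewrite mangoldt_not_prime_power.
  by elim: (N) => //= k ->; lra.
set p := pdiv n; set m := (n %/ p)%N.
have pp : prime p by exact: pdiv_prime.
have nE : n = (p * m)%N by rewrite mulnC /m divnK // pdiv_dvd.
have m0 : (0 < m)%N by move/leP: n0; rewrite nE muln_gt0 => /andP[].
have mn : (m < n)%N by rewrite nE -{1}(mul1n m) ltn_pmul2r // prime_gt1.
set v := logn p m.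
have pvn : ((p ^ v.+1)%N < N)%coq_nat.
  apply: (Nat.le_lt_trans _ n) => //; apply/leP.
  rewrite nE expnS leq_mul2l; apply/orP; right.
  by apply: dvdn_leq => //; rewrite pfactor_dvdn.
rewrite (psum_ext _ (fun d => (if dvd d m then mangoldt d else 0)
    + (if Nat.eqb d (p ^ v.+1)%N then ln (INR p) else 0))); last first.
  move=> d _; case h : (is_prime_power d); last first.
    rewrite mangoldt_not_prime_power //.
    have -> : Nat.eqb d (p ^ v.+1)%N = false.
      apply/negP => /Nat.eqb_eq dE; move/is_prime_powerP: h; apply.
      by exists p, v.
    by case: ifP; case: ifP => *; lra.
  move/is_prime_powerP: h => [q [k [pq ->]]].
  rewrite mangoldt_pfactor // /dvd !pfactor_dvdn //; last by apply/leP.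
  have -> : logn q n = ((p == q) + logn q m)%N by rewrite nE (lognM q (prime_gt0 pp) m0); move: (logn_prime q pp) => ->; rewrite eq_sym.
  case: (eqVneq p q) => [<-|npq] /=.
    rewrite add1n -/v.
    have -> : Nat.eqb (p ^ k.+1)%N (p ^ v.+1)%N = (k == v).
      apply/idP/eqP => [/Nat.eqb_eq /eqP|->]; last exact: Nat.eqb_refl.
      by rewrite eqn_exp2l ?prime_gt1 // => /eqP [].
    rewrite ltnS leq_eqVlt; case: eqP => [->|_] /=.
      by rewrite ltnn; lra.
    by case: ifP => *; lra.
  rewrite add0n.
  have -> : Nat.eqb (q ^ k.+1)%N (p ^ v.+1)%N = false.
    apply/negP => /Nat.eqb_eq e.
    have : (q %| p ^ v.+1)%N by rewrite -e expnS dvdn_mulr.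
    by rewrite Euclid_dvdX // dvdn_prime2 // => /andP[/eqP qp _]; move/eqP: npq; rewrite qp.
  by case: ifP => *; lra.
rewrite psum_plus psum_delta // IH //; last 2 first.
- by apply/ltP.
- by apply: (Nat.lt_trans _ n) => //; apply/ltP.
have h1 := prime_INR _ pp.
have h2 : 0 < INR m by apply: (lt_INR 0); apply/ltP.
rewrite nE -multE mult_INR ln_mult //; lra.
Qed.

(** * Primes congruent to 1 modulo 4 are sums of two squares *)

(** The last j factors of (p-1)! are the numbers p - i with 1 <= i <= j, each congruent to -i modulo
    p; [z] collects the multiples of p. *)
Lemma fact_split p j : (0 < p)%N -> (j < p)%N ->
  exists z : Z, Z.of_nat (p.-1)`! =
    (Z.of_nat (p.-1 - j)`! * Z.of_nat j`! * (-1) ^ Z.of_nat j + Z.of_nat p * z)%Z.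
Proof.
move=> p0; elim: j => [|j IH] jp; first by exists 0%Z; rewrite subn0 /=; lia.
have [z hz] := IH (ltnW jp).
have e : (p.-1 - j = (p.-1 - j.+1).+1)%N by rewrite subnS prednK // subn_gt0 -ltnS prednK.
have eF : Z.of_nat (p.-1 - j)`! = ((Z.of_nat p - Z.of_nat j.+1) * Z.of_nat (p.-1 - j.+1)`!)%Z.
  rewrite {1}e factS -multE Nat2Z.inj_mul; congr (_ * _)%Z.
  move: e jp p0; rewrite -!minusE => e /ltP jp /ltP p0; lia.
have eG : Z.of_nat (j.+1)`! = (Z.of_nat j.+1 * Z.of_nat j`!)%Z.
  by rewrite factS -multE Nat2Z.inj_mul.
have eP : ((-1) ^ Z.of_nat j.+1 = - (-1) ^ Z.of_nat j)%Z.
  by rewrite Nat2Z.inj_succ Z.pow_succ_r; lia.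
exists (z + Z.of_nat (p.-1 - j.+1)`! * Z.of_nat j`! * (-1) ^ Z.of_nat j)%Z.
rewrite hz eF eG eP; ring.
Qed.

(** For p = 4k + 1, [fact_split] with j = 2k gives (p-1)! = ((2k)!)^2 modulo p, and Wilson's theorem
    gives -1 for the left-hand side. *)
Lemma sqrt_m1 p : prime p -> (p %% 4 = 1)%N ->
  exists x z : Z, (x * x + 1 = Z.of_nat p * z)%Z.
Proof.
move=> pp p4; have p1 := prime_gt1 pp; have p0 := ltnW p1.
set k := (p %/ 4)%N.
have pE : p = (k * 4).+1 by rewrite {1}(divn_eq p 4) p4 addn1.
have jp : (k.*2 < p)%N by rewrite pE ltnS -mul2n mulnC leq_mul2l orbT.
have [z hz] := fact_split p k.*2 p0 jp.
have : (p.-1 - k.*2 = k.*2)%N.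
  by rewrite pE /= -!muln2 -mulnBr.
move=> eK; rewrite eK in hz.
move: (p1); move/Wilson => W; move: pp; rewrite W => /dvdnP[q hq].
have sg : ((-1) ^ Z.of_nat k.*2 = 1)%Z.
  rewrite -mul2n -multE Nat2Z.inj_mul Z.pow_mul_r; [|lia|lia].
  by apply: Z.pow_1_l; lia.
rewrite sg in hz.
exists (Z.of_nat (k.*2)`!), (Z.of_nat q - z)%Z.
have hq' : (Z.of_nat (p.-1)`! + 1 = Z.of_nat q * Z.of_nat p)%Z.
  by rewrite -Nat2Z.inj_mul multE -hq Nat2Z.inj_succ; lia.
lia.
Qed.

(** Thue's argument: there are (s+1)^2 > p pairs (i, j), hence more pairs than residues. *)
Lemma pigeonhole_mod (p s x : nat) : (0 < p)%N -> (p < s.+1 * s.+1)%N ->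
  exists i j i' j' : nat, [/\ (i <= s)%coq_nat, (j <= s)%coq_nat, (i' <= s)%coq_nat,
     (j' <= s)%coq_nat & (i, j) <> (i', j') /\ (i + x * j = i' + x * j' %[mod p])%N].
Proof.
case: p => // p _ hs.
pose f (ij : 'I_s.+1 * 'I_s.+1) : 'I_p.+1 := inord ((ij.1 + x * ij.2) %% p.+1)%N.
have : ~ injective f.
  by move=> /leq_card; rewrite card_prod !card_ord leqNgt hs.
move/injectiveP/injectivePn => [[i j] [[i' j'] ne e]].
exists i, j, i', j'; split; try by apply/leP; rewrite -ltnS.
split; first by case=> /val_inj ei /val_inj ej; move/eqP: ne; rewrite ei ej.
by move/(congr1 val): e; rewrite /= !inordK ?ltn_pmod.
Qed.

Lemma modn_modulo n d : (0 < d)%N -> (n %% d)%N = Nat.modulo n d.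
Proof.
move=> d0; apply: (Nat.mod_unique _ _ (n %/ d)%N).
  by apply/ltP; rewrite ltn_mod.
by rewrite {1}(divn_eq n d) -plusE -multE Nat.mul_comm.
Qed.

(** With x^2 = -1 modulo p, Thue's pairs give small a, b, not both zero, with a + x b = 0 modulo p.
    Then p divides a^2 + b^2, which lies strictly between 0 and 2p. *)
Lemma two_squares p : prime p -> Nat.modulo p 4 = 1%N ->
  exists a b : Z, (a * a + b * b = Z.of_nat p)%Z.
Proof.
rewrite -modn_modulo // => pp p4; have p1 := prime_gt1 pp; have p0 := ltnW p1.
have [x0 [z0 hx0]] := sqrt_m1 p pp p4.
have [x [z hx]] : exists (x : nat) (z : Z), (Z.of_nat x * Z.of_nat x + 1 = Z.of_nat p * z)%Z.
  exists (Z.abs_nat x0), z0; rewrite Zabs2Nat.id_abs -hx0; nia.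
set s := Nat.sqrt p; have [s1 s2] := Nat.sqrt_spec p (Nat.le_0_l _).
have s2' : (p < s.+1 * s.+1)%N by apply/ltP; rewrite -multE.
have [i [j [i' [j' [hi hj hi' hj' [ne e]]]]]] := pigeonhole_mod p s x p0 s2'.
(* A prime is not a square; strictness here is what makes a^2 + b^2 < 2p. *)
have ss : (s * s < p)%coq_nat.
  case: (Nat.lt_eq_cases (s * s)%coq_nat p) => /(_ s1) [//|eq] _.
  exfalso; move: pp; rewrite -eq multE -/(s ^ 2)%N => /primeP[_ h].
  have := h s; rewrite dvdn_mulr // => /(_ isT) /orP[/eqP s1'|/eqP sE].
    by move: p1; rewrite -eq s1'.
  move: p1; rewrite -eq multE -sE => /ltP h1; have := sE; rewrite -multE; nia.
have [w hw] : exists w : Z, (Z.of_nat i - Z.of_nat i' + Z.of_nat x * (Z.of_nat j - Z.of_nat j') = Z.of_nat p * w)%Z.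
  exists (Z.of_nat ((i + x * j) %/ p)%N - Z.of_nat ((i' + x * j') %/ p)%N)%Z.
  have h1 := f_equal Z.of_nat (divn_eq (i + x * j) p).
  have h2 := f_equal Z.of_nat (divn_eq (i' + x * j') p).
  rewrite e in h1; rewrite -!plusE -!multE !Nat2Z.inj_add !Nat2Z.inj_mul in h1 h2.
  rewrite -!plusE -!multE; lia.
set a := (Z.of_nat i - Z.of_nat i')%Z in hw; set b := (Z.of_nat j - Z.of_nat j')%Z in hw.
exists a, b.
(* The cofactor is read off from a^2 + b^2 = (a + x b) (a - x b) + (x^2 + 1) b^2. *)
set t := (w * (a - Z.of_nat x * b) + z * (b * b))%Z.
have ht : (a * a + b * b = Z.of_nat p * t)%Z.
  rewrite /t Z.mul_add_distr_l !Z.mul_assoc -hw -hx; ring.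
have nz : (0 < a * a + b * b)%Z.
  have : a <> 0%Z \/ b <> 0%Z.
    case: (Z.eq_dec a 0) => ha; last by left.
    right=> hb; apply: ne; rewrite /a /b in ha hb; congr (_, _); lia.
  nia.
have ha : (- Z.of_nat s <= a <= Z.of_nat s)%Z by rewrite /a; lia.
have hb : (- Z.of_nat s <= b <= Z.of_nat s)%Z by rewrite /b; lia.
have hs : (Z.of_nat s * Z.of_nat s < Z.of_nat p)%Z by rewrite -Nat2Z.inj_mul; apply: (proj1 (Nat2Z.inj_lt _ _)).
have h1 : (a * a <= Z.of_nat s * Z.of_nat s)%Z by nia.
have h2 : (b * b <= Z.of_nat s * Z.of_nat s)%Z by nia.
have : t = 1%Z by nia.
by move=> t1; rewrite ht t1; lia.
Qed.

Lemma prime_div_mul p (x y : Z) : prime p -> (Z.of_nat p | x * y)%Z ->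
  (Z.of_nat p | x)%Z \/ (Z.of_nat p | y)%Z.
Proof.
have cv z : (Z.of_nat p | z)%Z <-> (p %| Z.abs_nat z)%N.
  rewrite -Z.divide_abs_r -Zabs2Nat.id_abs; split=> [[k hk]|/dvdnP[k ->]].
    apply/dvdnP; exists (Z.abs_nat k); apply: Nat2Z.inj.
    by rewrite -multE Nat2Z.inj_mul Zabs2Nat.id_abs; nia.
  by exists (Z.of_nat k); rewrite -multE Nat2Z.inj_mul.
rewrite !cv Zabs2Nat.inj_mul multE => pp.
by rewrite Euclid_dvdM // => /orP.
Qed.

End PrimeArith.

Import PrimeArith.

(** * Chebyshev and Mertens estimates modulo 4 *)

Lemma psum_le f g n : (forall i, (i < n)%nat -> f i <= g i) -> psum f n <= psum g n.
Proof.
  induction n as [|n IH]; intros H; simpl; [lra|].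
  apply Rplus_le_compat; [apply IH; intros|]; apply H; lia.
Qed.

Lemma psum_scal c f n : psum (fun i => c * f i) n = c * psum f n.
Proof. induction n as [|n IH]; simpl; [ring|rewrite IH; ring]. Qed.

Lemma psum_minus f g n : psum (fun i => f i - g i) n = psum f n - psum g n.
Proof. induction n as [|n IH]; simpl; [lra|rewrite IH; lra]. Qed.

Lemma psum_0 n : psum (fun _ => 0) n = 0.
Proof. induction n as [|n IH]; simpl; [|rewrite IH]; lra. Qed.

Lemma psum_const c n : psum (fun _ => c) n = INR n * c.
Proof. induction n as [|n IH]; [simpl; lra|]. rewrite S_INR; simpl psum; rewrite IH; ring. Qed.

Lemma psum_nonneg f n : (forall i, (i < n)%nat -> 0 <= f i) -> 0 <= psum f n.
Proof. intros H. rewrite <- (psum_0 n). apply psum_le, H. Qed.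

Lemma psum_abs f n : Rabs (psum f n) <= psum (fun i => Rabs (f i)) n.
Proof.
  induction n as [|n IH]; simpl; [rewrite Rabs_R0; lra|].
  eapply Rle_trans; [apply Rabs_triang|lra].
Qed.

Lemma psum_swap (f : nat -> nat -> R) n m :
  psum (fun i => psum (f i) m) n = psum (fun j => psum (fun i => f i j) n) m.
Proof.
  induction n as [|n IH]; simpl; [now rewrite psum_0|].
  now rewrite IH, psum_plus.
Qed.

Lemma psum_split f n k : psum f (n + k) = psum f n + psum (fun i => f (n + i)%nat) k.
Proof.
  induction k as [|k IH]; [rewrite Nat.add_0_r; simpl; lra|].
  rewrite Nat.add_succ_r; simpl; rewrite IH; lra.
Qed.

Lemma psum_above g n m : (n <= m)%nat ->
  psum (fun d => if Nat.ltb d n then 0 else g d) m = psum g m - psum g n.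
Proof.
  intros H. replace m with (n + (m - n))%nat by lia. rewrite !psum_split.
  rewrite (psum_ext _ (fun _ => 0) n), psum_0.
  2:{ intros i Hi. destruct (Nat.ltb_spec i n); [reflexivity|lia]. }
  rewrite (psum_ext _ (fun i => g (n + i)%nat) (m - n)); [lra|].
  intros i Hi. destruct (Nat.ltb_spec (n + i) n); [lia|reflexivity].
Qed.


Lemma mangoldt_0 : mangoldt 0 = 0.
Proof. reflexivity. Qed.

Lemma psum_multiples f d N : (0 < d)%nat ->
  psum (fun i => if dvd d (S i) then f (S i) else 0) N = psum (fun m => f (d * S m)%nat) (N / d).
Proof.
  intros Hd. induction N as [|N IH]; [now rewrite Nat.Div0.div_0_l|].
  simpl psum; rewrite IH.
  destruct (dvd d (S N)) eqn:E.
  - apply dvdE in E. destruct E as [c Hc]. destruct c as [|c]; [lia|].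
    assert (E1 : (S N / d = S c)%nat) by (rewrite Hc; apply Nat.div_mul; lia).
    assert (E2 : (N / d = c)%nat).
    { symmetry; apply Nat.div_unique with (r := (d - 1)%nat); [lia|]. nia. }
    rewrite E1, E2. simpl psum. do 2 f_equal. lia.
  - assert (E2 : (N / d = S N / d)%nat); [|rewrite E2; lra].
    symmetry; apply Nat.div_unique with (r := (S N mod d - 1)%nat).
    + pose proof (Nat.mod_upper_bound (S N) d ltac:(lia)); lia.
    + assert (S N mod d <> 0)%nat.
      { intros Z. apply Nat.Lcm0.mod_divide in Z. apply dvdE in Z. congruence. }
      pose proof (Nat.div_mod_eq (S N) d). lia.
Qed.

(** Insert ln n as the sum of [mangoldt d] over d | n and exchange the sums; for d > N the inner sum
    is empty. The cases f = 1, f = [odd_ind] and f(n) = [chi n] / n give the Chebyshev bound and the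
    two Mertens sums. *)
Lemma sum_f_ln f N M : (N < M)%nat ->
  psum (fun i => f (S i) * ln (INR (S i))) N =
  psum (fun d => mangoldt d * psum (fun m => f (d * S m)%nat) (N / d)) M.
Proof.
  intros HM.
  rewrite (psum_ext _ (fun i => psum (fun d => if dvd d (S i) then mangoldt d * f (S i) else 0) M)).
  - rewrite psum_swap. apply psum_ext. intros d _.
    destruct d as [|d].
    + rewrite mangoldt_0, Rmult_0_l. transitivity (psum (fun _ => 0) N); [|apply psum_0]. apply psum_ext; intros i _.
      destruct (dvd 0 (S i)); rewrite ?mangoldt_0; ring.
    + rewrite <- (psum_multiples f) by lia. rewrite <- psum_scal.
      apply psum_ext; intros i _. destruct (dvd (S d) (S i)); ring.
  - intros i Hi. rewrite <- (ln_eq_sum_mangoldt M (S i)) by lia.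
    rewrite <- psum_scal. apply psum_ext; intros d _. destruct (dvd d (S i)); ring.
Qed.

Lemma ln_le_sub1 x : 0 < x -> ln x <= x - 1.
Proof. intros H. pose proof (exp_ineq1_le (ln x)). rewrite exp_ln in H0; lra. Qed.

Lemma ln_nonneg x : 1 <= x -> 0 <= ln x.
Proof.
  intros [H|H]; [|subst; rewrite ln_1; lra].
  rewrite <- ln_1; apply Rlt_le, ln_increasing; lra.
Qed.

Lemma ln_mono x y : 0 < x -> x <= y -> ln x <= ln y.
Proof. intros H [H1|H1]; [apply Rlt_le, ln_increasing; lra|subst; lra]. Qed.

Lemma INR_S_ge1 n : 1 <= INR (S n).
Proof. rewrite S_INR; pose proof (pos_INR n); lra. Qed.

(** Chebyshev's function; [psum] stops before its upper bound, hence [S N]. *)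
Definition psi (N : nat) : R := psum mangoldt (S N).

Definition lnfact (N : nat) : R := psum (fun i => ln (INR (S i))) N.

Lemma lnfact_mangoldt N M : (N < M)%nat -> lnfact N = psum (fun d => mangoldt d * INR (N / d)) M.
Proof.
  intros H. unfold lnfact. rewrite (psum_ext _ (fun i => 1 * ln (INR (S i)))) by (intros; ring).
  rewrite (sum_f_ln (fun _ => 1) N M H). apply psum_ext; intros. rewrite psum_const; ring.
Qed.

(** The left-hand side is the logarithm of the central binomial coefficient; each step of the
    induction adds at most 2 ln 2. *)
Lemma lnfact_double N : lnfact (2 * N) - 2 * lnfact N <= 3 * INR N.
Proof.
  induction N as [|N IH]; [unfold lnfact; simpl; lra|].
  replace (2 * S N)%nat with (S (S (2 * N))) by lia.
  unfold lnfact in *. cbn [psum].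
  assert (H1 : ln (INR (S (2 * N))) <= ln (2 * INR (S N))).
  { apply ln_mono; rewrite !S_INR, ?mult_INR; simpl INR; pose proof (pos_INR N); lra. }
  assert (H2 : ln (INR (S (S (2 * N)))) = ln (2 * INR (S N))).
  { f_equal. rewrite !S_INR, mult_INR; simpl INR; lra. }
  pose proof (INR_S_ge1 N) as H3.
  rewrite ln_mult in H1, H2 by lra.
  assert (H4 : ln 2 <= 1) by (pose proof (ln_le_sub1 2); lra).
  replace (3 * INR (S N)) with (3 * INR N + 3) by (rewrite S_INR; ring). rewrite H2. lra.
Qed.

(** The integer floor(2N/d) - 2 floor(N/d) is never negative and is at least 1 for N < d <= 2N, so
    [lnfact_double] bounds the sum of [mangoldt] over that range. *)
Lemma psi_double N : psi (2 * N) <= psi N + 3 * INR N.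
Proof.
  pose proof (lnfact_double N) as H.
  rewrite (lnfact_mangoldt (2 * N) (S (2 * N))), (lnfact_mangoldt N (S (2 * N))) in H by lia.
  rewrite <- psum_scal, <- psum_minus in H.
  assert (H1 : psum (fun d => if Nat.ltb d (S N) then 0 else mangoldt d) (S (2 * N)) <=
     psum (fun i => mangoldt i * INR (2 * N / i) - 2 * (mangoldt i * INR (N / i))) (S (2 * N))).
  { apply psum_le. intros d Hd. pose proof (mangoldt_ge0 d).
    destruct d as [|d]; [rewrite mangoldt_0; simpl; lra|].
    assert (H2 : 2 * INR (N / S d) <= INR (2 * N / S d)).
    { change 2 with (INR 2). rewrite <- mult_INR. apply le_INR.
      apply Nat.div_le_lower_bound; [lia|].
      pose proof (Nat.Div0.mul_div_le N (S d)). nia. }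
    destruct (Nat.ltb_spec (S d) (S N)); [nra|].
    assert (H3 : (N / S d = 0)%nat) by (apply Nat.div_small; lia).
    assert (H4 : 1 <= INR (2 * N / S d)).
    { apply (le_INR 1). apply Nat.div_le_lower_bound; lia. }
    rewrite H3. change (INR 0) with 0. nra. }
  rewrite psum_above in H1 by lia. unfold psi. lra.
Qed.

Lemma psi_mono a b : (a <= b)%nat -> psi a <= psi b.
Proof.
  intros H. unfold psi. replace (S b) with (S a + (b - a))%nat by lia. rewrite psum_split.
  assert (0 <= psum (fun i => mangoldt (S a + i)) (b - a)) by (apply psum_nonneg; intros; apply mangoldt_ge0).
  lra.
Qed.

Lemma psi_le N : psi N <= 6 * INR N.
Proof.
  induction N as [N IH] using (well_founded_induction lt_wf).
  destruct (Nat.le_gt_cases N 1) as [H|H].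
  { assert (N = 0 \/ N = 1)%nat as [->| ->] by lia; unfold psi; cbn [psum];
      rewrite ?mangoldt_0; [simpl; lra|].
    replace (mangoldt 1) with 0 by reflexivity. simpl; lra. }
  destruct (Nat.Even_or_Odd N) as [[m ->]|[m ->]].
  - eapply Rle_trans; [apply psi_double|]. specialize (IH m ltac:(lia)).
    rewrite mult_INR; simpl (INR 2). pose proof (pos_INR m). lra.
  (* An odd N = 2m + 1 is rounded up to 2 (m + 1); the resulting 9 (m + 1) is at most 6 (2m + 1)
     because m >= 1. *)
  - eapply Rle_trans; [apply (psi_mono _ (2 * (m + 1))); lia|].
    eapply Rle_trans; [apply psi_double|]. specialize (IH (m + 1)%nat ltac:(lia)).
    rewrite !plus_INR, ?mult_INR in *; simpl INR in *.
    assert (1 <= INR m) by (apply (le_INR 1); lia). lra.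
Qed.

(** The principal character modulo 4. *)
Definition odd_ind (n : nat) : R := if Nat.odd n then 1 else 0.

Lemma odd_ind_mul a b : odd_ind (a * b) = odd_ind a * odd_ind b.
Proof. unfold odd_ind; rewrite Nat.odd_mul. destruct (Nat.odd a), (Nat.odd b); simpl; ring. Qed.

Lemma odd_ind_bound n : 0 <= odd_ind n <= 1.
Proof. unfold odd_ind; destruct (Nat.odd n); lra. Qed.

Lemma odd_count q : INR q / 2 <= psum (fun m => odd_ind (S m)) q <= (INR q + 1) / 2.
Proof.
  assert (H : psum (fun m => odd_ind (S m)) q = (INR q + odd_ind q) / 2).
  { induction q as [|q IH]; [unfold odd_ind; simpl; lra|].
    rewrite S_INR; cbn [psum]; rewrite IH. unfold odd_ind.
    rewrite Nat.odd_succ, <- Nat.negb_odd. destruct (Nat.odd q); simpl; lra. }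
  rewrite H. pose proof (odd_ind_bound q). lra.
Qed.

Lemma INR_div N d : (0 < d)%nat ->
  INR (N / d) <= INR N / INR d < INR (N / d) + 1.
Proof.
  intros H. assert (Hd : 0 < INR d) by (apply (lt_INR 0); lia).
  pose proof (Nat.div_mod_eq N d) as E. pose proof (Nat.mod_upper_bound N d ltac:(lia)) as B.
  apply lt_INR in B. apply (f_equal INR) in E. rewrite plus_INR, mult_INR in E.
  pose proof (pos_INR (N mod d)).
  split.
  - apply Rmult_le_reg_r with (INR d); [lra|]. unfold Rdiv. rewrite Rmult_assoc, Rinv_l by lra. lra.
  - apply Rmult_lt_reg_r with (INR d); [lra|]. unfold Rdiv. rewrite Rmult_assoc, Rinv_l by lra. lra.
Qed.

Lemma lnfact_lower N : INR N * ln (INR N) - INR N <= lnfact N.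
Proof.
  induction N as [|N IH]; [unfold lnfact; simpl; lra|].
  unfold lnfact in *; cbn [psum].
  destruct N as [|N]; [simpl; rewrite ln_1; lra|].
  pose proof (INR_S_ge1 N) as H1. rewrite (S_INR (S N)).
  set (x := INR (S N)) in *.
  assert (H2 : ln (x + 1) <= ln x + / x).
  { replace (x + 1) with (x * (1 + / x)) by (field; lra).
    assert (0 < / x) by (apply Rinv_0_lt_compat; lra).
    rewrite ln_mult by lra. pose proof (ln_le_sub1 (1 + / x)); lra. }
  assert (H3 : x * ln (x + 1) <= x * ln x + 1).
  { apply Rmult_le_compat_l with (r := x) in H2; [|lra].
    rewrite Rmult_plus_distr_l, Rinv_r in H2 by lra. lra. }
  lra.
Qed.

(** The sum [T] of ln n over odd n <= N is evaluated twice: directly it is (N/2) ln N up to O(N),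
    and through [sum_f_ln] it is (N/2) [P] with an error of at most psi(N) / 2, since the number of
    odd m <= N/d differs from N/(2d) by at most 1/2. *)
Lemma odd_mertens N : (1 <= N)%nat ->
  Rabs (psum (fun d => odd_ind d * mangoldt d / INR d) (S N) - ln (INR N)) <= 9.
Proof.
  intros HN. assert (N1 : 1 <= INR N) by (apply (le_INR 1); lia).
  set (P := psum (fun d => odd_ind d * mangoldt d / INR d) (S N)).
  set (T := psum (fun i => odd_ind (S i) * ln (INR (S i))) N).
  assert (HT : Rabs (T - INR N / 2 * P) <= psi N / 2).
  { unfold T. rewrite (sum_f_ln _ N (S N)) by lia. unfold P. rewrite <- psum_scal, <- psum_minus.
    eapply Rle_trans; [apply psum_abs|].
    replace (psi N / 2) with (/ 2 * psi N) by lra. unfold psi. rewrite <- psum_scal.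
    apply psum_le. intros d _. destruct d as [|d]; [rewrite mangoldt_0; unfold Rdiv; rewrite !Rmult_0_r, !Rmult_0_l, Rmult_0_r, Rminus_0_r, Rabs_R0; lra|].
    rewrite (psum_ext _ (fun m => odd_ind (S d) * odd_ind (S m))) by (intros; apply odd_ind_mul).
    rewrite psum_scal. pose proof (odd_count (N / S d)) as C.
    pose proof (INR_div N (S d) ltac:(lia)) as D.
    pose proof (mangoldt_ge0 (S d)) as L. pose proof (odd_ind_bound (S d)) as O.
    replace (mangoldt (S d) * (odd_ind (S d) * psum (fun m => odd_ind (S m)) (N / S d)) -
      INR N / 2 * (odd_ind (S d) * mangoldt (S d) / INR (S d))) with
      ((mangoldt (S d) * odd_ind (S d)) *
       (psum (fun m => odd_ind (S m)) (N / S d) - (INR N / INR (S d)) / 2))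
      by (field; apply not_0_INR; lia).
    rewrite Rabs_mult, Rabs_pos_eq by nra.
    apply Rle_trans with (mangoldt (S d) * 1 * / 2); [|lra].
    apply Rmult_le_compat; [nra|apply Rabs_pos|nra|].
    apply Rabs_le. lra. }
  assert (U : T <= (INR N + 1) / 2 * ln (INR N)).
  { apply Rle_trans with (psum (fun i => ln (INR N) * odd_ind (S i)) N).
    - apply psum_le. intros i Hi. rewrite Rmult_comm. apply Rmult_le_compat_r; [apply odd_ind_bound|].
      apply ln_mono; [pose proof (INR_S_ge1 i); lra|apply le_INR; lia].
    - rewrite psum_scal. pose proof (odd_count N). pose proof (ln_nonneg _ N1). nra. }
  assert (Lw : INR N / 2 * ln (INR N) - INR N <= T).
  { assert (psum (fun i => odd_ind (S i) * (ln (INR N) - ln (INR (S i)))) N <= INR N).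
    { apply Rle_trans with (psum (fun i => ln (INR N) - ln (INR (S i))) N).
      - apply psum_le. intros i Hi.
        assert (ln (INR (S i)) <= ln (INR N))
          by (apply ln_mono; [pose proof (INR_S_ge1 i); lra|apply le_INR; lia]).
        pose proof (odd_ind_bound (S i)). nra.
      - rewrite psum_minus, psum_const. pose proof (lnfact_lower N). unfold lnfact in *. lra. }
    rewrite (psum_ext _ (fun i => ln (INR N) * odd_ind (S i) - odd_ind (S i) * ln (INR (S i)))) in H
      by (intros; ring).
    rewrite psum_minus, psum_scal in H. fold T in H.
    pose proof (odd_count N). pose proof (ln_nonneg _ N1). nra. }
  pose proof (psi_le N) as Hpsi.
  assert (l1 : ln (INR N) <= INR N) by (pose proof (ln_le_sub1 (INR N)); lra).
  apply Rabs_le_between in HT. apply Rabs_le_between. split.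
  - apply Rmult_le_reg_l with (INR N / 2); [lra|]. lra.
  - apply Rmult_le_reg_l with (INR N / 2); [lra|]. lra.
Qed.

(** The nonprincipal Dirichlet character modulo 4. *)
Definition chi (n : nat) : R :=
  match (n mod 4)%nat with 1%nat => 1 | 3%nat => -1 | _ => 0 end.

Lemma chi_mul a b : chi (a * b) = chi a * chi b.
Proof.
  unfold chi. rewrite Nat.Div0.mul_mod.
  pose proof (Nat.mod_upper_bound a 4 ltac:(lia)). pose proof (Nat.mod_upper_bound b 4 ltac:(lia)).
  set (x := (a mod 4)%nat) in *. set (y := (b mod 4)%nat) in *.
  destruct x as [|[|[|[|x]]]]; try lia; destruct y as [|[|[|[|y]]]]; try lia; simpl; lra.
Qed.

Lemma chi_abs n : Rabs (chi n) <= 1.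
Proof. unfold chi. apply Rabs_le. destruct (n mod 4)%nat as [|[|[|[|x]]]]; lra. Qed.

Lemma chi_odd n : (odd_ind n + chi n) / 2 = if Nat.eqb (n mod 4) 1 then 1 else 0.
Proof.
  unfold odd_ind, chi.
  assert (E : Nat.odd n = Nat.odd (n mod 4)).
  { rewrite (Nat.div_mod_eq n 4) at 1. rewrite Nat.odd_add, Nat.odd_mul. simpl.
    destruct (Nat.odd (n mod 4)); reflexivity. }
  rewrite E. pose proof (Nat.mod_upper_bound n 4 ltac:(lia)).
  destruct (n mod 4)%nat as [|[|[|[|x]]]]; simpl; try lra. lia.
Qed.

(** The nonzero values of [chi] alternate in sign, so a sum against decreasing nonnegative weights
    is dominated by its first weight. *)
Lemma chi_alternating (phi : nat -> R) k : forall a,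
  (forall n, (a <= n)%nat -> 0 <= phi (S n) <= phi n) ->
  Rabs (psum (fun i => chi (a + i) * phi (a + i)%nat) k) <= phi a.
Proof.
  intros a Hphi.
  (* The induction needs the sign as well: a sum starting at a residue 0 or 1 is nonnegative, one
     starting at 2 or 3 is nonpositive. *)
  enough (H : forall a', (a <= a')%nat ->
     let U := psum (fun i => chi (a' + i) * phi (a' + i)%nat) k in
     ((a' mod 4 < 2)%nat -> 0 <= U <= phi a') /\ ((2 <= a' mod 4)%nat -> - phi a' <= U <= 0)).
  { specialize (H a (le_n a)). cbv zeta in H. apply Rabs_le.
    assert (0 <= phi a) by (destruct (Hphi a); [lia|lra]).
    destruct H as [H1 H2]. destruct (Nat.lt_ge_cases (a mod 4) 2) as [C|C]; [specialize (H1 C)|specialize (H2 C)]; lra. }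
  induction k as [|k IH]; intros b Hb; cbv zeta.
  { simpl. destruct (Hphi b Hb). split; lra. }
  specialize (IH (S b) ltac:(lia)). cbv zeta in IH.
  assert (E : psum (fun i => chi (b + i) * phi (b + i)%nat) (S k) =
     chi b * phi b + psum (fun i => chi (S b + i) * phi (S b + i)%nat) k).
  { change (S k) with (1 + k)%nat. rewrite psum_split. simpl psum at 1. rewrite Nat.add_0_r.
    rewrite Rplus_0_l. f_equal. apply psum_ext. intros i _. now rewrite Nat.add_assoc, Nat.add_1_r. }
  rewrite E. set (U := psum _ k) in *. clearbody U.
  assert (M : (S b mod 4 = (S (b mod 4)) mod 4)%nat).
  { change (S b) with (1 + b)%nat. change (S (b mod 4)) with (1 + b mod 4)%nat.
    now rewrite Nat.Div0.add_mod_idemp_r. }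
  rewrite M in IH. unfold chi. destruct (Hphi b Hb) as [P1 P2].
  pose proof (Nat.mod_upper_bound b 4 ltac:(lia)).
  destruct (b mod 4)%nat as [|[|[|[|x]]]]; try lia;
   cbn [Nat.modulo Nat.divmod Nat.sub fst snd] in IH; destruct IH as [I1 I2];
   (split; intros; try lia);
   (try specialize (I1 ltac:(simpl; lia))); (try specialize (I2 ltac:(simpl; lia))); lra.
Qed.

(** Partial sums of L(1, chi). *)
Definition Lsum (q : nat) : R := psum (fun m => chi (S m) / INR (S m)) q.

Lemma inv_INR_decr n : (1 <= n)%nat -> 0 <= / INR (S n) <= / INR n.
Proof.
  intros H. assert (0 < INR n) by (apply (lt_INR 0); lia). rewrite S_INR. split.
  - apply Rlt_le, Rinv_0_lt_compat; lra.
  - apply Rinv_le_contravar; lra.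
Qed.

Lemma Lsum_tail q N : (q <= N)%nat -> Rabs (Lsum N - Lsum q) <= / INR (S q).
Proof.
  intros H. unfold Lsum. replace N with (q + (N - q))%nat by lia. rewrite psum_split.
  pose proof (chi_alternating (fun n => / INR n) (N - q) (S q)) as A.
  match goal with |- Rabs (?a + ?b - ?a) <= _ => replace (a + b - a) with b by ring end.
  apply A. intros n Hn. apply inv_INR_decr; lia.
Qed.

(** The nonvanishing of L(1, chi) in explicit form: the first two terms give 1, and the tail
    starting at 3 is at most 1/3. *)
Lemma Lsum_lower N : (2 <= N)%nat -> 2 / 3 <= Lsum N.
Proof.
  intros H. pose proof (Lsum_tail 2 N H) as T.
  unfold Lsum in T at 2. cbn [psum] in T. unfold chi in T. simpl in T.
  apply Rabs_le_between in T. lra.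
Qed.

Lemma ln_div_decr n : (3 <= n)%nat -> 0 <= ln (INR (S n)) / INR (S n) <= ln (INR n) / INR n.
Proof.
  intros H. assert (H3 : 3 <= INR n) by (apply (le_INR 3) in H; simpl in H; lra).
  rewrite S_INR. set (x := INR n) in *.
  pose proof (ln_nonneg (x + 1) ltac:(lra)) as L0.
  assert (L1 : 1 <= ln x).
  { rewrite <- (ln_exp 1). apply ln_mono; [apply exp_pos|]. pose proof exp_le_3. lra. }
  assert (H2 : ln (x + 1) <= ln x + / x).
  { replace (x + 1) with (x * (1 + / x)) by (field; lra).
    assert (0 < / x) by (apply Rinv_0_lt_compat; lra).
    rewrite ln_mult by lra. pose proof (ln_le_sub1 (1 + / x)); lra. }
  split.
  - apply Rmult_le_pos; [lra|]. apply Rlt_le, Rinv_0_lt_compat; lra.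
  - apply Rmult_le_reg_r with (x * (x + 1)); [nra|].
    replace (ln (x + 1) / (x + 1) * (x * (x + 1))) with (x * ln (x + 1)) by (field; lra).
    replace (ln x / x * (x * (x + 1))) with (x * ln x + ln x) by (field; lra).
    apply Rmult_le_compat_l with (r := x) in H2; [|lra].
    rewrite Rmult_plus_distr_l, Rinv_r in H2 by lra. lra.
Qed.

(** The first two terms vanish because ln 1 = 0 and chi(2) = 0. The rest starts at 3, from where on
    ln n / n decreases. *)
Lemma chi_ln_bounded N : (2 <= N)%nat ->
  Rabs (psum (fun i => chi (S i) / INR (S i) * ln (INR (S i))) N) <= 1.
Proof.
  intros H. replace N with (2 + (N - 2))%nat by lia. rewrite psum_split.
  replace (psum (fun i => chi (S i) / INR (S i) * ln (INR (S i))) 2) with 0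
    by (cbn [psum]; unfold chi; simpl; rewrite ln_1; lra).
  rewrite Rplus_0_l.
  rewrite (psum_ext _ (fun i => chi (3 + i) * (ln (INR (3 + i)) / INR (3 + i))))
    by (intros; simpl; unfold Rdiv; ring).
  eapply Rle_trans; [apply (chi_alternating (fun n => ln (INR n) / INR n))|].
  - intros n Hn. apply ln_div_decr; lia.
  - simpl. pose proof (ln_le_sub1 (1 + 1 + 1)). lra.
Qed.

(** By [sum_f_ln], the bounded sum of chi(n) ln n / n is the sum of chi(d) mangoldt(d) / d *
    [Lsum (N / d)]. Replacing [Lsum (N / d)] by [Lsum N] costs at most d/N per term, in total psi(N)
    / N <= 6. So |Lsum N * P| <= 7, and division by 2/3 gives 21/2. *)
Lemma chi_mertens N : (2 <= N)%nat ->
  Rabs (psum (fun d => chi d * mangoldt d / INR d) (S N)) <= 11.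
Proof.
  intros HN. assert (N1 : 2 <= INR N) by (apply (le_INR 2); lia).
  set (P := psum (fun d => chi d * mangoldt d / INR d) (S N)).
  pose proof (chi_ln_bounded N HN) as B. pose proof (Lsum_lower N HN) as L.
  rewrite (sum_f_ln (fun n => chi n / INR n) N (S N)) in B by lia.
  set (T := psum _ (S N)) in B.
  assert (HT : Rabs (T - Lsum N * P) <= 6).
  { apply Rle_trans with (/ INR N * psi N).
    2:{ pose proof (psi_le N). apply Rmult_le_reg_l with (INR N); [lra|].
        rewrite <- Rmult_assoc, Rinv_r by lra. lra. }
    unfold T, P, psi. rewrite <- !psum_scal, <- psum_minus.
    eapply Rle_trans; [apply psum_abs|]. apply psum_le. intros d Hd.
    destruct d as [|d]; [rewrite mangoldt_0; unfold Rdiv; rewrite !Rmult_0_r, !Rmult_0_l, Rmult_0_r, Rminus_0_r, Rabs_R0; lra|].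
    rewrite (psum_ext _ (fun m => chi (S d) / INR (S d) * (chi (S m) / INR (S m)))).
    2:{ intros m _. rewrite chi_mul, mult_INR. field. split; apply not_0_INR; lia. }
    rewrite psum_scal. fold (Lsum (N / S d)).
    assert (Hq : (N / S d <= N)%nat) by (apply Nat.div_le_upper_bound; nia).
    pose proof (Lsum_tail _ _ Hq) as Tl. pose proof (INR_div N (S d) ltac:(lia)) as D.
    pose proof (INR_S_ge1 d) as D1. pose proof (mangoldt_ge0 (S d)) as L0.
    replace (mangoldt (S d) * (chi (S d) / INR (S d) * Lsum (N / S d)) -
       Lsum N * (chi (S d) * mangoldt (S d) / INR (S d))) with
      (- (mangoldt (S d) / INR (S d)) * (chi (S d) * (Lsum N - Lsum (N / S d)))) by (field; lra).
    assert (0 <= mangoldt (S d) / INR (S d)).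
    { apply Rmult_le_pos; [lra|]. apply Rlt_le, Rinv_0_lt_compat; lra. }
    rewrite Rabs_mult, Rabs_Ropp, Rabs_pos_eq, Rabs_mult by lra.
    replace (/ INR N * mangoldt (S d)) with (mangoldt (S d) / INR (S d) * (1 * (INR (S d) * / INR N)))
      by (field; split; lra).
    apply Rmult_le_compat_l; [lra|].
    apply Rmult_le_compat; [apply Rabs_pos|apply Rabs_pos|apply chi_abs|].
    eapply Rle_trans; [apply Tl|]. rewrite (S_INR (N / S d)).
    replace (INR (S d) * / INR N) with (/ (INR N / INR (S d))) by (field; split; lra).
    apply Rinv_le_contravar; [|lra].
    apply Rmult_lt_0_compat; [lra|apply Rinv_0_lt_compat; lra]. }
  assert (Rabs (Lsum N * P) <= 7).
  { replace (Lsum N * P) with (T - (T - Lsum N * P)) by ring.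
    unfold Rminus at 1. eapply Rle_trans; [apply Rabs_triang|]. rewrite Rabs_Ropp. lra. }
  rewrite Rabs_mult, Rabs_pos_eq in H by lra. pose proof (Rabs_pos P). nra.
Qed.

Definition mangoldt_sum_1mod4 (N : nat) : R := psum (fun d => if Nat.eqb (d mod 4) 1 then mangoldt d / INR d else 0) (S N).

Lemma mertens_1mod4 N : (2 <= N)%nat -> Rabs (mangoldt_sum_1mod4 N - ln (INR N) / 2) <= 10.
Proof.
  intros HN. pose proof (chi_mertens N HN) as A. pose proof (odd_mertens N ltac:(lia)) as B.
  assert (E : mangoldt_sum_1mod4 N = / 2 * (psum (fun d => odd_ind d * mangoldt d / INR d) (S N) +
                        psum (fun d => chi d * mangoldt d / INR d) (S N))).
  { rewrite <- psum_plus, <- psum_scal. apply psum_ext. intros d _.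
    replace (/ 2 * _) with ((odd_ind d + chi d) / 2 * (mangoldt d / INR d)) by (unfold Rdiv; ring).
    rewrite chi_odd. destruct (Nat.eqb _ _); ring. }
  rewrite E. apply Rabs_le_between in A. apply Rabs_le_between in B. apply Rabs_le. lra.
Qed.

(** * Counting primes congruent to 1 modulo 4 *)

Lemma exp_ge_cube x : 0 <= x -> (x / 3) ^ 3 <= exp x.
Proof.
  intros H. replace x with (x / 3 + x / 3 + x / 3) at 2 by field. rewrite !exp_plus.
  pose proof (exp_ineq1_le (x / 3)). pose proof (exp_pos (x / 3)).
  replace ((x / 3) ^ 3) with (x / 3 * (x / 3) * (x / 3)) by ring.
  assert (0 <= x / 3) by lra.
  apply Rmult_le_compat; [nra|lra| |lra]. apply Rmult_le_compat; lra.
Qed.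

Lemma exp_dominates a C : 0 < a -> exists L0, 1 <= L0 /\ forall L, L0 <= L -> C * L ^ 2 <= exp (a * L).
Proof.
  (* The threshold solves (a L / 3)^3 >= |C| L^2. *)
  intros Ha. exists (Rmax 1 (27 * Rabs C / a ^ 3)). split; [apply Rmax_l|]. intros L HL.
  assert (H1 : 1 <= L) by (eapply Rle_trans; [apply Rmax_l|apply HL]).
  assert (H2 : 27 * Rabs C / a ^ 3 <= L) by (eapply Rle_trans; [apply Rmax_r|apply HL]).
  assert (a3 : 0 < a ^ 3) by (apply pow_lt; lra).
  eapply Rle_trans; [|apply exp_ge_cube; nra].
  replace ((a * L / 3) ^ 3) with (a ^ 3 * L / 27 * L ^ 2) by field.
  apply Rmult_le_compat_r; [nra|].
  apply Rmult_le_compat_r with (r := a ^ 3 / 27) in H2; [|lra].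
  replace (27 * Rabs C / a ^ 3 * (a ^ 3 / 27)) with (Rabs C) in H2 by (field; lra).
  pose proof (Rle_abs C). lra.
Qed.

Lemma psum_count (f : nat -> bool) a k :
  psum (fun i => if f (a + i)%nat then 1 else 0) k = INR (length (filter f (seq a k))).
Proof.
  induction k as [|k IH]; [reflexivity|].
  rewrite seq_S, filter_app, length_app, plus_INR, <- IH. simpl. destruct (f (a + k)%nat); simpl; lra.
Qed.

Lemma proper_prime_power_bound d N : is_prime_power d = true -> prime.prime d = false -> (d <= N)%nat ->
  exists p k, (p <= Nat.sqrt N)%nat /\ (k <= Nat.log2 N)%nat /\ d = (p ^ S (S k))%nat.
Proof.
  intros H H1 HN. destruct (is_prime_powerP d) as [[p [k [Hp Hd]]]|]; [|discriminate].
  rewrite expn_pow in Hd.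
  destruct k as [|k].
  { rewrite Nat.pow_1_r in Hd. subst. unfold is_true in Hp. congruence. }
  assert (p2 : (2 <= p)%nat).
  { pose proof (prime_INR p Hp). change 1 with (INR 1) in H0. apply INR_lt in H0. lia. }
  exists p, k. split; [|split].
  - apply Nat.sqrt_le_square. rewrite Hd in HN. simpl in HN.
    assert (1 <= p ^ k)%nat by (apply Nat.neq_0_lt_0, Nat.pow_nonzero; lia). nia.
  - apply Nat.log2_le_pow2; [|rewrite Hd in HN]; [destruct N; [|lia]|].
    { assert (d = 0)%nat by lia. subst d. assert (p ^ S (S k) <> 0)%nat by (apply Nat.pow_nonzero; lia). lia. }
    eapply Nat.le_trans; [|apply HN]. transitivity (p ^ k)%nat.
    + apply Nat.pow_le_mono_l; lia.
    + apply Nat.pow_le_mono_r; lia.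
  - assumption.
Qed.

(** Mertens' sum grows by at least 1 between N/R and N, while a prime power in this range
    contributes at most R ln N / N. This yields N / (R ln N) prime powers, of which only O(sqrt N ln
    N) are not primes. The lower end N/R keeps all these primes of the order of N. *)
Lemma primes_1mod4_many : exists K R X0, 0 < K /\ 1 <= R /\ forall N : nat, X0 <= INR N ->
  exists l, NoDup l /\
   (forall p, In p l -> prime.prime p = true /\ (p mod 4 = 1)%nat /\ INR N / R <= INR p <= INR N) /\
   K * INR N / ln (INR N) <= INR (length l).
Proof.
  (* Half of ln R has to exceed the two errors 10 of [mertens_1mod4] by 1: 42 / 2 - 20 = 1. *)
  destruct (INR_unbounded (exp 42)) as [R0 HR0].
  assert (R1 : 1 < INR R0) by (pose proof (exp_ineq1_le 42); lra).
  assert (Rn : (1 < R0)%nat) by (apply INR_lt; simpl; lra).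
  (* This makes 6 L exp(L/2), the bound for the proper prime powers, at most N / (2 R0 L), half of
     the main term. *)
  destruct (exp_dominates (/ 2) (12 * INR R0) ltac:(lra)) as [L0 [L01 HL0]].
  exists (/ (2 * INR R0)), (INR R0), (Rmax (exp L0) (2 * INR R0)).
  split; [apply Rinv_0_lt_compat; lra|]. split; [lra|]. intros N HN.
  assert (HN1 : exp L0 <= INR N) by (eapply Rle_trans; [apply Rmax_l|apply HN]).
  assert (HN2 : 2 * INR R0 <= INR N) by (eapply Rle_trans; [apply Rmax_r|apply HN]).
  set (L := ln (INR N)).
  assert (HL : L0 <= L) by (unfold L; rewrite <- (ln_exp L0); apply ln_mono; [apply exp_pos|lra]).
  assert (EL : INR N = exp L) by (unfold L; rewrite exp_ln; lra).
  set (M := (N / R0)%nat).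
  pose proof (INR_div N R0 ltac:(lia)) as HM. fold M in HM.
  assert (M2 : (2 <= M)%nat).
  { unfold M. apply Nat.div_le_lower_bound; [lia|]. apply INR_le. rewrite mult_INR. simpl (INR 2). lra. }
  assert (MN : (M <= N)%nat) by (unfold M; apply Nat.div_le_upper_bound; nia).
  exists (filter (fun d => Nat.eqb (d mod 4) 1 && prime.prime d)%bool (seq (S M) (N - M))).
  split; [apply NoDup_filter, seq_NoDup|]. split.
  { intros p Hp. apply filter_In in Hp. destruct Hp as [Hs Hp]. apply in_seq in Hs.
    apply andb_prop in Hp. destruct Hp as [Hp1 Hp2]. apply Nat.eqb_eq in Hp1.
    split; [assumption|]. split; [assumption|]. split.
    - apply Rle_trans with (INR M + 1); [lra|]. rewrite <- S_INR. apply le_INR; lia.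
    - apply le_INR; lia. }
  set (lp := filter _ _).
  set (lpp := filter (fun d => Nat.eqb (d mod 4) 1 && is_prime_power d)%bool (seq (S M) (N - M))).
  (* A list containing all proper prime powers up to N. Its length serves only as an upper bound, so
     repetitions and larger entries are harmless. *)
  set (lq := map (fun pk => fst pk ^ S (S (snd pk)))%nat
               (list_prod (seq 0 (S (Nat.sqrt N))) (seq 0 (S (Nat.log2 N))))).
  assert (A1 : (length lpp <= length lp + length lq)%nat).
  { rewrite <- length_app. apply NoDup_incl_length; [apply NoDup_filter, seq_NoDup|].
    intros d Hd. apply filter_In in Hd. destruct Hd as [Hs Hd].
    apply andb_prop in Hd. destruct Hd as [Hd1 Hd2]. apply in_or_app.
    destruct (prime.prime d) eqn:Ep.
    - left. apply filter_In. rewrite Hd1, Ep. auto.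
    - right. apply in_seq in Hs.
      destruct (proper_prime_power_bound d N Hd2 Ep ltac:(lia)) as [p [k [H1 [H2 H3]]]].
      apply in_map_iff. exists (p, k). split; [cbn [fst snd]; symmetry; exact H3|].
      apply in_prod; apply in_seq; lia. }
  assert (A2 : INR (length lq) <= 6 * L * exp (L / 2)).
  { unfold lq. rewrite length_map, length_prod, !length_seq, mult_INR, !S_INR.
    assert (B1 : INR (Nat.sqrt N) <= exp (L / 2)).
    { apply Rsqr_incr_0_var; [|apply Rlt_le, exp_pos]. unfold Rsqr.
      rewrite <- exp_plus. replace (L / 2 + L / 2) with L by field. rewrite <- EL, <- mult_INR.
      apply le_INR. apply Nat.sqrt_spec; lia. }
    assert (B2 : INR (Nat.log2 N) <= 2 * L).
    { pose proof (Nat.log2_spec N ltac:(lia)) as [C1 _]. apply le_INR in C1. rewrite pow_INR in C1.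
      apply ln_mono in C1; [|apply pow_lt; simpl; lra]. rewrite ln_pow in C1 by (simpl; lra).
      fold L in C1. pose proof ln_lt_2. simpl (INR 2) in C1. replace (1 + 1) with 2 in C1 by ring.
      pose proof (pos_INR (Nat.log2 N)). nra. }
    pose proof (exp_ineq1_le (L / 2)). pose proof (pos_INR (Nat.sqrt N)). pose proof (pos_INR (Nat.log2 N)).
    apply Rle_trans with ((2 * exp (L / 2)) * (3 * L)); [|lra].
    apply Rmult_le_compat; lra. }
  assert (A3 : INR N / (INR R0 * L) <= INR (length lpp)).
  { assert (B1 : 1 <= mangoldt_sum_1mod4 N - mangoldt_sum_1mod4 M).
    { pose proof (mertens_1mod4 N ltac:(lia)) as C1. pose proof (mertens_1mod4 M M2) as C2.
      apply Rabs_le_between in C1. apply Rabs_le_between in C2.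
      assert (C3 : ln (INR M) <= L - ln (INR R0)).
      { unfold L. rewrite <- ln_div by lra. apply ln_mono; [|lra]. apply (lt_INR 0); lia. }
      assert (C4 : 42 <= ln (INR R0)).
      { rewrite <- (ln_exp 42). apply ln_mono; [apply exp_pos|lra]. }
      fold L in C1. lra. }
    assert (B2 : mangoldt_sum_1mod4 N - mangoldt_sum_1mod4 M <= INR (length lpp) * (INR R0 * L / INR N)).
    { unfold mangoldt_sum_1mod4. replace (S N) with (S M + (N - M))%nat by lia. rewrite psum_split.
      match goal with |- ?a + ?b - ?a <= _ => replace (a + b - a) with b by ring end.
      unfold lpp. rewrite <- psum_count, Rmult_comm, <- psum_scal. apply psum_le. intros i Hi.
      set (d := (S M + i)%nat). assert (Hd : (M < d <= N)%nat) by (unfold d; lia). clearbody d.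
      destruct (Nat.eqb (d mod 4) 1); cbn [andb]; [|lra].
      destruct (is_prime_power d) eqn:E; [|rewrite mangoldt_not_prime_power by assumption; unfold Rdiv; lra].
      assert (D0 : INR N / INR R0 <= INR d).
      { apply Rle_trans with (INR M + 1); [lra|]. rewrite <- S_INR. apply le_INR; lia. }
      assert (D1 : 0 < INR N / INR R0) by (apply Rdiv_lt_0_compat; lra).
      assert (D2 : mangoldt d <= L).
      { eapply Rle_trans; [apply mangoldt_le; lia|]. apply ln_mono; [lra|apply le_INR; lia]. }
      replace (INR R0 * L / INR N * 1) with (L * / (INR N / INR R0)) by (field; lra).
      apply Rmult_le_compat; [apply mangoldt_ge0| |assumption|].
      - apply Rlt_le, Rinv_0_lt_compat; lra.
      - apply Rinv_le_contravar; lra. }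
    assert (B3 : 0 < INR N / (INR R0 * L)) by (apply Rdiv_lt_0_compat; nra).
    assert (B4 : 1 <= INR (length lpp) * (INR R0 * L / INR N)) by lra.
    apply Rmult_le_compat_r with (r := INR N / (INR R0 * L)) in B4; [|lra].
    replace (INR (length lpp) * (INR R0 * L / INR N) * (INR N / (INR R0 * L))) with (INR (length lpp)) in B4
      by (field; repeat split; nra).
    lra. }
  apply le_INR in A1. rewrite plus_INR in A1. specialize (HL0 L HL).
  assert (A4 : 6 * L * exp (L / 2) <= INR N / (2 * INR R0 * L)).
  { apply Rmult_le_reg_r with (2 * INR R0 * L); [nra|].
    replace (INR N / (2 * INR R0 * L) * (2 * INR R0 * L)) with (INR N) by (field; split; nra).
    replace (INR N) with (exp (/ 2 * L) * exp (L / 2)) by (rewrite <- exp_plus, EL; f_equal; field).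
    replace (6 * L * exp (L / 2) * (2 * INR R0 * L)) with (12 * INR R0 * L ^ 2 * exp (L / 2)) by ring.
    apply Rmult_le_compat_r; [apply Rlt_le, exp_pos|assumption]. }
  replace (/ (2 * INR R0) * INR N / L) with (INR N / (INR R0 * L) - INR N / (2 * INR R0 * L))
    by (field; split; nra).
  lra.
Qed.

(** * Representations as sums of two squares *)

Lemma rsum_app l1 l2 : rsum (l1 ++ l2) = rsum l1 + rsum l2.
Proof. induction l1 as [|x l IH]; simpl; [lra|rewrite IH; lra]. Qed.

Lemma rsum_map_le {T} (f g : T -> R) l : (forall x, In x l -> f x <= g x) ->
  rsum (map f l) <= rsum (map g l).
Proof.
  induction l as [|x l IH]; intros H; simpl; [lra|].
  apply Rplus_le_compat; [apply H; simpl; auto|apply IH; intros; apply H; simpl; auto].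
Qed.

Lemma rsum_map_scal {T} c (f : T -> R) l : rsum (map (fun x => c * f x) l) = c * rsum (map f l).
Proof. induction l as [|x l IH]; simpl; [lra|rewrite IH; lra]. Qed.

Lemma rsum_map_nonneg {T} (f : T -> R) l : (forall x, In x l -> 0 <= f x) -> 0 <= rsum (map f l).
Proof.
  induction l as [|x l IH]; intros H; simpl; [lra|].
  apply Rplus_le_le_0_compat; [apply H; simpl; auto|apply IH; intros; apply H; simpl; auto].
Qed.

Lemma rsum_map_single {T} (f : T -> R) l x : (forall y, In y l -> 0 <= f y) -> In x l ->
  f x <= rsum (map f l).
Proof.
  induction l as [|y l IH]; intros H Hx; simpl; [destruct Hx|].
  assert (0 <= rsum (map f l)) by (apply rsum_map_nonneg; intros; apply H; simpl; auto).
  assert (0 <= f y) by (apply H; simpl; auto).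
  destruct Hx as [->|Hx]; [lra|].
  specialize (IH ltac:(intros; apply H; simpl; auto) Hx). lra.
Qed.

Lemma rsum_count {T} (P : T -> bool) l :
  rsum (map (fun x => if P x then 1 else 0) l) = INR (length (filter P l)).
Proof.
  induction l as [|x l IH]; [reflexivity|]. simpl map; simpl filter; simpl rsum. rewrite IH.
  destruct (P x); [simpl length; rewrite S_INR|]; lra.
Qed.

Lemma in_zrange a n : In a (zrange n) <-> (- Z.of_nat n <= a <= Z.of_nat n)%Z.
Proof.
  unfold zrange. rewrite in_map_iff. split.
  - intros [k [<- Hk]]. apply in_seq in Hk. lia.
  - intros H. exists (Z.to_nat (a + Z.of_nat n)). split; [lia|]. apply in_seq. lia.
Qed.

Lemma zrange_NoDup n : NoDup (zrange n).
Proof.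
  unfold zrange. apply NoDup_map_NoDup_ForallPairs; [|apply seq_NoDup].
  intros x y _ _ H. lia.
Qed.

Lemma list_prod_NoDup {S T} (l1 : list S) (l2 : list T) :
  NoDup l1 -> NoDup l2 -> NoDup (list_prod l1 l2).
Proof.
  intros H1 H2. induction H1 as [|x l Hx H1 IH]; simpl; [constructor|].
  apply NoDup_app.
  - apply NoDup_map_NoDup_ForallPairs; [|assumption]. intros a b _ _ E. congruence.
  - assumption.
  - intros [a b] Ha Hb. apply in_map_iff in Ha. destruct Ha as [y [E _]]. injection E as -> ->.
    apply in_prod_iff in Hb. tauto.
Qed.

Definition on_shell (n : nat) (ab : Z * Z) : bool :=
  Z.eqb (fst ab * fst ab + snd ab * snd ab)%Z (Z.of_nat n).

Definition zbox (n : nat) := list_prod (zrange n) (zrange n).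

Lemma shell_sum_box n g :
  shell_sum n g = rsum (map (fun ab => if on_shell n ab then g (fst ab) (snd ab) else 0) (zbox n)).
Proof.
  unfold shell_sum, zbox. generalize (zrange n) as l2.
  enough (H : forall l1 l2, rsum (map (fun a => rsum (map (fun b =>
      if Z.eqb (a * a + b * b)%Z (Z.of_nat n) then g a b else 0) l2)) l1) =
    rsum (map (fun ab => if on_shell n ab then g (fst ab) (snd ab) else 0) (list_prod l1 l2)))
    by (intros; apply H).
  intros l1 l2. induction l1 as [|a l IH]; [reflexivity|].
  simpl list_prod. simpl map at 1. simpl rsum at 1. rewrite map_app, rsum_app, map_map, IH.
  reflexivity.
Qed.

Lemma on_shell_zbox n a b : (a * a + b * b = Z.of_nat n)%Z -> In (a, b) (zbox n).
Proof. intros H. apply in_prod; apply in_zrange; nia. Qed.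

Lemma shell_sum_le n g h :
  (forall a b, (a * a + b * b = Z.of_nat n)%Z -> g a b <= h a b) ->
  shell_sum n g <= shell_sum n h.
Proof.
  intros H. rewrite !shell_sum_box. apply rsum_map_le. intros [a b] _. unfold on_shell; simpl.
  destruct (Z.eqb_spec (a * a + b * b) (Z.of_nat n)); [auto|lra].
Qed.

Lemma shell_sum_scal n c g : shell_sum n (fun a b => c * g a b) = c * shell_sum n g.
Proof.
  rewrite !shell_sum_box, <- rsum_map_scal. f_equal. apply map_ext. intros [a b].
  destruct (on_shell n (a, b)); simpl; ring.
Qed.

Lemma shell_sum_const n c : shell_sum n (fun _ _ => c) = c * r2 n.
Proof.
  unfold r2. rewrite <- shell_sum_scal, !shell_sum_box. f_equal. apply map_ext. intros ab.
  destruct (on_shell n ab); ring.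
Qed.

Lemma shell_sum_single n g a b :
  (forall a b, (a * a + b * b = Z.of_nat n)%Z -> 0 <= g a b) ->
  (a * a + b * b = Z.of_nat n)%Z -> g a b <= shell_sum n g.
Proof.
  intros H Hab. rewrite shell_sum_box.
  eapply Rle_trans; [|apply (rsum_map_single _ _ (a, b)); [|apply on_shell_zbox, Hab]].
  - unfold on_shell; simpl. rewrite Hab, Z.eqb_refl. lra.
  - intros [x y] _. unfold on_shell; simpl.
    destruct (Z.eqb_spec (x * x + y * y) (Z.of_nat n)); [auto|lra].
Qed.

Lemma r2_count n : r2 n = INR (length (filter (on_shell n) (zbox n))).
Proof. unfold r2. rewrite shell_sum_box. apply rsum_count. Qed.

Lemma r2_nonneg n : 0 <= r2 n.
Proof. rewrite r2_count. apply pos_INR. Qed.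

Lemma r2_ge1 n : in_N2 n -> 1 <= r2 n.
Proof.
  unfold in_N2. rewrite r2_count. intros H. apply (le_INR 1).
  change 0 with (INR 0) in H. apply INR_lt in H. lia.
Qed.

Lemma r2_out n : ~ in_N2 n -> r2 n = 0.
Proof. unfold in_N2. pose proof (r2_nonneg n). lra. Qed.

Lemma in_N2_intro n a b : (a * a + b * b = Z.of_nat n)%Z -> in_N2 n.
Proof.
  intros H. unfold in_N2, r2. apply Rlt_le_trans with 1; [lra|].
  apply (shell_sum_single n (fun _ _ => 1) a b); [intros; lra|assumption].
Qed.

Lemma r2_le_length n l : (forall a b, (a * a + b * b = Z.of_nat n)%Z -> In (a, b) l) ->
  r2 n <= INR (length l).
Proof.
  intros H. rewrite r2_count. apply le_INR. apply NoDup_incl_length.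
  - apply NoDup_filter, list_prod_NoDup; apply zrange_NoDup.
  - intros [a b] Hab. apply filter_In in Hab. destruct Hab as [_ Hab]. apply H.
    now apply Z.eqb_eq.
Qed.

(** The first coordinate lies in [-sqrt n, sqrt n] and determines the second up to sign. *)
Lemma r2_le_sqrt n : r2 n <= 6 * sqrt (INR n + 1).
Proof.
  set (s a := Z.sqrt (Z.of_nat n - a * a)).
  apply Rle_trans with (INR (length (map (fun a => (a, s a)) (zrange (Nat.sqrt n)) ++
      map (fun a => (a, - s a)%Z) (zrange (Nat.sqrt n))))).
  - apply r2_le_length. intros a b H.
    assert (Ha : In a (zrange (Nat.sqrt n))).
    { apply in_zrange.
      assert (Z.abs_nat a <= Nat.sqrt n)%nat; [|lia].
      apply Nat.sqrt_le_square. nia. }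
    apply in_or_app. destruct (Z.le_gt_cases 0 b) as [Hb|Hb]; [left|right]; apply in_map_iff; exists a;
      (split; [|assumption]); f_equal; unfold s.
    + replace (Z.of_nat n - a * a)%Z with (b * b)%Z by lia. apply Z.sqrt_square; lia.
    + replace (Z.of_nat n - a * a)%Z with (- b * - b)%Z by lia. rewrite Z.sqrt_square; lia.
  - rewrite length_app, !length_map. unfold zrange. rewrite length_map, length_seq.
    assert (H1 : INR (Nat.sqrt n) <= sqrt (INR n + 1)).
    { apply Rsqr_incr_0_var; [|apply sqrt_pos]. rewrite Rsqr_sqrt by (pose proof (pos_INR n); lra).
      unfold Rsqr. rewrite <- mult_INR. pose proof (Nat.sqrt_spec n ltac:(lia)) as [C _].
      apply le_INR in C. lra. }
    assert (H2 : 1 <= sqrt (INR n + 1)).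
    { rewrite <- sqrt_1 at 1. apply sqrt_le_1_alt. pose proof (pos_INR n); lra. }
    rewrite !plus_INR, !mult_INR. simpl INR. lra.
Qed.

Lemma r2_prime p : prime.prime p = true -> (p mod 4 = 1)%nat -> in_N2 p /\ r2 p <= 8.
Proof.
  intros Hp H4. destruct (two_squares p Hp H4) as [a [b Hab]].
  split; [now apply (in_N2_intro p a b)|].
  assert (p0 : (0 < Z.of_nat p)%Z) by (destruct p; [simpl in H4; lia|lia]).
  set (P := Z.of_nat p) in *.
  set (l := (a, b) :: (a, -b)%Z :: (-a, b)%Z :: (-a, -b)%Z :: (b, a) :: (b, -a)%Z :: (-b, a)%Z :: (-b, -a)%Z :: nil).
  replace 8 with (INR (length l)) by (simpl; lra).
  apply (r2_le_length p l). intros c d Hcd. fold P in Hcd.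
  (* Brahmagupta: both (ac+bd)^2+(ad-bc)^2 and (ac-bd)^2+(ad+bc)^2 equal p^2,
     and p divides ad-bc or ad+bc. *)
  assert (K : forall d', (d' = d \/ d' = - d)%Z -> (P | a * d' - b * c)%Z ->
     ((c = a /\ d' = b) \/ (c = - a /\ d' = - b) \/ (c = - b /\ d' = a) \/ (c = b /\ d' = - a))%Z).
  { intros d' Hd' [k Hk].
    assert (Hc : (c * c + d' * d' = P)%Z) by (destruct Hd'; subst d'; lia).
    assert (Q : ((a * c + b * d') * (a * c + b * d') + (k * P) * (k * P) = P * P)%Z)
      by (rewrite <- Hk; transitivity ((a * a + b * b) * (c * c + d' * d'))%Z;
          [ring|now rewrite Hab, Hc]).
    set (t := (a * c + b * d')%Z) in *.
    assert (C1 : (P * c = a * t - b * (k * P))%Z) by (rewrite <- Hk; unfold t; rewrite <- Hab; ring).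
    assert (C2 : (P * d' = b * t + a * (k * P))%Z) by (rewrite <- Hk; unfold t; rewrite <- Hab; ring).
    (* From t^2 + (k P)^2 = P^2 there remain k = 0, where t = P or t = -P and (c, d') is (a, b) up
       to a common sign, and k = 1 or -1, where t = 0 and the coordinates are exchanged. *)
    assert (K1 : (k * k <= 1)%Z).
    { apply Z.mul_le_mono_pos_r with (P * P)%Z; [now apply Z.mul_pos_pos|].
      replace (1 * (P * P))%Z with (t * t + k * k * (P * P))%Z by (rewrite Z.mul_1_l; etransitivity; [|exact Q]; ring).
      pose proof (Z.square_nonneg t). lia. }
    assert (P0 : P <> 0%Z) by lia.
    assert (k = 0 \/ k = 1 \/ k = -1)%Z as [->|[->| ->]] by nia.
    - assert (T : ((t - P) * (t + P) = 0)%Z) by (ring_simplify; ring_simplify in Q; lia).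
      apply Z.mul_eq_0 in T. destruct T as [T|T].
      + assert (E : t = P) by lia. rewrite E in C1, C2.
        left; split; apply (Z.mul_reg_l _ _ P P0); [rewrite C1|rewrite C2]; ring.
      + assert (E : t = (- P)%Z) by lia. rewrite E in C1, C2.
        right; left; split; apply (Z.mul_reg_l _ _ P P0); [rewrite C1|rewrite C2]; ring.
    - assert (T : (t * t = 0)%Z) by (ring_simplify; ring_simplify in Q; lia).
      assert (E : t = 0%Z) by (apply Z.mul_eq_0 in T; lia). rewrite E in C1, C2. right; right; left.
      split; apply (Z.mul_reg_l _ _ P P0); [rewrite C1|rewrite C2]; ring.
    - assert (T : (t * t = 0)%Z) by (ring_simplify; ring_simplify in Q; lia).
      assert (E : t = 0%Z) by (apply Z.mul_eq_0 in T; lia). rewrite E in C1, C2. right; right; right.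
      split; apply (Z.mul_reg_l _ _ P P0); [rewrite C1|rewrite C2]; ring. }
  assert (D : (P | (a * d - b * c) * (a * (- d) - b * c))%Z).
  { exists (b * b - d * d)%Z.
    transitivity (b * b * (c * c) - (a * a) * (d * d))%Z; [ring|].
    replace (c * c)%Z with (P - d * d)%Z by lia. replace (a * a)%Z with (P - b * b)%Z by lia. ring. }
  unfold l; simpl.
  destruct (prime_div_mul p _ _ Hp D) as [D1|D1]; apply K in D1; auto;
    destruct D1 as [[E1 E2]|[[E1 E2]|[[E1 E2]|[E1 E2]]]];
    subst c; try subst d; try (assert (E4 : (d = - - d)%Z) by lia; rewrite E2 in E4; rewrite E4);
    rewrite ?Z.opp_involutive; auto 12.
Qed.

(** * Series and eigenvalues *)

Lemma sum_n_psum a n : sum_n a n = psum a (S n).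
Proof.
  induction n as [|n IH]; [rewrite sum_O; simpl; lra|].
  rewrite sum_Sn, IH. reflexivity.
Qed.

Lemma ex_series_bounded a M : (forall n, 0 <= a n) -> (forall n, psum a n <= M) -> ex_series a.
Proof.
  intros H0 HM. change (ex_finite_lim_seq (sum_n a)).
  apply (ex_finite_lim_seq_incr _ M).
  - intros n. rewrite sum_Sn. unfold plus; simpl. specialize (H0 (S n)). lra.
  - intros n. rewrite sum_n_psum. apply HM.
Qed.

Lemma is_series_finite a M : (forall n, (M <= n)%nat -> a n = 0) -> is_series a (psum a M).
Proof.
  intros H. assert (E : forall n, (M <= n)%nat -> psum a n = psum a M).
  { intros n Hn. replace n with (M + (n - M))%nat by lia. rewrite psum_split.
    rewrite (psum_ext _ (fun _ => 0) (n - M)), psum_0; [lra|]. intros; apply H; lia. }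
  change (is_lim_seq (sum_n a) (psum a M)).
  apply is_lim_seq_ext_loc with (fun _ => psum a M); [|apply is_lim_seq_const].
  exists M. intros n Hn. rewrite sum_n_psum, (E (S n)) by lia; reflexivity.
Qed.

Lemma is_series_delta p (c : R) : is_series (fun n => if Nat.eqb n p then c else 0) c.
Proof.
  assert (H := is_series_finite (fun n => if Nat.eqb n p then c else 0) (S p)).
  rewrite psum_delta in H by lia. apply H.
  intros n Hn. destruct (Nat.eqb_spec n p); [lia|reflexivity].
Qed.

Lemma is_series_remove (a : nat -> R) p l : is_series (fun n => if Nat.eqb n p then 0 else a n) l ->
  is_series a (a p + l).
Proof.
  intros H. eapply is_series_ext; [|apply (is_series_plus _ _ _ _ (is_series_delta p (a p)) H)].
  intros n. unfold plus; simpl. destruct (Nat.eqb_spec n p); [subst|]; lra.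
Qed.

Lemma ex_series_remove (a : nat -> R) p : ex_series a -> ex_series (fun n => if Nat.eqb n p then 0 else a n).
Proof.
  intros [l H]. exists (l - a p). eapply is_series_ext; [|apply (is_series_minus _ _ _ _ H (is_series_delta p (a p)))].
  intros n. unfold plus, opp; simpl. destruct (Nat.eqb_spec n p); [subst|]; lra.
Qed.

Lemma ex_series_Rscal (c : R) (a : nat -> R) : ex_series a -> ex_series (fun n => c * a n).
Proof. exact (ex_series_scal (V := R_NormedModule) c a). Qed.

Lemma Series_nonneg a : (forall n, 0 <= a n) -> ex_series a -> 0 <= Series a.
Proof.
  intros H E. rewrite <- (is_series_unique (fun _ => 0) 0).
  - apply Series_le; [|assumption]. intros n; split; [lra|apply H].
  - apply (is_series_finite (fun _ => 0) 0). reflexivity.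
Qed.

Lemma Series_single a p : (forall n, 0 <= a n) -> ex_series a -> a p <= Series a.
Proof.
  intros H E. pose proof (ex_series_remove a p E) as E'.
  pose proof (is_series_unique _ _ (is_series_remove a p _ (Series_correct _ E'))) as U.
  assert (0 <= Series (fun n => if Nat.eqb n p then 0 else a n)).
  2:{ rewrite U. rewrite <- (Rplus_0_r (a p)) at 1. apply Rplus_le_compat_l. assumption. }
  apply Series_nonneg; [|assumption]. intros n; destruct (Nat.eqb n p); [lra|apply H].
Qed.

(** [series] is a chosen limit and is known to be the sum only when one exists. Every use of
    [norm_const] and [Op] therefore has to be preceded by a proof of convergence. *)
Lemma series_Series s : ex_series s -> series s = Series s.
Proof.
  intros E. unfold series. symmetry. apply is_series_unique. apply is_series_Reals.
  apply epsilon_spec. exists (Series s). apply is_series_Reals. now apply Series_correct.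
Qed.

(* The exponent lies between 3/2, needed for the sum of r2 n / rho n to converge by
   r2_le_sqrt, and 2 * 131/146, below which window_tail is effective. *)
Definition rho (n : nat) : R := Rpower (INR n + 1) (7 / 4).

Lemma rho_pos n : 0 < rho n.
Proof. apply exp_pos. Qed.

Lemma rho_le_sq n : rho n <= (INR n + 1) ^ 2.
Proof.
  unfold rho. pose proof (pos_INR n). rewrite <- Rpower_pow by lra. apply Rle_Rpower; [lra|simpl; lra].
Qed.

Lemma ex_series_Rpower_54 : ex_series (fun n => Rpower (INR n + 1) (- (5 / 4))).
Proof.
  apply (ex_series_bounded _ 5); [intros; apply Rlt_le, exp_pos|].
  (* A telescoping majorant: (x + 1)^(-5/4) <= 4 (x^(-1/4) - (x + 1)^(-1/4)). *)
  enough (H : forall n, psum (fun n => Rpower (INR n + 1) (- (5 / 4))) (S n)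
                <= 5 - 4 * Rpower (INR n + 1) (- (1 / 4))).
  { intros [|n]; [simpl; lra|]. pose proof (H n). pose proof (exp_pos (- (1 / 4) * ln (INR n + 1))).
    unfold Rpower in *. lra. }
  induction n as [|n IH].
  { simpl. rewrite !Rplus_0_l. unfold Rpower. rewrite !ln_1, !Rmult_0_r, exp_0. lra. }
  cbn [psum] in *. rewrite S_INR in *. set (x := INR n + 1) in *.
  assert (Hx : 1 <= x) by (unfold x; pose proof (pos_INR n); lra).
  assert (E1 : Rpower (x + 1) (- (5 / 4)) = Rpower (x + 1) (- (1 / 4)) * / (x + 1)).
  { replace (- (5 / 4)) with (- (1 / 4) + - 1) by field. rewrite Rpower_plus, (Rpower_Ropp _ 1), Rpower_1; lra. }
  assert (E2 : Rpower (x + 1) (- (1 / 4)) * (1 + / (4 * (x + 1))) <= Rpower x (- (1 / 4))).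
  { replace x with ((x + 1) * (1 - / (x + 1))) at 3 by (field; lra).
    assert (0 < / (x + 1) < 1).
    { split; [apply Rinv_0_lt_compat; lra|]. rewrite <- Rinv_1. apply Rinv_lt_contravar; lra. }
    rewrite <- Rpower_mult_distr by lra. apply Rmult_le_compat_l; [apply Rlt_le, exp_pos|].
    unfold Rpower. eapply Rle_trans; [|apply exp_ineq1_le].
    pose proof (ln_le_sub1 (1 - / (x + 1)) ltac:(lra)).
    replace (/ (4 * (x + 1))) with (/ 4 * / (x + 1)) by (field; lra). lra. }
  rewrite E1.
  replace (Rpower (x + 1) (- (1 / 4)) * (1 + / (4 * (x + 1)))) with
    (Rpower (x + 1) (- (1 / 4)) + / 4 * (Rpower (x + 1) (- (1 / 4)) * / (x + 1))) in E2 by (field; lra).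
  lra.
Qed.

Lemma r2_rho_summable : ex_series (fun n => r2 n / rho n).
Proof.
  apply (ex_series_le (fun n => r2 n / rho n) (fun n => 6 * Rpower (INR n + 1) (- (5 / 4)))).
  2:{ apply (ex_series_Rscal 6), ex_series_Rpower_54. }
  intros n. unfold norm; simpl; unfold abs; simpl. pose proof (rho_pos n). pose proof (pos_INR n).
  rewrite Rabs_pos_eq by (apply Rmult_le_pos; [apply r2_nonneg|apply Rlt_le, Rinv_0_lt_compat; lra]).
  apply Rmult_le_reg_r with (rho n); [assumption|].
  replace (r2 n / rho n * rho n) with (r2 n) by (field; lra).
  unfold rho. rewrite Rmult_assoc, <- Rpower_plus.
  replace (- (5 / 4) + 7 / 4) with (/ 2) by field. rewrite Rpower_sqrt by lra. apply r2_le_sqrt.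
Qed.

(** Convergence for all weights used later. The bound on [k] is asked on N_2 only, since [w]
    vanishes elsewhere; there (n + 1)^2 dominates [rho]. *)
Lemma r2_summable (w k : nat -> R) B :
  (forall n, 0 <= w n <= r2 n) -> (forall n, in_N2 n -> Rabs (k n) <= B / (INR n + 1) ^ 2) ->
  ex_series (fun n => Rabs (w n * k n)).
Proof.
  intros Hw Hk.
  apply (ex_series_le (fun n => Rabs (w n * k n)) (fun n => Rabs B * (r2 n / rho n))).
  2:{ apply (ex_series_Rscal (Rabs B)), r2_rho_summable. }
  intros n. unfold norm; simpl; unfold abs; simpl. rewrite Rabs_Rabsolu, Rabs_mult, Rabs_pos_eq by apply Hw.
  pose proof (rho_pos n) as P. pose proof (rho_le_sq n) as Q.
  destruct (excluded_middle_informative (in_N2 n)) as [H|H].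
  - replace (Rabs B * (r2 n / rho n)) with (r2 n * (Rabs B * / rho n)) by (unfold Rdiv; ring).
    apply Rmult_le_compat; [apply Hw|apply Rabs_pos|apply Hw|].
    eapply Rle_trans; [apply Hk, H|]. unfold Rdiv.
    apply Rle_trans with (Rabs B * / (INR n + 1) ^ 2).
    + apply Rmult_le_compat_r; [|apply Rle_abs]. apply Rlt_le, Rinv_0_lt_compat; lra.
    + apply Rmult_le_compat_l; [apply Rabs_pos|]. apply Rinv_le_contravar; lra.
  - pose proof (Hw n) as W. rewrite (r2_out n H) in *. assert (w n = 0) by lra. rewrite H0.
    unfold Rdiv. rewrite !Rmult_0_l, Rmult_0_r. lra.
Qed.

(** * The quantization condition as a weighted series, and its solutions *)

(** The weight is kept apart from the kernel so that both couplings become series of w n * kern lam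
    n, with w equal to [r2] or to [window]. *)
Definition kern (lam : R) (n : nat) : R := / (INR n - lam) - INR n / (INR n ^ 2 + 1).

(** One condition records both that [lam] is not a pole and that the inverse distances decay like
    1/n, which is the form needed for summability. *)
Definition sep (lam D : R) : Prop :=
  forall n, in_N2 n -> INR n <> lam /\ / Rabs (INR n - lam) <= D / (INR n + 1).

Lemma sep_dist lam d : 0 <= lam -> 0 < d -> (forall n, in_N2 n -> d <= Rabs (INR n - lam)) ->
  sep lam ((lam + 1) / d + 1).
Proof.
  intros H0 Hd H n Hn. specialize (H n Hn). pose proof (pos_INR n).
  split; [intros E; rewrite E, Rminus_diag_eq, Rabs_R0 in H by reflexivity; lra|].
  set (x := Rabs (INR n - lam)) in *.
  assert (N : INR n + 1 <= x + (lam + 1)) by (unfold x; pose proof (Rle_abs (INR n - lam)); lra).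
  apply Rmult_le_reg_l with x; [lra|]. rewrite Rinv_r by lra.
  apply Rmult_le_reg_r with (INR n + 1); [lra|].
  replace (x * (((lam + 1) / d + 1) / (INR n + 1)) * (INR n + 1)) with (x / d * (lam + 1) + x) by (field; lra).
  assert (1 <= x / d).
  { apply Rmult_le_reg_r with d; [lra|]. replace (x / d * d) with x by (field; lra). lra. }
  nra.
Qed.

Lemma sep_gap lam a b : 0 <= a -> a < lam < b -> (forall n, in_N2 n -> INR n <= a \/ b <= INR n) ->
  exists D, sep lam D.
Proof.
  intros Ha Hl H. eexists. apply (sep_dist lam (Rmin (lam - a) (b - lam))); [lra|apply Rmin_pos; lra|].
  intros n Hn. destruct (H n Hn).
  - rewrite Rabs_left by lra. eapply Rle_trans; [apply Rmin_l|lra].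
  - rewrite Rabs_right by lra. eapply Rle_trans; [apply Rmin_r|lra].
Qed.

Lemma sep_prod lam1 lam2 D1 D2 n : sep lam1 D1 -> sep lam2 D2 -> in_N2 n ->
  Rabs (/ ((INR n - lam1) * (INR n - lam2))) <= D1 * D2 / (INR n + 1) ^ 2.
Proof.
  intros H1 H2 Hn. destruct (H1 n Hn) as [N1 B1]. destruct (H2 n Hn) as [N2 B2].
  rewrite Rinv_mult, Rabs_mult, !Rabs_inv. pose proof (pos_INR n).
  replace (D1 * D2 / (INR n + 1) ^ 2) with (D1 / (INR n + 1) * (D2 / (INR n + 1))) by (field; lra).
  apply Rmult_le_compat; try assumption; apply Rlt_le, Rinv_0_lt_compat, Rabs_pos_lt; lra.
Qed.

(** Over a common denominator the kernel is (lam n + 1) / ((n^2 + 1) (n - lam)): the two tails 1/n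
    cancel and the decay is quadratic. *)
Lemma kern_bound lam D n : sep lam D -> in_N2 n ->
  Rabs (kern lam n) <= (2 * (Rabs lam + 1) * Rabs D) / (INR n + 1) ^ 2.
Proof.
  intros H Hn. destruct (H n Hn) as [N B]. pose proof (pos_INR n) as P.
  assert (Q : 0 < INR n ^ 2 + 1) by nra.
  replace (kern lam n) with ((lam * INR n + 1) / (INR n ^ 2 + 1) * / (INR n - lam))
    by (unfold kern; field; split; lra).
  rewrite Rabs_mult, Rabs_inv.
  replace (2 * (Rabs lam + 1) * Rabs D / (INR n + 1) ^ 2) with
    (2 * (Rabs lam + 1) / (INR n + 1) * (Rabs D / (INR n + 1))) by (field; lra).
  apply Rmult_le_compat; [apply Rabs_pos|apply Rlt_le, Rinv_0_lt_compat, Rabs_pos_lt; lra| |].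
  - unfold Rdiv. rewrite Rabs_mult, Rabs_inv, (Rabs_pos_eq (INR n ^ 2 + 1)) by lra.
    assert (A : Rabs (lam * INR n + 1) <= (Rabs lam + 1) * (INR n + 1)).
    { eapply Rle_trans; [apply Rabs_triang|]. rewrite Rabs_mult, Rabs_R1, (Rabs_pos_eq (INR n)) by lra.
      pose proof (Rabs_pos lam). nra. }
    apply Rle_trans with ((Rabs lam + 1) * (INR n + 1) * / (INR n ^ 2 + 1)).
    + apply Rmult_le_compat_r; [apply Rlt_le, Rinv_0_lt_compat; lra|assumption].
    + replace (2 * (Rabs lam + 1) * / (INR n + 1)) with ((Rabs lam + 1) * (INR n + 1) * (2 * / (INR n + 1) ^ 2)) by (field; lra).
      apply Rmult_le_compat_l; [pose proof (Rabs_pos lam); nra|].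
      apply Rmult_le_reg_r with ((INR n ^ 2 + 1) * (INR n + 1) ^ 2); [nra|].
      replace (/ (INR n ^ 2 + 1) * ((INR n ^ 2 + 1) * (INR n + 1) ^ 2)) with ((INR n + 1) ^ 2) by (field; nra).
      replace (2 * / (INR n + 1) ^ 2 * ((INR n ^ 2 + 1) * (INR n + 1) ^ 2)) with (2 * (INR n ^ 2 + 1)) by (field; nra).
      pose proof (pow2_ge_0 (INR n - 1)). nra.
  - eapply Rle_trans; [apply B|]. unfold Rdiv. apply Rmult_le_compat_r; [apply Rlt_le, Rinv_0_lt_compat; lra|apply Rle_abs].
Qed.

Lemma kern_summable w lam D : (forall n, 0 <= w n <= r2 n) -> sep lam D ->
  ex_series (fun n => w n * kern lam n).
Proof.
  intros Hw H. apply ex_series_Rabs. eapply r2_summable; [assumption|]. intros n Hn. now apply (kern_bound lam D).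
Qed.

Lemma prod_summable w lam1 lam2 D1 D2 : (forall n, 0 <= w n <= r2 n) -> sep lam1 D1 -> sep lam2 D2 ->
  ex_series (fun n => Rabs (w n * / ((INR n - lam1) * (INR n - lam2)))).
Proof. intros Hw H1 H2. apply (r2_summable w _ (D1 * D2) Hw). intros n Hn. apply sep_prod; assumption. Qed.

(** The resolvent identity; the regularizing term drops out. *)
Lemma kern_diff lam1 lam2 n : INR n <> lam1 -> INR n <> lam2 ->
  kern lam1 n - kern lam2 n = (lam1 - lam2) * / ((INR n - lam1) * (INR n - lam2)).
Proof. intros. unfold kern. field. split; [|split]; try lra. pose proof (pos_INR n). nra. Qed.

Lemma lipschitz_continuity f K : (forall x y, Rabs (f x - f y) <= K * Rabs (x - y)) -> continuity f.
Proof.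
  intros H x eps Heps. exists (eps / (Rabs K + 1)). pose proof (Rabs_pos K). split.
  { apply Rdiv_lt_0_compat; lra. }
  intros y [_ Hy]. simpl in *. unfold R_dist in *.
  eapply Rle_lt_trans; [apply H|].
  apply Rle_lt_trans with (Rabs K * Rabs (y - x)).
  { apply Rmult_le_compat_r; [apply Rabs_pos|apply Rle_abs]. }
  apply Rle_lt_trans with ((Rabs K) * (eps / (Rabs K + 1))).
  - apply Rmult_le_compat_l; lra.
  - apply Rmult_lt_reg_r with (Rabs K + 1); [lra|].
    replace (Rabs K * (eps / (Rabs K + 1)) * (Rabs K + 1)) with (Rabs K * eps) by (field; lra). nra.
Qed.

(* Multiplying the equation by (lam - a)(b - lam) removes the two poles at the ends of the gap
   and leaves a continuous function with opposite signs there. *)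
Lemma eigenvalue_in_gap w (C : R) (a b : nat) : (forall n, 0 <= w n <= r2 n) ->
  (a < b)%nat -> 0 < w a -> 0 < w b -> (forall n, in_N2 n -> (n <= a)%nat \/ (b <= n)%nat) ->
  exists lam, INR a < lam < INR b /\ is_series (fun n => w n * kern lam n) C.
Proof.
  intros Hw Hab Wa Wb Hgap.
  pose proof (lt_INR a b Hab) as AB. pose proof (pos_INR a) as A0.
  set (w' := fun n => if Nat.eqb n a then 0 else if Nat.eqb n b then 0 else w n).
  assert (Hw' : forall n, 0 <= w' n <= r2 n).
  { intros n. unfold w'. pose proof (Hw n). pose proof (r2_nonneg n). destruct (Nat.eqb n a), (Nat.eqb n b); lra. }
  (* Shells other than a and b are at distance at least 1 from the closed gap, so one constant
     serves all [lam] in it, the end points included. *)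
  set (D := INR b + 2).
  assert (Sp : forall lam, INR a <= lam <= INR b -> forall n, w' n <> 0 ->
     in_N2 n /\ INR n <> lam /\ / Rabs (INR n - lam) <= D / (INR n + 1)).
  { intros lam Hl n Hn. assert (Nn : in_N2 n).
    { unfold in_N2. pose proof (Hw' n). lra. }
    split; [assumption|].
    assert (d1 : 1 <= Rabs (INR n - lam)).
    { unfold w' in Hn. destruct (Nat.eqb_spec n a); [lra|]. destruct (Nat.eqb_spec n b); [lra|].
      destruct (Hgap n Nn) as [G|G].
      - assert (INR (S n) <= INR a) by (apply le_INR; lia). rewrite S_INR in H. rewrite Rabs_left by lra. lra.
      - assert (INR (S b) <= INR n) by (apply le_INR; lia). rewrite S_INR in H. rewrite Rabs_right by lra. lra. }
    split; [intros E; rewrite E, Rminus_diag_eq, Rabs_R0 in d1 by reflexivity; lra|].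
    pose proof (pos_INR n). set (x := Rabs (INR n - lam)) in *.
    assert (N : INR n <= x + lam) by (unfold x; pose proof (Rle_abs (INR n - lam)); lra).
    apply Rmult_le_reg_l with x; [lra|]. rewrite Rinv_r by lra.
    apply Rmult_le_reg_r with (INR n + 1); [lra|].
    replace (x * (D / (INR n + 1)) * (INR n + 1)) with (x * D) by (field; lra). unfold D. nra. }
  assert (Kb : forall lam, INR a <= lam <= INR b -> ex_series (fun n => w' n * kern lam n)).
  { intros lam Hl.
    set (k := fun n => if Req_EM_T (w' n) 0 then 0 else kern lam n).
    apply ex_series_ext with (fun n => w' n * k n).
    { intros n. unfold k. destruct (Req_EM_T (w' n) 0) as [E|E]; [rewrite E, !Rmult_0_l; reflexivity|reflexivity]. }
    apply ex_series_Rabs. apply (r2_summable _ _ (2 * (INR b + 1) * D) Hw').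
    intros n Hn. pose proof (pos_INR n) as P. unfold k. destruct (Req_EM_T (w' n) 0) as [E|E].
    { rewrite Rabs_R0. apply Rmult_le_pos; [unfold D; nra|]. apply Rlt_le, Rinv_0_lt_compat. nra. }
    destruct (Sp lam Hl n E) as [_ [N B]].
    assert (Q : 0 < INR n ^ 2 + 1) by nra.
    replace (kern lam n) with ((lam * INR n + 1) / (INR n ^ 2 + 1) * / (INR n - lam))
      by (unfold kern; field; split; lra).
    rewrite Rabs_mult, Rabs_inv.
    replace (2 * (INR b + 1) * D / (INR n + 1) ^ 2) with
      (2 * (INR b + 1) / (INR n + 1) * (D / (INR n + 1))) by (field; lra).
    apply Rmult_le_compat; [apply Rabs_pos|apply Rlt_le, Rinv_0_lt_compat, Rabs_pos_lt; lra| |assumption].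
    assert (0 <= lam * INR n) by nra.
    rewrite Rabs_pos_eq by (apply Rmult_le_pos; [lra|apply Rlt_le, Rinv_0_lt_compat; lra]).
    apply Rmult_le_reg_r with ((INR n ^ 2 + 1) * (INR n + 1)); [nra|].
    replace ((lam * INR n + 1) / (INR n ^ 2 + 1) * ((INR n ^ 2 + 1) * (INR n + 1))) with ((lam * INR n + 1) * (INR n + 1)) by (field; nra).
    replace (2 * (INR b + 1) / (INR n + 1) * ((INR n ^ 2 + 1) * (INR n + 1))) with ((INR b + 1) * (2 * (INR n ^ 2 + 1))) by (field; nra).
    apply Rle_trans with ((INR b + 1) * (INR n + 1) * (INR n + 1)).
    2:{ pose proof (pow2_ge_0 (INR n - 1)). rewrite Rmult_assoc. apply Rmult_le_compat_l; nra. }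
    apply Rmult_le_compat_r; [lra|]. nra. }
  set (rest := fun lam => Series (fun n => w' n * kern lam n)).
  set (KK := Series (fun n => w' n * (D ^ 2 / (INR n + 1) ^ 2))).
  assert (EK : ex_series (fun n => w' n * (D ^ 2 / (INR n + 1) ^ 2))).
  { apply ex_series_Rabs. apply (r2_summable _ _ (D ^ 2) Hw'). intros n _. pose proof (pos_INR n).
    rewrite Rabs_pos_eq; [lra|]. apply Rmult_le_pos; [nra|]. apply Rlt_le, Rinv_0_lt_compat. nra. }
  assert (Lip : forall x y, INR a <= x <= INR b -> INR a <= y <= INR b ->
     Rabs (rest x - rest y) <= KK * Rabs (x - y)).
  { intros x y Hx Hy. unfold rest. rewrite <- Series_minus by (apply Kb; assumption).
    assert (PW : forall n, Rabs (w' n * kern x n - w' n * kern y n) <= Rabs (x - y) * (w' n * (D ^ 2 / (INR n + 1) ^ 2))).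
    { intros n. destruct (Req_EM_T (w' n) 0) as [E|E].
      { rewrite E, !Rmult_0_l, Rmult_0_r, Rminus_0_r, Rabs_R0. lra. }
      destruct (Sp x Hx n E) as [_ [N1 B1]]. destruct (Sp y Hy n E) as [_ [N2 B2]].
      rewrite <- Rmult_minus_distr_l, kern_diff by assumption.
      rewrite !Rabs_mult, Rabs_inv, Rabs_mult, Rinv_mult, (Rabs_pos_eq (w' n)) by apply Hw'.
      pose proof (pos_INR n).
      replace (Rabs (x - y) * (w' n * (D ^ 2 / (INR n + 1) ^ 2))) with
        (w' n * (Rabs (x - y) * (D / (INR n + 1) * (D / (INR n + 1))))) by (field; lra).
      apply Rmult_le_compat_l; [apply Hw'|]. apply Rmult_le_compat_l; [apply Rabs_pos|].
      apply Rmult_le_compat; try assumption; apply Rlt_le, Rinv_0_lt_compat, Rabs_pos_lt; lra. }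
    assert (EA : ex_series (fun n => Rabs (x - y) * (w' n * (D ^ 2 / (INR n + 1) ^ 2)))).
    { apply (ex_series_Rscal (Rabs (x - y))), EK. }
    eapply Rle_trans; [apply Series_Rabs|].
    - apply (ex_series_le (fun n => Rabs (w' n * kern x n - w' n * kern y n)) (fun n => Rabs (x - y) * (w' n * (D ^ 2 / (INR n + 1) ^ 2)))); [|apply EA].
      intros n. unfold norm; simpl; unfold abs; simpl. rewrite Rabs_Rabsolu. apply PW.
    - unfold KK. rewrite Rmult_comm, <- Series_scal_l. apply Series_le; [|assumption].
      intros n. split; [apply Rabs_pos|apply PW]. }
  (* [IVT] asks for continuity on the whole line, whereas [rest] is controlled on the closed gap
     only; hence the projection onto the gap. *)
  set (cl := fun x => Rmax (INR a) (Rmin (INR b) x)).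
  assert (Hcl : forall x, INR a <= cl x <= INR b).
  { intros x. unfold cl. split; [apply Rmax_l|]. apply Rmax_lub; [lra|apply Rmin_l]. }
  assert (Hcl2 : forall x y, Rabs (cl x - cl y) <= Rabs (x - y)).
  { intros x y. unfold cl. apply Rle_trans with (Rabs (Rmin (INR b) x - Rmin (INR b) y)).
    - generalize (Rmin (INR b) x) (Rmin (INR b) y). intros s t. unfold Rmax.
      destruct (Rle_dec (INR a) s), (Rle_dec (INR a) t);
        unfold Rabs; repeat match goal with |- context [Rcase_abs ?s] => destruct (Rcase_abs s) end; lra.
    - unfold Rmin. destruct (Rle_dec (INR b) x), (Rle_dec (INR b) y);
        unfold Rabs; repeat match goal with |- context [Rcase_abs ?s] => destruct (Rcase_abs s) end; lra. }
  assert (KK0 : 0 <= KK).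
  { apply Series_nonneg; [|assumption]. intros n. apply Rmult_le_pos; [apply Hw'|].
    pose proof (pos_INR n). apply Rmult_le_pos; [nra|]. apply Rlt_le, Rinv_0_lt_compat. nra. }
  assert (Cr : continuity (fun x => rest (cl x))).
  { apply (lipschitz_continuity _ KK). intros x y. eapply Rle_trans; [apply Lip; apply Hcl|].
    apply Rmult_le_compat_l; [assumption|apply Hcl2]. }
  (* The regularizing terms of the shells a and b are moved into the constant, which leaves only
     their poles to be multiplied out. *)
  set (C' := C + w a * (INR a / (INR a ^ 2 + 1)) + w b * (INR b / (INR b ^ 2 + 1))).
  set (H := fun x => (rest (cl x) - C') * ((x - INR a) * (INR b - x)) - w a * (INR b - x) + w b * (x - INR a)).
  assert (CH : continuity H).
  { assert (G : forall rc, continuity rc -> continuity (fun x =>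
        (rc x - C') * ((x - INR a) * (INR b - x)) - w a * (INR b - x) + w b * (x - INR a)))
      by (intros rc Hrc; reg).
    exact (G _ Cr). }
  destruct (IVT H (INR a) (INR b) CH AB) as [z [Hz1 Hz2]].
  { unfold H. nra. }
  { unfold H. nra. }
  assert (za : z <> INR a) by (intros ->; unfold H in Hz2; nra).
  assert (zb : z <> INR b) by (intros ->; unfold H in Hz2; nra).
  exists z. split; [lra|].
  assert (Ez : cl z = z) by (unfold cl; rewrite Rmin_right, Rmax_right; lra).
  unfold H in Hz2. rewrite Ez in Hz2.
  pose proof (Series_correct _ (Kb z Hz1)) as S1. fold (rest z) in S1.
  assert (S2 : is_series (fun n => if Nat.eqb n a then 0 else w n * kern z n) (w b * kern z b + rest z)).
  { pose proof (is_series_remove (fun n => if Nat.eqb n a then 0 else w n * kern z n) b (rest z)) as Q.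
    cbv beta in Q. replace (Nat.eqb b a) with false in Q by (symmetry; apply Nat.eqb_neq; lia).
    apply Q. eapply is_series_ext; [|apply S1].
    intros n. unfold w'. destruct (Nat.eqb n a), (Nat.eqb n b); rewrite ?Rmult_0_l; reflexivity. }
  apply (is_series_remove (fun n => w n * kern z n) a) in S2.
  replace C with (w a * kern z a + (w b * kern z b + rest z)); [exact S2|].
  assert (R : rest z = C' + w a * / (z - INR a) - w b * / (INR b - z)).
  { apply Rmult_eq_reg_r with ((z - INR a) * (INR b - z)); [|nra].
    replace ((C' + w a * / (z - INR a) - w b * / (INR b - z)) * ((z - INR a) * (INR b - z))) with
     (C' * ((z - INR a) * (INR b - z)) + w a * (INR b - z) - w b * (z - INR a)) by (field; lra). lra. }
  rewrite R. unfold C', kern.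
  replace (/ (INR a - z)) with (- / (z - INR a)) by (field; lra). ring.
Qed.

(** * The mass of a shell *)

(** Here x + u + v is the distance to the chosen eigenvalue and x the distance to the other one. The
    factor 1 would do; 67 matches [near_side_ratio]. *)
Lemma far_side_ratio u v x : 0 < u -> u <= v -> 0 < x ->
  u ^ 2 / (x + u + v) ^ 2 <= 67 * (u * v) * / (x * (x + u + v)).
Proof.
  intros Hu Hv Hx. set (y := x + u + v). assert (x < y) by (unfold y; lra).
  apply Rmult_le_reg_r with (x * y ^ 2); [apply Rmult_lt_0_compat; [lra|apply pow_lt; lra]|].
  replace (u ^ 2 / y ^ 2 * (x * y ^ 2)) with (u * u * x) by (field; lra).
  replace (67 * (u * v) * / (x * y) * (x * y ^ 2)) with (u * v * (67 * y)) by (field; lra).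
  apply Rmult_le_compat; nra.
Qed.

(* The nearest shell beyond the eigenvalue cannot be much closer than u: its term alone
   would make the left-hand side of uv * S <= 16 too large. *)
Lemma near_side_ratio u v x0 x : 0 < u -> u <= v -> 0 < x0 -> x0 <= x ->
  u * v * / (x0 * (x0 + u + v)) <= 16 ->
  u ^ 2 / x ^ 2 <= 67 * (u * v) * / (x * (x + u + v)).
Proof.
  intros Hu Hv H0 Hx H.
  assert (A : u * v <= 16 * (x0 * (x0 + u + v))).
  { apply Rmult_le_reg_r with (/ (x0 * (x0 + u + v))); [apply Rinv_0_lt_compat; nra|].
    replace (16 * (x0 * (x0 + u + v)) * / (x0 * (x0 + u + v))) with 16 by (field; split; lra). assumption. }
  (* If u > 33 x0, then x0 + u + v <= (67/33) v, and the product with x0 <= u / 33 is at most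
     (67/1089) u v. This contradicts [A] because 16 * 67 = 1072 < 1089. *)
  assert (B : u <= 33 * x0).
  { destruct (Rle_or_lt u (33 * x0)); [assumption|]. exfalso.
    assert (x0 * (x0 + u + v) <= u / 33 * (67 / 33 * v)) by (apply Rmult_le_compat; lra). nra. }
  assert (D : u <= 33 * x) by lra.
  apply Rmult_le_reg_r with (x ^ 2 * (x + u + v)); [apply Rmult_lt_0_compat; [apply pow_lt|]; lra|].
  replace (u ^ 2 / x ^ 2 * (x ^ 2 * (x + u + v))) with (u * (u * (x + u + v))) by (field; lra).
  replace (67 * (u * v) * / (x * (x + u + v)) * (x ^ 2 * (x + u + v))) with (u * (67 * v * x)) by (field; lra).
  apply Rmult_le_compat_l; [lra|].
  assert (u * x <= v * x) by nra. assert (u * u <= 33 * x * v) by nra. assert (u * v <= 33 * x * v) by nra. nra.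
Qed.

Lemma norm_const_Series lam D : sep lam D ->
  ex_series (fun n => r2 n / (INR n - lam) ^ 2) /\
  norm_const lam = Series (fun n => r2 n / (INR n - lam) ^ 2).
Proof.
  intros H. assert (E : ex_series (fun n => r2 n / (INR n - lam) ^ 2)).
  { apply ex_series_Rabs.
    apply ex_series_ext with (fun n => Rabs (r2 n * / ((INR n - lam) * (INR n - lam)))).
    - intros n. unfold Rdiv. do 3 f_equal. ring.
    - apply (prod_summable r2 lam lam D D); try assumption. intros n; pose proof (r2_nonneg n); lra. }
  split; [assumption|]. unfold norm_const. now apply series_Series.
Qed.

(** The three parts of 1081 = 8 + 67 * 16 + 1 are the shell p, the weighted shells compared with
    [q], and the shells cut off by the weight. Here [t] stands for u v, and [q] is abstract so that
    both eigenvalues can be treated. *)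
Lemma mass_bound (w1 q : nat -> R) lam p u t : (forall n, 0 <= w1 n <= r2 n) ->
  0 < u -> (INR p - lam) ^ 2 = u ^ 2 -> r2 p <= 8 -> w1 p = r2 p ->
  (exists D, sep lam D) ->
  (forall n, 0 <= q n) -> ex_series q -> t * Series q <= 16 -> 0 <= t ->
  (forall n, n <> p -> in_N2 n -> u ^ 2 * (w1 n / (INR n - lam) ^ 2) <= 67 * t * q n) ->
  u ^ 2 * Series (fun n => (r2 n - w1 n) / (INR n - lam) ^ 2) <= 1 ->
  (INR p - lam) ^ 2 * norm_const lam <= 1081.
Proof.
  intros Hw Hu Hp Hr Hwp [D HD] Hq Eq Ht t0 Hpt Htail.
  destruct (norm_const_Series lam D HD) as [E ->].
  assert (Hd : forall n, 0 <= r2 n - w1 n <= r2 n) by (intros n; specialize (Hw n); lra).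
  assert (Et : ex_series (fun n => (r2 n - w1 n) / (INR n - lam) ^ 2)).
  { apply ex_series_Rabs.
    apply ex_series_ext with (fun n => Rabs ((r2 n - w1 n) * / ((INR n - lam) * (INR n - lam)))).
    - intros n. unfold Rdiv. do 3 f_equal. ring.
    - apply (prod_summable (fun n => r2 n - w1 n) lam lam D D); assumption. }
  rewrite Hp, <- Series_scal_l.
  set (T := fun n => (r2 n - w1 n) / (INR n - lam) ^ 2) in *.
  pose proof (is_series_delta p 8) as I1.
  pose proof (is_series_scal (V := R_NormedModule) (67 * t) _ _ (Series_correct _ Eq)) as I2.
  pose proof (is_series_scal (V := R_NormedModule) (u ^ 2) _ _ (Series_correct _ Et)) as I3.
  pose proof (is_series_plus _ _ _ _ (is_series_plus _ _ _ _ I1 I2) I3) as I.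
  apply Rle_trans with (8 + 67 * t * Series q + u ^ 2 * Series T); [|nra].
  rewrite <- (is_series_unique _ (8 + 67 * t * Series q + u ^ 2 * Series T) I).
  apply Series_le; [|eexists; apply I].
  intros n. change (0 <= u ^ 2 * (r2 n / (INR n - lam) ^ 2) <=
    (if Nat.eqb n p then 8 else 0) + 67 * t * q n + u ^ 2 * T n).
  assert (nn : 0 <= r2 n / (INR n - lam) ^ 2).
  { destruct (excluded_middle_informative (in_N2 n)) as [H|H].
    - destruct (HD n H) as [H1 _]. apply Rmult_le_pos; [apply r2_nonneg|].
      apply Rlt_le, Rinv_0_lt_compat, pow2_gt_0; lra.
    - rewrite (r2_out n H). unfold Rdiv; lra. }
  split; [apply Rmult_le_pos; [nra|assumption]|].
  assert (Tn : 0 <= 67 * t * q n) by (apply Rmult_le_pos; [lra|apply Hq]).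
  destruct (Nat.eqb_spec n p) as [->|Hn].
  - unfold T. rewrite Hwp, Hp, (Rminus_diag_eq (r2 p)) by reflexivity.
    replace (u ^ 2 * (r2 p / u ^ 2)) with (r2 p) by (field; lra). unfold Rdiv. rewrite Rmult_0_l, Rmult_0_r. lra.
  - destruct (excluded_middle_informative (in_N2 n)) as [H|H].
    + specialize (Hpt n Hn H). unfold T.
      replace (r2 n / (INR n - lam) ^ 2) with (w1 n / (INR n - lam) ^ 2 + (r2 n - w1 n) / (INR n - lam) ^ 2)
        by (unfold Rdiv; ring). nra.
    + unfold T. pose proof (Hw n). rewrite (r2_out n H) in *. unfold Rdiv at 1.
      assert (w1 n = 0) by lra. rewrite H1. unfold Rdiv. nra.
Qed.

(** The conditions at [lm] and [lp] may carry different weights. The difference is formed with [w1]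
    throughout, and the discrepancy of the weights appears as an error at [lp], which is needed from
    above only. *)
Lemma adjacent_eigenvalue_mass (p nm np : nat) (w1 w2 : nat -> R) (lm lp C : R) :
  (forall n, 0 <= w1 n <= r2 n) -> (forall n, 0 <= w2 n <= r2 n) ->
  in_N2 p -> in_N2 nm -> in_N2 np -> r2 p <= 8 ->
  w1 p = r2 p -> w1 nm = r2 nm -> w1 np = r2 np ->
  (forall n, in_N2 n -> (n <= nm)%nat \/ n = p \/ (np <= n)%nat) ->
  INR nm < lm < INR p -> INR p < lp < INR np ->
  is_series (fun n => w1 n * kern lm n) C -> is_series (fun n => w2 n * kern lp n) C ->
  Series (fun n => (w1 n - w2 n) * kern lp n) <= / (INR np - INR nm) ->
  (forall lam, INR nm < lam < INR np -> lam <> INR p ->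
     Series (fun n => (r2 n - w1 n) / (INR n - lam) ^ 2) <= / (INR np - INR nm) ^ 2) ->
  exists lam, (lam = lm \/ lam = lp) /\ (INR p - lam) ^ 2 * norm_const lam <= 1081.
Proof.
  intros Hw1 Hw2 Np Nm Nn Hr Wp Wm Wn Hgap Hlm Hlp S1 S2 He Ht.
  pose proof (pos_INR nm) as nm0.
  assert (Dm : exists D, sep lm D).
  { apply (sep_gap lm (INR nm) (INR p)); [lra|lra|].
    intros n H. destruct (Hgap n H) as [G|[->|G]]; [left; now apply le_INR|right; lra|right].
    apply le_INR in G. lra. }
  assert (Dp : exists D, sep lp D).
  { apply (sep_gap lp (INR p) (INR np)); [lra|lra|].
    intros n H. destruct (Hgap n H) as [G|[->|G]]; [left|left; lra|right; now apply le_INR].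
    apply le_INR in G. lra. }
  destruct Dm as [D1 HD1]. destruct Dp as [D2 HD2].
  set (u := lp - INR p). set (v := INR p - lm).
  assert (Hu : 0 < u) by (unfold u; lra). assert (Hv : 0 < v) by (unfold v; lra).
  set (g := INR np - INR nm) in *. assert (Hg : u + v < g) by (unfold u, v, g; lra).
  set (k := fun n => w1 n * / ((INR n - lp) * (INR n - lm))).
  set (q := fun n => if Nat.eqb n p then 0 else k n).
  assert (Ek : ex_series k) by (apply ex_series_Rabs; apply (prod_summable w1 lp lm D2 D1); assumption).
  assert (Eq : ex_series q) by (apply ex_series_remove; assumption).
  assert (Hq : forall n, 0 <= q n).
  { intros n. unfold q, k. destruct (Nat.eqb_spec n p) as [->|Hn]; [lra|].
    pose proof (Hw1 n) as W. destruct (Req_EM_T (w1 n) 0) as [->|W0]; [lra|].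
    assert (N : in_N2 n) by (unfold in_N2; lra).
    apply Rmult_le_pos; [lra|]. apply Rlt_le, Rinv_0_lt_compat.
    destruct (Hgap n N) as [G|[G|G]]; [apply le_INR in G; nra|congruence|apply le_INR in G; nra]. }
  assert (Sk : Series k = k p + Series q).
  { apply is_series_unique, is_series_remove, Series_correct, Eq. }
  assert (kp : k p = - (r2 p / (u * v))).
  { unfold k, u, v. rewrite Wp. field. split; lra. }
  assert (Ed : (u + v) * Series k = Series (fun n => (w1 n - w2 n) * kern lp n)).
  { pose proof (kern_summable w1 lp D2 Hw1 HD2) as E1.
    pose proof (kern_summable w1 lm D1 Hw1 HD1) as E2.
    pose proof (kern_summable w2 lp D2 Hw2 HD2) as E3.
    rewrite <- Series_scal_l.
    transitivity (Series (fun n => w1 n * kern lp n - w1 n * kern lm n)).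
    - apply Series_ext. intros n. unfold k.
      destruct (Req_EM_T (w1 n) 0) as [E|W0]; [rewrite E; ring|].
      assert (N : in_N2 n) by (unfold in_N2; pose proof (Hw1 n); lra).
      rewrite <- Rmult_minus_distr_l, kern_diff by (now apply HD1 || now apply HD2). unfold u, v. ring.
    - rewrite Series_minus by assumption. rewrite (is_series_unique _ _ S1).
      rewrite <- (is_series_unique _ _ S2). rewrite <- Series_minus by assumption.
      apply Series_ext. intros n. ring. }
  (* The error contributes at most u v / (u + v)^2 <= 1/4 to u v [Series q], because the gap g
     exceeds u + v. So the sum is at most 8 + 1/4. *)
  assert (Hq16 : u * v * Series q <= 16).
  { rewrite Sk, kp in Ed. rewrite <- Ed in He.
    assert (G : / g <= / (u + v)) by (apply Rinv_le_contravar; lra).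
    assert (A : (u + v) * (u * v * Series q - r2 p) <= u * v / (u + v)).
    { replace ((u + v) * (u * v * Series q - r2 p)) with (u * v * ((u + v) * (- (r2 p / (u * v)) + Series q))) by (field; lra).
      apply Rmult_le_compat_l; [nra|]. lra. }
    assert (B : u * v / (u + v) <= (u + v) / 4).
    { apply Rmult_le_reg_r with (u + v); [lra|]. replace (u * v / (u + v) * (u + v)) with (u * v) by (field; lra).
      pose proof (pow2_ge_0 (u - v)). nra. }
    assert (u * v * Series q - r2 p <= / 4) by nra. lra. }
  (* Where the weight is full it is at least 1, so the bare kernel is bounded by the whole sum.
     Applied to [nm] and [np], this is the input of [near_side_ratio]. *)
  assert (Hn1 : forall n, n <> p -> in_N2 n -> w1 n = r2 n -> u * v * / ((INR n - lp) * (INR n - lm)) <= 16).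
  { intros n Hn N W. pose proof (Series_single q n Hq Eq) as Sg.
    assert (Q : / ((INR n - lp) * (INR n - lm)) <= q n).
    { pose proof (Hq n) as Q0. unfold q, k in *. destruct (Nat.eqb_spec n p); [congruence|].
      rewrite W in *. pose proof (r2_ge1 n N).
      set (z := / ((INR n - lp) * (INR n - lm))) in *.
      assert (0 <= z) by (destruct (Rle_or_lt 0 z); [assumption|nra]). nra. }
    assert (u * v * / ((INR n - lp) * (INR n - lm)) <= u * v * Series q) by (apply Rmult_le_compat_l; [nra|lra]).
    lra. }
  assert (Nmp : nm <> p) by (intros ->; lra). assert (Nnp : np <> p) by (intros ->; lra).
  assert (Tl : forall lam s, 0 < s < g -> INR nm < lam < INR np -> lam <> INR p ->
     s ^ 2 * Series (fun n => (r2 n - w1 n) / (INR n - lam) ^ 2) <= 1).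
  { intros lam s Hs H1 H2. specialize (Ht lam H1 H2).
    apply Rle_trans with (s ^ 2 * / g ^ 2); [apply Rmult_le_compat_l; [nra|assumption]|].
    apply Rmult_le_reg_r with (g ^ 2); [nra|]. replace (s ^ 2 * / g ^ 2 * g ^ 2) with (s ^ 2) by (field; lra). nra. }
  (* The eigenvalue closer to p is taken; the second case is the mirror image of the first. *)
  destruct (Rle_or_lt u v) as [Huv|Huv].
  - exists lp. split; [right; reflexivity|].
    apply (mass_bound w1 q lp p u (u * v)); try assumption.
    + unfold u; ring.
    + exists D2; assumption.
    + nra.
    + intros n Hn N. unfold q, k. destruct (Nat.eqb_spec n p); [congruence|].
      replace (u ^ 2 * (w1 n / (INR n - lp) ^ 2)) with (w1 n * (u ^ 2 / (INR n - lp) ^ 2)) by (unfold Rdiv; ring).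
      replace (67 * (u * v) * (w1 n * / ((INR n - lp) * (INR n - lm)))) with
        (w1 n * (67 * (u * v) * / ((INR n - lp) * (INR n - lm)))) by ring.
      apply Rmult_le_compat_l; [apply Hw1|].
      destruct (Hgap n N) as [G|[G|G]]; [|congruence|]; apply le_INR in G.
      * replace ((INR n - lp) ^ 2) with (((lm - INR n) + u + v) ^ 2) by (unfold u, v; ring).
        replace ((INR n - lp) * (INR n - lm)) with ((lm - INR n) * ((lm - INR n) + u + v)) by (unfold u, v; ring).
        apply far_side_ratio; lra.
      * replace (INR n - lm) with ((INR n - lp) + u + v) by (unfold u, v; ring).
        apply (near_side_ratio u v (INR np - lp)); try lra.
        replace (INR np - lp + u + v) with (INR np - lm) by (unfold u, v; ring). now apply Hn1.
    + apply Tl; lra.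
  - exists lm. split; [left; reflexivity|].
    apply (mass_bound w1 q lm p v (u * v)); try assumption.
    + reflexivity.
    + exists D1; assumption.
    + nra.
    + intros n Hn N. unfold q, k. destruct (Nat.eqb_spec n p); [congruence|].
      replace (v ^ 2 * (w1 n / (INR n - lm) ^ 2)) with (w1 n * (v ^ 2 / (INR n - lm) ^ 2)) by (unfold Rdiv; ring).
      replace (67 * (u * v) * (w1 n * / ((INR n - lp) * (INR n - lm)))) with
        (w1 n * (67 * (v * u) * / ((INR n - lp) * (INR n - lm)))) by ring.
      apply Rmult_le_compat_l; [apply Hw1|].
      destruct (Hgap n N) as [G|[G|G]]; [|congruence|]; apply le_INR in G.
      * replace ((INR n - lm) ^ 2) with ((lm - INR n) ^ 2) by ring.
        replace ((INR n - lp) * (INR n - lm)) with ((lm - INR n) * ((lm - INR n) + v + u)) by (unfold u, v; ring).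
        apply (near_side_ratio v u (lm - INR nm)); try lra.
        replace ((lm - INR nm) * (lm - INR nm + v + u)) with ((INR nm - lp) * (INR nm - lm)) by (unfold u, v; ring).
        rewrite (Rmult_comm v u). now apply Hn1.
      * replace (INR n - lm) with ((INR n - lp) + v + u) by (unfold u, v; ring).
        apply far_side_ratio; lra.
    + apply Tl; lra.
Qed.

(** * Limit points *)

Lemma unit_circle_angle x y : x ^ 2 + y ^ 2 = 1 -> exists t, 0 <= t <= 2 * PI /\ x = cos t /\ y = sin t.
Proof.
  intros H. assert (Hx : -1 <= x <= 1) by nra. pose proof (acos_bound x) as B. pose proof PI_RGT_0.
  assert (S : sqrt (1 - Rsqr x) = Rabs y).
  { replace (1 - Rsqr x) with (Rsqr y) by (unfold Rsqr; lra). apply sqrt_Rsqr_abs. }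
  destruct (Rle_or_lt 0 y) as [Hy|Hy].
  - exists (acos x). rewrite cos_acos, sin_acos, S, Rabs_pos_eq by lra. repeat split; lra.
  - exists (2 * PI - acos x). split; [lra|].
    rewrite cos_minus, sin_minus, cos_2PI, sin_2PI, cos_acos, sin_acos, S, Rabs_left by lra. split; lra.
Qed.

(** The angle is kept in a compact interval, for the bound on test functions and for the extraction
    of a limit direction. *)
Lemma lattice_angle a b : (0 < a * a + b * b)%Z ->
  exists t, 0 <= t <= 2 * PI /\ IZR a / zabs a b = cos t /\ IZR b / zabs a b = sin t.
Proof.
  intros H. apply unit_circle_angle. unfold zabs.
  apply IZR_lt in H. rewrite plus_IZR, !mult_IZR in H.
  assert (P : 0 < IZR a ^ 2 + IZR b ^ 2) by nra.
  pose proof (sqrt_lt_R0 _ P) as Q. pose proof (pow2_sqrt (IZR a ^ 2 + IZR b ^ 2) ltac:(lra)) as E.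
  set (s := sqrt _) in *.
  replace ((IZR a / s) ^ 2 + (IZR b / s) ^ 2) with ((IZR a ^ 2 + IZR b ^ 2) / s ^ 2) by (field; lra).
  rewrite E. field. lra.
Qed.

Lemma smooth_S1_continuity f : smooth_S1 f -> continuity (fun t => f (cos t) (sin t)).
Proof.
  intros [D [D0 D1]] t. apply derivable_continuous_pt. exists (D 1%nat t).
  apply (is_derive_Reals (fun t => f (cos t) (sin t))).
  apply is_derive_ext with (D 0%nat); [assumption|]. apply is_derive_Reals, D1.
Qed.

Lemma smooth_S1_bounded f : smooth_S1 f ->
  exists M, forall t, 0 <= t <= 2 * PI -> Rabs (f (cos t) (sin t)) <= M.
Proof.
  intros Hf. pose proof PI_RGT_0.
  destruct (continuity_ab_maj (fun t => Rabs (f (cos t) (sin t))) 0 (2 * PI)) as [m [Hm _]]; [lra| |].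
  - intros c _. apply (continuity_pt_comp (fun t => f (cos t) (sin t)) Rabs).
    + apply smooth_S1_continuity, Hf.
    + apply Rcontinuity_abs.
  - exists (Rabs (f (cos m) (sin m))). intros t Ht. now apply Hm.
Qed.

Lemma norm_const_nonneg lam D : sep lam D -> 0 <= norm_const lam.
Proof.
  intros H. destruct (norm_const_Series lam D H) as [E ->]. apply Series_nonneg; [|assumption].
  intros n. destruct (excluded_middle_informative (in_N2 n)) as [N|N].
  - destruct (H n N) as [H1 _]. apply Rmult_le_pos; [apply r2_nonneg|].
    apply Rlt_le, Rinv_0_lt_compat, pow2_gt_0; lra.
  - rewrite (r2_out n N). unfold Rdiv; lra.
Qed.

Lemma ghat_sq_nonneg lam D a b : sep lam D -> 0 <= ghat_sq lam a b.
Proof.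
  intros H. pose proof (norm_const_nonneg lam D H) as N. unfold ghat_sq.
  assert (Q : 0 <= (IZR (a * a + b * b) - lam) ^ 2 * norm_const lam)
    by (apply Rmult_le_pos; [apply pow2_ge_0|assumption]).
  destruct Q as [Q|Q]; [apply Rlt_le, Rinv_0_lt_compat, Q|rewrite <- Q, Rinv_0; lra].
Qed.

(** All terms are nonnegative, so one lattice point bounds the sum from below. The sup bound on f is
    used for convergence, through the series defining [norm_const]. *)
Lemma Op_lower lam D f a b t : sep lam D -> smooth_S1 f -> nonneg_S1 f -> (0 < a * a + b * b)%Z ->
  IZR a / zabs a b = cos t -> IZR b / zabs a b = sin t ->
  f (cos t) (sin t) * ghat_sq lam a b <= Op lam f.
Proof.
  intros HD Hf Hn Hab Ec Es. unfold Op.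
  set (s := fun n => shell_sum (S n) (fun a b => f (IZR a / zabs a b) (IZR b / zabs a b) * ghat_sq lam a b)).
  destruct (smooth_S1_bounded f Hf) as [M HM].
  assert (Hs0 : forall n a b, (a * a + b * b = Z.of_nat (S n))%Z ->
     0 <= f (IZR a / zabs a b) (IZR b / zabs a b) * ghat_sq lam a b <= M * ghat_sq lam a b).
  { intros n x y Hxy. destruct (lattice_angle x y ltac:(lia)) as [t' [T1 [-> ->]]].
    pose proof (ghat_sq_nonneg lam D x y HD). pose proof (Hn t') as F0. pose proof (HM t' T1) as F1.
    rewrite Rabs_pos_eq in F1 by assumption.
    split; [apply Rmult_le_pos; assumption|apply Rmult_le_compat_r; assumption]. }
  assert (S0 : forall n, 0 <= s n).
  { intros n. unfold s. apply Rle_trans with (shell_sum (S n) (fun _ _ => 0)).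
    - rewrite shell_sum_const. lra.
    - apply shell_sum_le. intros x y Hxy. now apply (Hs0 n). }
  assert (Es1 : ex_series s).
  { destruct (norm_const_Series lam D HD) as [E _]. apply ex_series_incr_1 in E.
    apply (ex_series_Rscal (M * / norm_const lam)) in E.
    refine (ex_series_le s _ _ E). intros n.
    change (Rabs (s n) <= M * / norm_const lam * (r2 (S n) / (INR (S n) - lam) ^ 2)).
    rewrite Rabs_pos_eq by apply S0. unfold s.
    apply Rle_trans with (shell_sum (S n) (fun _ _ => M * / ((INR (S n) - lam) ^ 2 * norm_const lam))).
    - apply shell_sum_le. intros x y Hxy. eapply Rle_trans; [now apply (Hs0 n)|].
      unfold ghat_sq. rewrite Hxy, <- INR_IZR_INZ. lra.
    - rewrite shell_sum_const, Rinv_mult. unfold Rdiv. right; ring. }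
  rewrite series_Series by assumption.
  set (n := Z.to_nat (a * a + b * b - 1)).
  assert (Hn' : (a * a + b * b = Z.of_nat (S n))%Z) by (unfold n; lia).
  apply Rle_trans with (s n); [|now apply Series_single].
  unfold s. rewrite <- Ec, <- Es.
  apply (shell_sum_single (S n) (fun a b => f (IZR a / zabs a b) (IZR b / zabs a b) * ghat_sq lam a b)); [|assumption].
  intros x y Hxy. now apply (Hs0 n).
Qed.

(** [sep] is carried along because it ensures that the chosen limits in [norm_const] and [Op] are
    sums. *)
Definition scarred (c lam : R) : Prop :=
  (exists D, sep lam D) /\ exists a b, (0 < a * a + b * b)%Z /\ c <= ghat_sq lam a b.

Lemma scarred_limit (L2 : R -> Prop) c mu : 0 < c -> (forall lam, L2 lam -> scarred c lam) ->
  weak_star_limit_point L2 mu ->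
  exists t, forall f, smooth_S1 f -> nonneg_S1 f -> c * f (cos t) (sin t) <= mu f.
Proof.
  intros Hc HL [lk [H1 [_ H3]]].
  assert (A : forall k, exists t, 0 <= t <= 2 * PI /\
     forall f, smooth_S1 f -> nonneg_S1 f -> c * f (cos t) (sin t) <= Op (lk k) f).
  { intros k. destruct (HL _ (H1 k)) as [[D HD] [a [b [Hab Hg]]]].
    destruct (lattice_angle a b Hab) as [t [Ht [Ec Es]]]. exists t. split; [assumption|].
    intros f Hf Hn. eapply Rle_trans; [|apply (Op_lower _ D f a b t); assumption].
    rewrite Rmult_comm. apply Rmult_le_compat_l; [apply Hn|assumption]. }
  set (tk := fun k => proj1_sig (constructive_indefinite_description _ (A k))).
  assert (Htk : forall k, 0 <= tk k <= 2 * PI /\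
     forall f, smooth_S1 f -> nonneg_S1 f -> c * f (cos (tk k)) (sin (tk k)) <= Op (lk k) f).
  { intros k. unfold tk. destruct (constructive_indefinite_description _ (A k)); assumption. }
  destruct (Bolzano_Weierstrass tk (fun x => 0 <= x <= 2 * PI)) as [t Ht].
  { apply compact_P3. }
  { intros k. apply Htk. }
  exists t. intros f Hf Hn. apply Rnot_lt_le. intros Hlt.
  set (e := (c * f (cos t) (sin t) - mu f) / 2). assert (He : 0 < e) by (unfold e; lra).
  destruct (H3 f Hf e He) as [N HN].
  destruct (smooth_S1_continuity f Hf t (e / c)) as [d [Hd Hcont]]; [apply Rdiv_lt_0_compat; lra|].
  destruct (Ht (fun x => Rabs (x - t) < d) N) as [k [Hk Hkt]].
  { exists (mkposreal d Hd). intros x Hx. exact Hx. }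
  specialize (HN k Hk). unfold Rdist in HN. apply Rabs_def2 in HN.
  pose proof (proj2 (Htk k) f Hf Hn) as B.
  assert (Fc : Rabs (f (cos (tk k)) (sin (tk k)) - f (cos t) (sin t)) < e / c).
  { destruct (Req_dec (tk k) t) as [->|Hne].
    - rewrite Rminus_diag_eq, Rabs_R0 by reflexivity. apply Rdiv_lt_0_compat; lra.
    - apply Hcont. split; [split; [exact I|congruence]|exact Hkt]. }
  apply Rabs_def2 in Fc. destruct Fc as [_ Fc].
  assert (c * (f (cos t) (sin t) - f (cos (tk k)) (sin (tk k))) < e).
  { apply Rlt_le_trans with (c * (e / c)); [apply Rmult_lt_compat_l; lra|]. right; field; lra. }
  unfold e in *. lra.
Qed.

(** * The strong coupling window *)

Lemma separated_count (P : nat -> bool) s A B M : 0 < s -> A <= B ->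
  (forall m n, (m < n)%nat -> P m = true -> P n = true -> s <= INR n - INR m) ->
  (forall n, P n = true -> A <= INR n <= B) ->
  psum (fun n => if P n then 1 else 0) M <= (B - A) / s + 1.
Proof.
  intros Hs HAB Hsep HP.
  assert (H : psum (fun n => if P n then 1 else 0) M = 0 \/
    exists m, (m < M)%nat /\ P m = true /\ psum (fun n => if P n then 1 else 0) M <= (INR m - A) / s + 1).
  { induction M as [|M IH]; [left; reflexivity|]. simpl psum. destruct (P M) eqn:E.
    - right. exists M. split; [lia|]. split; [assumption|].
      destruct IH as [->|[m [Hm [Pm Bm]]]].
      + destruct (HP M E). assert (0 <= (INR M - A) / s); [|lra].
        apply Rmult_le_pos; [lra|apply Rlt_le, Rinv_0_lt_compat; lra].
      + pose proof (Hsep m M Hm Pm E).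
        assert ((INR m - A) / s + 1 <= (INR M - A) / s); [|lra].
        apply Rmult_le_reg_r with s; [lra|]. unfold Rdiv.
        rewrite Rmult_plus_distr_r, !Rmult_assoc, Rinv_l by lra. lra.
    - destruct IH as [->|[m [Hm [Pm Bm]]]]; [left; lra|].
      right. exists m. split; [lia|]. split; [assumption|lra]. }
  destruct H as [->|[m [_ [Pm Bm]]]].
  - assert (0 <= (B - A) / s); [|lra]. apply Rmult_le_pos; [lra|apply Rlt_le, Rinv_0_lt_compat; lra].
  - eapply Rle_trans; [apply Bm|]. apply Rplus_le_compat_r. destruct (HP m Pm).
    apply Rmult_le_compat_r; [apply Rlt_le, Rinv_0_lt_compat; lra|lra].
Qed.

Definition near (z r : R) (n : nat) : bool := if Rle_dec (Rabs (INR n - z)) r then true else false.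

Lemma near_count z r M : 0 <= r -> psum (fun n => if near z r n then 1 else 0) M <= 2 * r + 1.
Proof.
  intros Hr. replace (2 * r) with ((z + r - (z - r)) / 1) by field.
  apply separated_count; [lra|lra| |].
  - intros m n H _ _. assert (INR (S m) <= INR n) by (apply le_INR; lia). rewrite S_INR in H0. lra.
  - intros n H. unfold near in H. destruct (Rle_dec _ _) as [H1|H1]; [|discriminate].
    apply Rabs_le_between in H1. lra.
Qed.

(** The weight of the strong coupling condition at an eigenvalue whose upper neighbour in N_2 is
    m. *)
Definition window (eta : R) (m n : nat) : R :=
  if Rlt_dec (Rabs (INR n - INR m)) (rpow (INR m) eta) then r2 n else 0.

Lemma window_bound eta m n : 0 <= window eta m n <= r2 n.
Proof. unfold window. pose proof (r2_nonneg n). destruct (Rlt_dec _ _); lra. Qed.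

Lemma rpow_le x eta : 1 <= x -> eta <= 1 -> rpow x eta <= x.
Proof.
  intros Hx He. unfold rpow. destruct (Rle_dec x 0); [lra|].
  rewrite <- (Rpower_1 x) at 2 by lra. apply Rle_Rpower; lra.
Qed.

(** Since m^eta <= m, the window lies within the range enumerated by [window_sum]; the finite sum is
    thus a full series with weight [window]. *)
Lemma window_sum_series eta lam m : eta <= 1 -> (1 <= m)%nat ->
  is_series (fun n => window eta m n * kern lam n) (window_sum eta lam m).
Proof.
  intros He Hm.
  set (F := fun n => if Rlt_dec (Rabs (INR n - INR m)) (rpow (INR m) eta) then term lam n else 0).
  assert (E : window_sum eta lam m = psum F (2 * m + 2)).
  { unfold window_sum. fold F. induction (2 * m + 2)%nat as [|k IH]; [reflexivity|].
    rewrite seq_S, map_app, rsum_app, IH. simpl. lra. }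
  assert (EF : forall n, F n = window eta m n * kern lam n).
  { intros n. unfold F, window, term, kern. destruct (Rlt_dec _ _); ring. }
  rewrite E. rewrite (psum_ext _ _ _ (fun i _ => EF i)).
  apply is_series_finite. intros n Hn. unfold window.
  destruct (Rlt_dec _ _) as [H|H]; [|ring]. exfalso.
  assert (M1 : 1 <= INR m) by (apply (le_INR 1); lia).
  pose proof (rpow_le (INR m) eta M1 He). apply le_INR in Hn.
  rewrite plus_INR, mult_INR in Hn. simpl (INR 2) in Hn.
  pose proof (Rle_abs (INR n - INR m)). lra.
Qed.

Section Window.
Variables (eta : R) (p nm np : nat).
Hypothesis eta_range : 131 / 146 < eta < 1.
Let x := INR p.
Let y := INR np.
Let L := ln x.
Let G := exp (L / 100).
Let W := rpow x eta.
Hypothesis L1 : 1 <= L.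
Hypothesis np_gt : x < y.
Hypothesis nm_lt : INR nm < x.
Hypothesis gap_r : y - x <= G.
Hypothesis gap_l : x - INR nm <= G.

Lemma x_exp : x = exp L.
Proof.
  unfold L. rewrite exp_ln; [reflexivity|]. pose proof (pos_INR nm). unfold x in *. lra.
Qed.

Lemma x_ge1 : 1 <= x.
Proof. rewrite x_exp. pose proof (exp_ineq1_le L). lra. Qed.

Lemma W_exp : W = exp (eta * L).
Proof. unfold W, rpow. pose proof x_ge1. destruct (Rle_dec x 0); [lra|]. reflexivity. Qed.

Lemma G_pos : 0 < G.
Proof. apply exp_pos. Qed.

Lemma W_pos : 0 < W.
Proof. rewrite W_exp. apply exp_pos. Qed.

Lemma W_le_x : W <= x.
Proof. apply rpow_le; [apply x_ge1|lra]. Qed.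

(** By (1 + s)^eta <= 1 + s and W <= x, the half-width of the window grows by no more than its
    centre moves. *)
Lemma rpow_y : W <= rpow y eta <= W + (y - x).
Proof.
  pose proof x_ge1 as X1. unfold W, rpow. destruct (Rle_dec y 0); [lra|]. destruct (Rle_dec x 0); [lra|].
  split.
  - apply Rle_Rpower_l; lra.
  - replace y with (x * (1 + (y - x) / x)) at 1 by (field; lra).
    assert (Q : 0 <= (y - x) / x) by (apply Rmult_le_pos; [lra|apply Rlt_le, Rinv_0_lt_compat; lra]).
    rewrite <- Rpower_mult_distr by lra.
    assert (A : Rpower (1 + (y - x) / x) eta <= 1 + (y - x) / x).
    { rewrite <- (Rpower_1 (1 + (y - x) / x)) at 2 by lra. apply Rle_Rpower; lra. }
    assert (B : Rpower x eta <= x).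
    { rewrite <- (Rpower_1 x) at 2 by lra. apply Rle_Rpower; lra. }
    assert (E : 0 < Rpower x eta) by apply exp_pos.
    assert (D : Rpower x eta * ((y - x) / x) <= y - x).
    { apply Rle_trans with (x * ((y - x) / x)); [apply Rmult_le_compat_r; assumption|right; field; lra]. }
    nra.
Qed.

(** Outside the window d = |n - x| >= W, so that |n - lam| >= d / 2, while [rho n] is at most
    (3x)^(7/4) (d/W)^2. The tail is thus bounded by 4 (3x)^(7/4) / W^2 times the convergent sum of
    r2 n / rho n. *)
Lemma window_tail lam : 2 * G <= W -> INR nm < lam < y ->
  4 * G ^ 2 * (4 * Series (fun n => r2 n / rho n) * (Rpower (3 * x) (7 / 4) / W ^ 2)) <= 1 ->
  (exists D, sep lam D) ->
  Series (fun n => (r2 n - window eta p n) / (INR n - lam) ^ 2) <= / (y - INR nm) ^ 2.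
Proof.
  intros HG Hlam Hbig [D HD]. pose proof x_ge1 as X1. pose proof W_pos as W0. pose proof W_le_x as Wx.
  pose proof G_pos as G0.
  set (K := 4 * (Rpower (3 * x) (7 / 4) / W ^ 2)).
  assert (K0 : 0 <= K).
  { apply Rmult_le_pos; [lra|]. apply Rmult_le_pos; [apply Rlt_le, exp_pos|]. apply Rlt_le, Rinv_0_lt_compat, pow_lt; lra. }
  assert (PW : forall n, 0 <= (r2 n - window eta p n) / (INR n - lam) ^ 2 <= K * (r2 n / rho n)).
  { intros n. pose proof (r2_nonneg n) as R0. pose proof (rho_pos n) as rp.
    assert (Q : 0 <= K * (r2 n / rho n)).
    { apply Rmult_le_pos; [assumption|]. apply Rmult_le_pos; [assumption|apply Rlt_le, Rinv_0_lt_compat; lra]. }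
    unfold window. fold x W. destruct (Rlt_dec (Rabs (INR n - x)) W) as [H|H].
    { rewrite Rminus_diag_eq by reflexivity. unfold Rdiv at 1 3. rewrite Rmult_0_l. lra. }
    rewrite Rminus_0_r. apply Rnot_lt_le in H. set (d := Rabs (INR n - x)) in *.
    assert (dl : d / 2 <= Rabs (INR n - lam)).
    { assert (T : d <= Rabs (INR n - lam) + Rabs (lam - x)).
      { unfold d. replace (INR n - x) with ((INR n - lam) + (lam - x)) by ring. apply Rabs_triang. }
      assert (Rabs (lam - x) <= G) by (apply Rabs_le; lra). lra. }
    assert (d2 : d ^ 2 / 4 <= (INR n - lam) ^ 2).
    { rewrite <- (pow2_abs (INR n - lam)). set (z := Rabs (INR n - lam)) in *. nra. }
    assert (d0 : 0 < d ^ 2 / 4) by nra.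
    split; [apply Rmult_le_pos; [assumption|apply Rlt_le, Rinv_0_lt_compat; lra]|].
    assert (dW : 1 <= d / W).
    { apply Rmult_le_reg_r with W; [lra|]. unfold Rdiv. rewrite Rmult_assoc, Rinv_l by lra. lra. }
    assert (N1 : INR n + 1 <= 3 * x * (d / W)).
    { assert (INR n <= x + d) by (unfold d; pose proof (Rle_abs (INR n - x)); lra).
      assert (d <= x * (d / W)).
      { replace d with (W * (d / W)) at 1 by (field; lra). apply Rmult_le_compat_r; lra. }
      nra. }
    assert (Rh : rho n <= Rpower (3 * x) (7 / 4) * (d / W) ^ 2).
    { unfold rho. pose proof (pos_INR n). eapply Rle_trans; [apply Rle_Rpower_l; [lra|split; [|apply N1]]; lra|].
      rewrite <- Rpower_mult_distr by lra. apply Rmult_le_compat_l; [apply Rlt_le, exp_pos|].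
      rewrite <- Rpower_pow by lra. apply Rle_Rpower; [lra|simpl; lra]. }
    replace (K * (r2 n / rho n)) with (r2 n * (K / rho n)) by (unfold Rdiv; ring).
    apply Rmult_le_compat_l; [assumption|].
    apply Rle_trans with (/ (d ^ 2 / 4)); [apply Rinv_le_contravar; lra|].
    apply Rmult_le_reg_r with (rho n * (d ^ 2 / 4)); [apply Rmult_lt_0_compat; lra|].
    replace (/ (d ^ 2 / 4) * (rho n * (d ^ 2 / 4))) with (rho n) by (field; lra).
    replace (K / rho n * (rho n * (d ^ 2 / 4))) with (K * d ^ 2 / 4) by (field; lra).
    replace (K * d ^ 2 / 4) with (Rpower (3 * x) (7 / 4) * (d / W) ^ 2); [assumption|].
    unfold K. field. lra. }
  eapply Rle_trans.
  { apply Series_le; [apply PW|]. apply ex_series_Rscal, r2_rho_summable. }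
  rewrite Series_scal_l.
  apply Rle_trans with (/ (4 * G ^ 2)).
  - assert (0 < 4 * G ^ 2) by nra.
    apply Rmult_le_reg_l with (4 * G ^ 2); [assumption|]. rewrite Rinv_r by lra.
    unfold K. lra.
  - apply Rinv_le_contravar; [apply pow_lt; lra|].
    replace (4 * G ^ 2) with ((2 * G) ^ 2) by ring. apply pow_incr. lra.
Qed.

(** The two windows differ only at shells within 2G of x - W or x + W: one G for the shift of the
    centre, one for the change of width. These are at most 2 (4G + 1) integers, each with a term of
    size O(sqrt x / W). *)
Lemma window_mismatch lp : 12 * G <= W -> 4 * W <= x -> 1 <= G -> x < lp < y ->
  960 * G ^ 2 * sqrt x <= W ->
  Series (fun n => (window eta p n - window eta np n) * kern lp n) <= / (y - INR nm).
Proof.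
  intros HG Hx HG1 Hlp Hbig. pose proof x_ge1 as X1. pose proof W_pos as W0. pose proof G_pos as G0.
  pose proof rpow_y as [V1 V2]. set (V := rpow y eta) in *.
  (* The product of the bounds 12 sqrt x for [r2] and 4 / W for the kernel near the ends of the
     window. *)
  set (c := 48 * sqrt x / W).
  assert (sx : 0 <= sqrt x) by apply sqrt_pos.
  assert (c0 : 0 <= c).
  { apply Rmult_le_pos; [lra|apply Rlt_le, Rinv_0_lt_compat; lra]. }
  set (f := fun n => (window eta p n - window eta np n) * kern lp n).
  set (ind := fun z n => if near z (2 * G) n then 1 else 0).
  assert (ind0 : forall z n, 0 <= ind z n) by (intros; unfold ind; destruct (near _ _ _); lra).
  assert (PW : forall n, Rabs (f n) <= c * (ind (x - W)%R n + ind (x + W)%R n)).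
  { intros n.
    assert (Z : f n = 0 -> Rabs (f n) <= c * (ind (x - W)%R n + ind (x + W)%R n)).
    { intros ->. rewrite Rabs_R0. apply Rmult_le_pos; [assumption|].
      pose proof (ind0 (x - W) n). pose proof (ind0 (x + W) n). lra. }
    assert (Key : (Rabs (f n) <= r2 n * Rabs (kern lp n)) /\ (f n = 0 \/ W - 2 * G <= Rabs (INR n - x) <= W + 2 * G)).
    { assert (T1 : Rabs (INR n - y) <= Rabs (INR n - x) + G).
      { replace (INR n - y) with ((INR n - x) + (x - y)) by ring. eapply Rle_trans; [apply Rabs_triang|].
        rewrite (Rabs_left (x - y)) by lra. lra. }
      assert (T2 : Rabs (INR n - x) <= Rabs (INR n - y) + G).
      { replace (INR n - x) with ((INR n - y) + (y - x)) by ring. eapply Rle_trans; [apply Rabs_triang|].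
        rewrite (Rabs_right (y - x)) by lra. lra. }
      unfold f, window. fold x y W V. pose proof (r2_nonneg n) as R0.
      rewrite Rabs_mult.
      destruct (Rlt_dec (Rabs (INR n - x)) W) as [H1|H1], (Rlt_dec (Rabs (INR n - y)) V) as [H2|H2].
      - split; [|left; ring]. apply Rmult_le_compat_r; [apply Rabs_pos|]. rewrite Rabs_pos_eq; lra.
      - split; [|right; lra]. apply Rmult_le_compat_r; [apply Rabs_pos|]. rewrite Rabs_pos_eq; lra.
      - split; [|right; lra]. apply Rmult_le_compat_r; [apply Rabs_pos|]. rewrite Rabs_left1; lra.
      - split; [|left; ring]. apply Rmult_le_compat_r; [apply Rabs_pos|]. rewrite Rabs_pos_eq; lra. }
    destruct Key as [K1 [K2|K2]]; [apply Z, K2|].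
    assert (I : 1 <= ind (x - W) n + ind (x + W) n).
    { pose proof (ind0 (x - W) n) as I1. pose proof (ind0 (x + W) n) as I2. unfold ind, near in *.
      destruct (Rle_dec (Rabs (INR n - (x - W))) (2 * G)) as [J1|J1]; [lra|].
      destruct (Rle_dec (Rabs (INR n - (x + W))) (2 * G)) as [J2|J2]; [lra|].
      exfalso. destruct (Rle_or_lt x (INR n)).
      - apply J2. rewrite Rabs_pos_eq in K2 by lra. apply Rabs_le. lra.
      - apply J1. rewrite Rabs_left in K2 by lra. apply Rabs_le. lra. }
    assert (B : r2 n * Rabs (kern lp n) <= c); [|nra].
    assert (nx : x / 2 <= INR n <= 2 * x).
    { destruct K2 as [_ K2]. apply Rabs_le_between in K2. lra. }
    assert (B1 : r2 n <= 12 * sqrt x).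
    { eapply Rle_trans; [apply r2_le_sqrt|]. replace (12 * sqrt x) with (6 * (2 * sqrt x)) by ring.
      apply Rmult_le_compat_l; [lra|]. replace 2 with (sqrt 4) by (replace 4 with (2 * 2) by ring; apply sqrt_square; lra).
      rewrite <- sqrt_mult by lra. apply sqrt_le_1_alt. lra. }
    assert (B2 : Rabs (kern lp n) <= 4 / W).
    { unfold kern. unfold Rminus at 1. eapply Rle_trans; [apply Rabs_triang|]. rewrite Rabs_Ropp, Rabs_inv.
      assert (D1 : W / 2 <= Rabs (INR n - lp)).
      { assert (Rabs (INR n - x) <= Rabs (INR n - lp) + G); [|lra].
        replace (INR n - x) with ((INR n - lp) + (lp - x)) by ring. eapply Rle_trans; [apply Rabs_triang|].
        rewrite (Rabs_right (lp - x)) by lra. lra. }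
      assert (D2 : / Rabs (INR n - lp) <= / (W / 2)) by (apply Rinv_le_contravar; lra).
      assert (D3 : Rabs (INR n / (INR n ^ 2 + 1)) <= 2 / W).
      { rewrite Rabs_pos_eq by (apply Rmult_le_pos; [lra|apply Rlt_le, Rinv_0_lt_compat; nra]).
        apply Rmult_le_reg_r with ((INR n ^ 2 + 1) * W); [apply Rmult_lt_0_compat; [nra|lra]|].
        replace (INR n / (INR n ^ 2 + 1) * ((INR n ^ 2 + 1) * W)) with (INR n * W) by (field; nra).
        replace (2 / W * ((INR n ^ 2 + 1) * W)) with (2 * (INR n ^ 2 + 1)) by (field; lra). nra. }
      replace (/ (W / 2)) with (2 / W) in D2 by (field; lra).
      replace (4 / W) with (2 / W + 2 / W) by (field; lra). lra. }
    apply Rle_trans with (12 * sqrt x * (4 / W)); [|right; unfold c; field; lra].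
    apply Rmult_le_compat; [apply r2_nonneg|apply Rabs_pos|assumption|assumption]. }
  destruct (INR_unbounded (x + W + 2 * G)) as [M HM].
  assert (Fz : forall n, (M <= n)%nat -> f n = 0).
  { intros n Hn. apply le_INR in Hn. specialize (PW n). unfold ind, near in PW.
    destruct (Rle_dec (Rabs (INR n - (x - W))) (2 * G)) as [J1|J1]; [apply Rabs_le_between in J1; lra|].
    destruct (Rle_dec (Rabs (INR n - (x + W))) (2 * G)) as [J2|J2]; [apply Rabs_le_between in J2; lra|].
    rewrite Rplus_0_r, Rmult_0_r in PW. pose proof (Rabs_pos (f n)).
    destruct (Req_dec (f n) 0) as [E|E]; [assumption|]. apply Rabs_pos_lt in E. lra. }
  rewrite (is_series_unique _ _ (is_series_finite f M Fz)).
  apply Rle_trans with (c * (2 * (2 * (2 * G) + 1))).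
  - apply Rle_trans with (psum (fun n => c * (ind (x - W) n + ind (x + W) n)) M).
    + apply psum_le. intros n _. eapply Rle_trans; [apply Rle_abs|apply PW].
    + rewrite psum_scal, psum_plus. apply Rmult_le_compat_l; [assumption|].
      pose proof (near_count (x - W) (2 * G) M ltac:(lra)). pose proof (near_count (x + W) (2 * G) M ltac:(lra)).
      unfold ind. lra.
  - apply Rle_trans with (/ (2 * G)); [|apply Rinv_le_contravar; lra].
    apply Rmult_le_reg_l with (2 * G); [lra|]. rewrite Rinv_r by lra.
    unfold c. apply Rle_trans with (960 * G ^ 2 * sqrt x / W).
    + replace (2 * G * (48 * sqrt x / W * (2 * (2 * (2 * G) + 1)))) with
       ((192 * G * (4 * G + 1)) * (sqrt x / W)) by (field; lra).
      replace (960 * G ^ 2 * sqrt x / W) with (960 * G ^ 2 * (sqrt x / W)) by (field; lra).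
      apply Rmult_le_compat_r; [apply Rmult_le_pos; [assumption|apply Rlt_le, Rinv_0_lt_compat; lra]|]. nra.
    + apply Rmult_le_reg_r with W; [lra|]. replace (960 * G ^ 2 * sqrt x / W * W) with (960 * G ^ 2 * sqrt x) by (field; lra). lra.
Qed.

End Window.

Lemma exp_dominates_const a C : 0 < a -> exists L0, 1 <= L0 /\ forall L, L0 <= L -> C <= exp (a * L).
Proof.
  intros Ha. destruct (exp_dominates a (Rabs C) Ha) as [L0 [H1 H2]]. exists L0. split; [assumption|].
  intros L HL. specialize (H2 L HL). pose proof (Rle_abs C). pose proof (Rabs_pos C).
  assert (1 <= L ^ 2) by nra. nra.
Qed.

(** With x = exp L the four claims compare powers of x: they hold for large L because eta > 1/100,
    eta < 1, eta > 1/50 + 1/2 and 2 eta > 7/4 + 1/50. The last follows from 2 * 131/146 > 1.79. *)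
Lemma window_large eta S : 131 / 146 < eta < 1 -> exists L0, 1 <= L0 /\ forall L, L0 <= L ->
  12 * exp (L / 100) <= exp (eta * L) /\ 4 * exp (eta * L) <= exp L /\
  960 * exp (L / 100) ^ 2 * exp (L / 2) <= exp (eta * L) /\
  4 * exp (L / 100) ^ 2 * (4 * S * (Rpower (3 * exp L) (7 / 4) / exp (eta * L) ^ 2)) <= 1.
Proof.
  intros He.
  destruct (exp_dominates_const (eta - / 100) 12 ltac:(lra)) as [L1 [H1 K1]].
  destruct (exp_dominates_const (1 - eta) 4 ltac:(lra)) as [L2 [H2 K2]].
  destruct (exp_dominates_const (eta - 52 / 100) 960 ltac:(lra)) as [L3 [H3 K3]].
  destruct (exp_dominates_const (2 * eta - 177 / 100) (16 * S * Rpower 3 (7 / 4)) ltac:(lra)) as [L4 [H4 K4]].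
  exists (Rmax (Rmax L1 L2) (Rmax L3 L4)). split; [eapply Rle_trans; [|apply Rmax_l]; eapply Rle_trans; [|apply Rmax_l]; assumption|].
  intros L HL.
  assert (A1 : L1 <= L) by (eapply Rle_trans; [|apply HL]; eapply Rle_trans; [apply (Rmax_l L1 L2)|apply Rmax_l]).
  assert (A2 : L2 <= L) by (eapply Rle_trans; [|apply HL]; eapply Rle_trans; [apply (Rmax_r L1 L2)|apply Rmax_l]).
  assert (A3 : L3 <= L) by (eapply Rle_trans; [|apply HL]; eapply Rle_trans; [apply (Rmax_l L3 L4)|apply Rmax_r]).
  assert (A4 : L4 <= L) by (eapply Rle_trans; [|apply HL]; eapply Rle_trans; [apply (Rmax_r L3 L4)|apply Rmax_r]).
  specialize (K1 L A1). specialize (K2 L A2). specialize (K3 L A3). specialize (K4 L A4).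
  assert (G2 : exp (L / 100) ^ 2 = exp (L / 50)).
  { simpl. rewrite Rmult_1_r, <- exp_plus. f_equal. field. }
  assert (W2 : exp (eta * L) ^ 2 = exp (2 * eta * L)).
  { simpl. rewrite Rmult_1_r, <- exp_plus. f_equal. ring. }
  rewrite G2, W2. repeat split.
  - replace (eta * L) with ((eta - / 100) * L + L / 100) by field. rewrite exp_plus.
    apply Rmult_le_compat_r; [apply Rlt_le, exp_pos|assumption].
  - replace L with ((1 - eta) * L + eta * L) at 2 by ring. rewrite exp_plus.
    apply Rmult_le_compat_r; [apply Rlt_le, exp_pos|assumption].
  - replace (eta * L) with ((eta - 52 / 100) * L + (L / 50 + L / 2)) by field. rewrite exp_plus, exp_plus, Rmult_assoc.
    apply Rmult_le_compat_r; [|assumption]. pose proof (exp_pos (L / 50)). pose proof (exp_pos (L / 2)). nra.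
  - assert (E : Rpower (3 * exp L) (7 / 4) = Rpower 3 (7 / 4) * exp (7 / 4 * L)).
    { rewrite <- Rpower_mult_distr by (try apply exp_pos; lra). f_equal. unfold Rpower. now rewrite ln_exp. }
    rewrite E. pose proof (exp_pos (2 * eta * L)) as P.
    apply Rmult_le_reg_r with (exp (2 * eta * L)); [assumption|].
    replace (4 * exp (L / 50) * (4 * S * (Rpower 3 (7 / 4) * exp (7 / 4 * L) / exp (2 * eta * L))) * exp (2 * eta * L))
      with (16 * S * Rpower 3 (7 / 4) * (exp (L / 50) * exp (7 / 4 * L))) by (field; lra).
    rewrite Rmult_1_l. replace (2 * eta * L) with ((2 * eta - 177 / 100) * L + (L / 50 + 7 / 4 * L)) by field.
    rewrite exp_plus, <- exp_plus. apply Rmult_le_compat_r; [apply Rlt_le, exp_pos|assumption].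
Qed.

(** * Scarred eigenvalues next to a shell *)

Definition consecutive (nm p np : nat) : Prop :=
  in_N2 nm /\ in_N2 p /\ in_N2 np /\ (nm < p)%nat /\ (p < np)%nat /\
  forall n, in_N2 n -> (n <= nm)%nat \/ n = p \/ (np <= n)%nat.

Lemma scarred_of_norm lam p D : sep lam D -> in_N2 p -> (1 <= p)%nat ->
  (INR p - lam) ^ 2 * norm_const lam <= 1081 -> scarred (/ 1081) lam.
Proof.
  intros HD Np p1 H. split; [exists D; assumption|].
  assert (Q : exists a b, (a * a + b * b = Z.of_nat p)%Z).
  { unfold in_N2 in Np. rewrite r2_count in Np.
    destruct (filter (on_shell p) (zbox p)) as [|[a b] l] eqn:E; [simpl in Np; lra|].
    exists a, b. assert (I : In (a, b) (filter (on_shell p) (zbox p))) by (rewrite E; left; reflexivity).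
    apply filter_In in I. apply Z.eqb_eq, I. }
  destruct Q as [a [b Hab]]. exists a, b. split; [lia|].
  unfold ghat_sq. rewrite Hab, <- INR_IZR_INZ. apply Rinv_le_contravar; [|assumption].
  destruct (HD p Np) as [Hne _].
  assert (P : 0 < (INR p - lam) ^ 2) by (apply pow2_gt_0; lra).
  apply Rmult_lt_0_compat; [assumption|].
  destruct (norm_const_Series lam D HD) as [E ->].
  apply Rlt_le_trans with (r2 p / (INR p - lam) ^ 2).
  - apply Rdiv_lt_0_compat; assumption.
  - apply (Series_single (fun n => r2 n / (INR n - lam) ^ 2)); [|assumption].
    intros n. destruct (excluded_middle_informative (in_N2 n)) as [N|N].
    + destruct (HD n N) as [H1 _]. apply Rmult_le_pos; [apply r2_nonneg|].
      apply Rlt_le, Rinv_0_lt_compat, pow2_gt_0; lra.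
    + rewrite (r2_out n N). unfold Rdiv; lra.
Qed.

Lemma consecutive_sep nm p np lam : consecutive nm p np ->
  INR nm < lam < INR np -> lam <> INR p -> exists D, sep lam D.
Proof.
  intros [_ [_ [_ [H1 [H2 H]]]]] Hl Hp. apply lt_INR in H1. apply lt_INR in H2. pose proof (pos_INR nm).
  destruct (Rlt_or_le lam (INR p)) as [Hlt|Hge].
  - apply (sep_gap lam (INR nm) (INR p)); [lra|lra|].
    intros n N. destruct (H n N) as [G|[->|G]]; [left; now apply le_INR|right; lra|right].
    apply le_INR in G. lra.
  - apply (sep_gap lam (INR p) (INR np)); [lra|lra|].
    intros n N. destruct (H n N) as [G|[->|G]]; [left|left; lra|right; now apply le_INR].
    apply le_INR in G. lra.
Qed.

Lemma sep_not_N2 lam D : sep lam D -> forall n, in_N2 n -> lam <> INR n.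
Proof. intros H n N. destruct (H n N). auto. Qed.

Lemma scarred_near_shell cp C : coupling_ok cp -> exists P0, 1 <= P0 /\ forall nm p np,
  P0 <= INR p -> consecutive nm p np -> r2 p <= 8 ->
  INR np - INR p <= Rpower (INR p) (1 / 100) -> INR p - INR nm <= Rpower (INR p) (1 / 100) ->
  exists lam, in_Lambda cp C lam /\ scarred (/ 1081) lam /\
    (INR nm < lam < INR p \/ INR p < lam < INR np).
Proof.
  intros Hcp.
  (* w1 and w2 are the weights in the quantization conditions below and above p. *)
  enough (Main : exists P0, 1 <= P0 /\ forall nm p np,
    P0 <= INR p -> consecutive nm p np ->
    INR np - INR p <= Rpower (INR p) (1 / 100) -> INR p - INR nm <= Rpower (INR p) (1 / 100) ->
    exists w1 w2 : nat -> R, (forall n, 0 <= w1 n <= r2 n) /\ (forall n, 0 <= w2 n <= r2 n) /\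
      w1 p = r2 p /\ w1 nm = r2 nm /\ w1 np = r2 np /\ w2 p = r2 p /\ w2 np = r2 np /\
      (forall lam, INR p < lam < INR np ->
         Series (fun n => (w1 n - w2 n) * kern lam n) <= / (INR np - INR nm)) /\
      (forall lam, INR nm < lam < INR np -> lam <> INR p ->
         Series (fun n => (r2 n - w1 n) / (INR n - lam) ^ 2) <= / (INR np - INR nm) ^ 2) /\
      (forall lam, INR nm < lam < INR p -> is_series (fun n => w1 n * kern lam n) C -> in_Lambda cp C lam) /\
      (forall lam, INR p < lam < INR np -> is_series (fun n => w2 n * kern lam n) C -> in_Lambda cp C lam)).
  { destruct Main as [P0 [P1 Main]]. exists P0. split; [assumption|]. intros nm p np Hp Hc Hr G1 G2.
    destruct (Main nm p np Hp Hc G1 G2) as [w1 [w2 [B1 [B2 [E1 [E2 [E3 [E4 [E5 [T1 [T2 [L1 L2]]]]]]]]]]]].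
    destruct Hc as [Nm [Np [Nn [O1 [O2 Gap]]]]].
    destruct (eigenvalue_in_gap w1 C nm p B1 O1) as [lm [Hlm Sm]];
      [rewrite E2; exact Nm|rewrite E1; exact Np| |].
    { intros n N. destruct (Gap n N) as [G|[->|G]]; [left|right|right]; lia. }
    destruct (eigenvalue_in_gap w2 C p np B2 O2) as [lp [Hlp Sp]];
      [rewrite E4; exact Np|rewrite E5; exact Nn| |].
    { intros n N. destruct (Gap n N) as [G|[->|G]]; [left|left|right]; lia. }
    destruct (adjacent_eigenvalue_mass p nm np w1 w2 lm lp C) as [lam [Hl Hm]]; try assumption.
    { apply T1; assumption. }
    assert (Hpos : INR nm < lam < INR p \/ INR p < lam < INR np) by (destruct Hl; subst; [left|right]; assumption).
    exists lam. split; [|split; [|assumption]].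
    - destruct Hl; subst; [now apply L1|now apply L2].
    - destruct (consecutive_sep nm p np lam) as [D HD].
      + repeat split; assumption.
      + apply lt_INR in O1. apply lt_INR in O2. lra.
      + lra.
      + apply (scarred_of_norm lam p D); try assumption. lia. }
  destruct cp as [|eta]; simpl in Hcp.
  (* Weak coupling: both conditions have the weight [r2], so the mismatch and the tail vanish
     identically. *)
  - exists 1. split; [lra|]. intros nm p np Hp Hc _ _. exists r2, r2.
    assert (R0 : forall n, 0 <= r2 n <= r2 n) by (intros n; pose proof (r2_nonneg n); lra).
    assert (O : INR nm < INR p < INR np) by (destruct Hc as [_ [_ [_ [O1 [O2 _]]]]]; split; now apply lt_INR).
    assert (Z : forall f : nat -> R, (forall n, f n = 0) -> Series f = 0).
    { intros f Hf. apply is_series_unique. apply is_series_ext with (fun _ => 0); [intros; symmetry; apply Hf|].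
      apply (is_series_finite (fun _ => 0) 0). reflexivity. }
    assert (LL : forall lam, INR nm < lam < INR np -> lam <> INR p ->
       is_series (fun n => r2 n * kern lam n) C -> in_Lambda Weak C lam).
    { intros lam H1 H2 S. destruct (consecutive_sep nm p np lam Hc H1 H2) as [D HD].
      split; [now apply (sep_not_N2 lam D)|]. simpl. apply is_series_Reals. exact S. }
    repeat split; try apply R0; try reflexivity.
    + intros lam Hlam. rewrite Z; [apply Rlt_le, Rinv_0_lt_compat; lra|]. intros n; ring.
    + intros lam H1 H2. rewrite Z; [apply Rlt_le, Rinv_0_lt_compat, pow_lt; lra|].
      intros n. unfold Rdiv; ring.
    + apply (LL lam); try assumption; lra.
    + apply (LL lam); try assumption; lra.
    + apply (LL lam); try assumption; lra.
    + apply (LL lam); try assumption; lra.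
  - destruct (window_large eta (Series (fun n => r2 n / rho n)) Hcp) as [L0 [L01 HL]].
    exists (exp L0). split; [pose proof (exp_ineq1_le L0); lra|].
    intros nm p np Hp Hc G1 G2.
    assert (O : INR nm < INR p < INR np) by (destruct Hc as [_ [_ [_ [O1 [O2 _]]]]]; split; now apply lt_INR).
    set (L := ln (INR p)).
    assert (HL0 : L0 <= L) by (unfold L; rewrite <- (ln_exp L0); apply ln_mono; [apply exp_pos|assumption]).
    pose proof (exp_pos L0) as e0.
    assert (EL : INR p = exp L) by (unfold L; rewrite exp_ln; lra).
    assert (EG : Rpower (INR p) (1 / 100) = exp (L / 100)) by (unfold Rpower; f_equal; unfold L; field).
    rewrite EG in G1, G2.
    assert (EW : rpow (INR p) eta = exp (eta * L)).
    { unfold rpow. destruct (Rle_dec (INR p) 0); [lra|reflexivity]. }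
    assert (Es : sqrt (INR p) = exp (L / 2)).
    { apply sqrt_lem_1; [lra|apply Rlt_le, exp_pos|]. rewrite <- exp_plus, EL. f_equal. field. }
    destruct (HL L HL0) as [K1 [K2 [K3 K4]]].
    assert (L1 : 1 <= L) by lra.
    assert (G0 : 1 <= exp (L / 100)) by (pose proof (exp_ineq1_le (L / 100)); lra).
    assert (Hy : rpow (INR p) eta <= rpow (INR np) eta).
    { apply (rpow_y eta p nm np); try assumption; try lra; unfold L in *; assumption. }
    (* The upper neighbour in N_2 is p for an eigenvalue below p and [np] for one above; this fixes
       the centres of the two windows. *)
    exists (window eta p), (window eta np).
    assert (Win : forall m n, Rabs (INR n - INR m) < rpow (INR m) eta -> window eta m n = r2 n).
    { intros m n H. unfold window. destruct (Rlt_dec _ _); [reflexivity|contradiction]. }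
    split; [apply window_bound|]. split; [apply window_bound|].
    split; [apply Win; rewrite Rminus_diag_eq, Rabs_R0 by reflexivity; rewrite EW; lra|].
    split; [apply Win; rewrite Rabs_left by lra; rewrite EW; lra|].
    split; [apply Win; rewrite Rabs_right by lra; rewrite EW; lra|].
    split; [apply Win; rewrite Rabs_left by lra; rewrite EW in Hy; lra|].
    split; [apply Win; rewrite Rminus_diag_eq, Rabs_R0 by reflexivity; rewrite EW in Hy; lra|].
    split; [|split; [|split]].
    + intros lam Hlam. apply (window_mismatch eta p nm np); try assumption; try lra;
        fold L; rewrite ?EW, ?Es; rewrite ?EL; lra || assumption.
    + intros lam H1 H2. apply (window_tail eta p nm np); try assumption; try lra;
        fold L; rewrite ?EW; rewrite ?EL; try lra; try assumption.
      now apply (consecutive_sep nm p np).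
    + intros lam Hlam S. destruct (consecutive_sep nm p np lam Hc ltac:(lra) ltac:(lra)) as [D HD].
      split; [now apply (sep_not_N2 lam D)|]. simpl. exists p.
      destruct Hc as [Nm [Np [Nn [O1 [O2 Gap]]]]]. split.
      * split; [assumption|]. split; [lra|]. intros k Nk Hk.
        destruct (Gap k Nk) as [G|[G|G]]; [apply le_INR in G; lra|lia|lia].
      * rewrite <- (is_series_unique _ _ S). symmetry. apply is_series_unique, window_sum_series; [lra|lia].
    + intros lam Hlam S. destruct (consecutive_sep nm p np lam Hc ltac:(lra) ltac:(lra)) as [D HD].
      split; [now apply (sep_not_N2 lam D)|]. simpl. exists np.
      destruct Hc as [Nm [Np [Nn [O1 [O2 Gap]]]]]. split.
      * split; [assumption|]. split; [lra|]. intros k Nk Hk.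
        destruct (Gap k Nk) as [G|[G|G]]; [apply le_INR in G; lra|subst; lra|lia].
      * rewrite <- (is_series_unique _ _ S). symmetry. apply is_series_unique, window_sum_series; [lra|lia].
Qed.

(** * Counting *)

Lemma least_nat (P : nat -> Prop) n : P n -> exists m, P m /\ (m <= n)%nat /\ forall k, P k -> (m <= k)%nat.
Proof.
  induction n as [n IH] using (well_founded_induction lt_wf). intros Hn.
  destruct (excluded_middle_informative (exists k, (k < n)%nat /\ P k)) as [[k [Hk Pk]]|H].
  - destruct (IH k Hk Pk) as [m [M1 [M2 M3]]]. exists m. repeat split; [assumption|lia|assumption].
  - exists n. split; [assumption|]. split; [lia|]. intros k Pk.
    destruct (Nat.le_gt_cases n k); [assumption|]. exfalso. apply H. exists k. auto.
Qed.

Definition gap_after (G : R) (p : nat) : Prop :=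
  in_N2 p /\ forall m, in_N2 m -> (p < m)%nat -> INR p + G < INR m.

Definition gap_before (G : R) (p : nat) : Prop :=
  in_N2 p /\ forall m, in_N2 m -> (m < p)%nat -> INR m < INR p - G.

Lemma short_gaps_consecutive G p : in_N2 p -> ~ gap_after G p -> ~ gap_before G p ->
  exists nm np, consecutive nm p np /\ INR np - INR p <= G /\ INR p - INR nm <= G.
Proof.
  intros Np Ha Hb.
  assert (A : exists m, (in_N2 m /\ (p < m)%nat) /\ INR m <= INR p + G).
  { apply NNPP. intros H. apply Ha. split; [assumption|]. intros m Nm Hm.
    apply Rnot_le_lt. intros Hle. apply H. exists m. auto. }
  assert (B : exists m, (in_N2 m /\ (m < p)%nat) /\ INR p - G <= INR m).
  { apply NNPP. intros H. apply Hb. split; [assumption|]. intros m Nm Hm.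
    apply Rnot_le_lt. intros Hle. apply H. exists m. auto. }
  destruct A as [m1 [A1 A2]]. destruct B as [m2 [[B1 B3] B2]].
  destruct (least_nat (fun m => in_N2 m /\ (p < m)%nat) m1 A1) as [np [[N1 N2] [N3 N4]]].
  (* The largest element of N_2 below p is found as p - k with k least. *)
  destruct (least_nat (fun k => in_N2 (p - k) /\ (1 <= k <= p)%nat) (p - m2)) as [k [[K1 K2] [K3 K4]]].
  { replace (p - (p - m2))%nat with m2 by lia. split; [assumption|lia]. }
  exists (p - k)%nat, np. split; [|split].
  - repeat split; try assumption; try lia. intros n Nn.
    destruct (Nat.lt_trichotomy n p) as [H|[H|H]].
    + left. assert (k <= p - n)%nat; [|lia]. apply K4. replace (p - (p - n))%nat with n by lia. split; [assumption|lia].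
    + auto.
    + right; right. apply N4. auto.
  - apply le_INR in N3. lra.
  - assert (INR m2 <= INR (p - k)) by (apply le_INR; lia). lra.
Qed.

Definition to_bool (P : Prop) : bool := if excluded_middle_informative P then true else false.

Lemma to_bool_iff P : to_bool P = true <-> P.
Proof. unfold to_bool. destruct (excluded_middle_informative P); split; intros; congruence || auto. Qed.

Lemma filter_separated_length (P : nat -> Prop) (l : list nat) s N : 0 < s -> NoDup l ->
  (forall p, In p l -> (p <= N)%nat) ->
  (forall m n, (m < n)%nat -> P m -> P n -> s <= INR n - INR m) ->
  INR (length (filter (fun p => to_bool (P p)) l)) <= INR N / s + 1.
Proof.
  intros Hs Hl HN Hsep.
  set (Q := fun p => to_bool (P p /\ (p <= N)%nat)).
  apply Rle_trans with (INR (length (filter Q (seq 0 (S N))))).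
  - apply le_INR, NoDup_incl_length; [now apply NoDup_filter|]. intros p Hp.
    apply filter_In in Hp. destruct Hp as [H1 H2]. apply -> to_bool_iff in H2.
    pose proof (HN p H1). apply filter_In. split; [apply in_seq; lia|]. apply <- to_bool_iff. auto.
  - rewrite <- psum_count. replace (INR N) with (INR N - 0) by ring.
    apply (separated_count Q s 0 (INR N)); [assumption|apply pos_INR| |].
    + intros m n Hmn Hm Hn. apply -> to_bool_iff in Hm. apply -> to_bool_iff in Hn. now apply Hsep.
    + intros n Hn. apply -> to_bool_iff in Hn. split; [apply pos_INR|apply le_INR, Hn].
Qed.

Lemma length_filter_negb {T} (f : T -> bool) l :
  (length (filter f l) + length (filter (fun x => negb (f x)) l) = length l)%nat.
Proof. induction l as [|x l IH]; simpl; [reflexivity|]. destruct (f x); simpl; lia. Qed.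

(** Two shells that are both followed (or both preceded) by a gap longer than G are more than G
    apart, so at most 2 (N/G + 1) primes are lost. As G is a power of N up to a constant, this is at
    most half of the available K N / ln N. *)
Lemma many_short_gap_primes : exists K, 0 < K /\ forall P0 : R, exists X1, 1 <= X1 /\
  forall N : nat, X1 <= INR N -> exists l : list nat, NoDup l /\
   (forall p, In p l -> P0 <= INR p <= INR N /\ r2 p <= 8 /\ exists nm np, consecutive nm p np /\
      INR np - INR p <= Rpower (INR p) (1 / 100) /\ INR p - INR nm <= Rpower (INR p) (1 / 100)) /\
   K * INR N / ln (INR N) <= INR (length l).
Proof.
  destruct primes_1mod4_many as [K [R0 [X0 [HK [HR HP]]]]].
  exists (K / 2). split; [lra|]. intros P0.
  (* Chosen to give 8 L <= K G below; the factor with [R0] compensates for its appearance in [G]. *)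
  set (C := 16 / K * exp (/ 100 * ln R0)).
  destruct (exp_dominates (/ 100) C ltac:(lra)) as [L0 [L01 HL]].
  exists (Rmax (Rmax 1 X0) (Rmax (exp L0) (R0 * Rmax P0 1))).
  split; [eapply Rle_trans; [|apply Rmax_l]; apply Rmax_l|]. intros N HN.
  assert (N1 : X0 <= INR N) by (eapply Rle_trans; [|apply HN]; eapply Rle_trans; [apply (Rmax_r 1)|apply Rmax_l]).
  assert (N2 : exp L0 <= INR N) by (eapply Rle_trans; [|apply HN]; eapply Rle_trans; [apply Rmax_l|apply Rmax_r]).
  assert (N3 : R0 * Rmax P0 1 <= INR N) by (eapply Rle_trans; [|apply HN]; eapply Rle_trans; [apply Rmax_r|apply Rmax_r]).
  pose proof (Rmax_r P0 1) as Q1. pose proof (Rmax_l P0 1) as Q2.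
  assert (NR : Rmax P0 1 <= INR N / R0).
  { apply Rmult_le_reg_l with R0; [lra|]. replace (R0 * (INR N / R0)) with (INR N) by (field; lra). assumption. }
  set (L := ln (INR N)).
  assert (HL0 : L0 <= L) by (unfold L; rewrite <- (ln_exp L0); apply ln_mono; [apply exp_pos|assumption]).
  pose proof (exp_pos L0) as e0.
  assert (EL : INR N = exp L) by (unfold L; rewrite exp_ln; lra).
  specialize (HL L HL0).
  destruct (HP N N1) as [l [Hnd [Hl Hc]]]. fold L in Hc.
  (* Taken at the lower end N / R0 of the range, so that G <= p^(1/100) for every prime p in the
     list. *)
  set (G := Rpower (INR N / R0) (1 / 100)).
  assert (G0 : 0 < G) by apply exp_pos.
  set (bad := fun p => orb (to_bool (gap_after G p)) (to_bool (gap_before G p))).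
  exists (filter (fun p => negb (bad p)) l). split; [now apply NoDup_filter|]. split.
  { intros p Hp. apply filter_In in Hp. destruct Hp as [Hp Hb]. destruct (Hl p Hp) as [Pp [P4 Pr]].
    destruct (r2_prime p Pp P4) as [Np R8]. split; [lra|]. split; [assumption|].
    assert (GG : G <= Rpower (INR p) (1 / 100)) by (apply Rle_Rpower_l; lra).
    unfold bad in Hb. apply Bool.negb_true_iff, Bool.orb_false_iff in Hb. destruct Hb as [B1 B2].
    destruct (short_gaps_consecutive G p Np) as [nm [np [C1 [C2 C3]]]].
    - intros H. apply <- to_bool_iff in H. congruence.
    - intros H. apply <- to_bool_iff in H. congruence.
    - exists nm, np. split; [assumption|]. lra. }
  assert (Bd : INR (length (filter bad l)) <= 2 * (INR N / G + 1)).
  { assert (HlN : forall p, In p l -> (p <= N)%nat) by (intros p Hp; apply INR_le; apply Hl, Hp).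
    pose proof (filter_separated_length (gap_after G) l G N G0 Hnd HlN) as F1.
    pose proof (filter_separated_length (gap_before G) l G N G0 Hnd HlN) as F2.
    assert (S : (length (filter bad l) <= length (filter (fun p => to_bool (gap_after G p)) l) +
       length (filter (fun p => to_bool (gap_before G p)) l))%nat).
    { clear. unfold bad. induction l as [|p l IH]; simpl; [lia|].
      destruct (to_bool (gap_after G p)), (to_bool (gap_before G p)); simpl; lia. }
    apply le_INR in S. rewrite plus_INR in S.
    assert (INR (length (filter (fun p => to_bool (gap_after G p)) l)) <= INR N / G + 1).
    { apply F1. intros m n Hmn [_ Hm] [Nn _]. specialize (Hm n Nn Hmn). lra. }
    assert (INR (length (filter (fun p => to_bool (gap_before G p)) l)) <= INR N / G + 1).
    { apply F2. intros m n Hmn [Nm _] [_ Hn]. specialize (Hn m Nm Hmn). lra. }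
    lra. }
  pose proof (length_filter_negb bad l) as E. apply (f_equal INR) in E. rewrite plus_INR in E.
  assert (EG : G = exp (/ 100 * L) / exp (/ 100 * ln R0)).
  { unfold G, Rpower. rewrite ln_div by lra. fold L.
    transitivity (exp (/ 100 * L + - (/ 100 * ln R0))); [f_equal; field|].
    rewrite exp_plus, exp_Ropp. reflexivity. }
  pose proof (exp_pos (/ 100 * ln R0)) as eR. set (r := exp (/ 100 * ln R0)) in *.
  assert (r1 : 1 <= r).
  { unfold r. pose proof (exp_ineq1_le (/ 100 * ln R0)). pose proof (ln_nonneg R0 HR). lra. }
  assert (C0 : 0 < 16 / K) by (apply Rdiv_lt_0_compat; lra).
  assert (L1 : 1 <= L) by lra.
  assert (B1 : 8 * L <= K * G).
  { apply Rmult_le_reg_r with (16 * r / K); [apply Rdiv_lt_0_compat; lra|].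
    replace (K * G * (16 * r / K)) with (16 * exp (/ 100 * L)) by (rewrite EG; field; split; lra).
    replace (8 * L * (16 * r / K)) with (8 * (C * L)) by (unfold C; fold r; field; lra).
    assert (C * L <= C * L ^ 2) by (apply Rmult_le_compat_l; [unfold C; fold r; nra|nra]).
    pose proof (exp_pos (/ 100 * L)). lra. }
  assert (GN : G <= INR N).
  { rewrite EG, EL. apply Rle_trans with (exp (/ 100 * L)).
    - apply Rmult_le_reg_r with r; [lra|]. replace (exp (/ 100 * L) / r * r) with (exp (/ 100 * L)) by (field; lra).
      pose proof (exp_pos (/ 100 * L)). nra.
    - destruct (Req_dec (/ 100 * L) L) as [->|]; [lra|]. apply Rlt_le, exp_increasing. lra. }
  assert (B2 : 2 * (INR N / G + 1) <= K / 2 * INR N / L).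
  { apply Rmult_le_reg_r with (2 * G * L); [nra|].
    replace (2 * (INR N / G + 1) * (2 * G * L)) with (4 * L * (INR N + G)) by (field; lra).
    replace (K / 2 * INR N / L * (2 * G * L)) with (K * G * INR N) by (field; lra).
    apply Rle_trans with (8 * L * INR N); [nra|]. apply Rmult_le_compat_r; lra. }
  replace (K / 2 * INR N / L) with (K * INR N / L - K / 2 * INR N / L) by (field; lra). fold L. lra.
Qed.

Theorem theorem1p3 :
  forall (cp : coupling) (C : R) (x0 : R * R),
    coupling_ok cp ->
    exists (L2 : R -> Prop) (A c : R) (N : nat),
      (forall lam, L2 lam -> in_Lambda cp C lam) /\
      1 < A /\ 0 < c /\ (1 <= N)%nat /\
      (exists K X0 : R, 0 < K /\
         forall x, X0 <= x ->
           exists l : list R, NoDup l /\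
             (forall lam, In lam l -> L2 lam /\ lam <= x) /\
             K * x / Rpower (ln x) A <= INR (length l)) /\
      (forall mu, weak_star_limit_point L2 mu ->
         exists pts : list (R * R),
           (length pts <= N)%nat /\
           (forall p, In p pts -> 0 <= snd p) /\
           rsum (map snd pts) = 1 /\
           forall f, smooth_S1 f -> nonneg_S1 f ->
             c * rsum (map (fun p => snd p * f (cos (fst p)) (sin (fst p))) pts)
               <= mu f).
Proof.
  intros cp C _ Hcp.
  set (L2 := fun lam => in_Lambda cp C lam /\ scarred (/ 1081) lam).
  (* The count obtained below has order x / ln x, and A = 2 is a convenient exponent above 1. The
     measure rho is a single point mass, hence N = 1. *)
  exists L2, 2, (/ 1081), 1%nat.
  split; [intros lam H; apply H|]. split; [lra|]. split; [lra|]. split; [lia|]. split.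
  2:{ intros mu Hmu. destruct (scarred_limit L2 (/ 1081) mu) as [t Ht]; [lra|intros lam H; apply H|assumption|].
      exists ((t, 1) :: nil). split; [simpl; lia|]. split; [intros p [<-|[]]; simpl; lra|].
      split; [simpl; lra|]. intros f Hf Hn. simpl. rewrite Rmult_1_l, Rplus_0_r. now apply Ht. }
  destruct (scarred_near_shell cp C Hcp) as [P0 [P01 Hp0]].
  destruct many_short_gap_primes as [K [HK Hm]]. destruct (Hm P0) as [X1 [HX1 Hl]].
  exists (K / 12), (4 * X1 + 8). split; [lra|]. intros x Hx.
  (* Primes up to x / 2 are used because the eigenvalue attached to p lies below p + p^(1/100) <=
     2p. *)
  destruct (nfloor_ex (x / 2) ltac:(lra)) as [N [Nl Nu]].
  assert (HN : x / 4 + 1 <= INR N) by lra.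
  destruct (Hl N ltac:(lra)) as [l [Hnd [Hprop Hlen]]].
  (* Besides membership, this records that p is the neighbour of [lam] in N_2 on one side. Once the
     side is known, [lam] determines p. *)
  set (near_p := fun p lam => L2 lam /\ lam <= x /\
     ((INR p < lam /\ forall n, in_N2 n -> INR n <= INR p \/ lam < INR n) \/
      (lam < INR p /\ forall n, in_N2 n -> INR n < lam \/ INR p <= INR n))).
  assert (Sel : forall p, exists lam, In p l -> near_p p lam).
  { intros p. destruct (excluded_middle_informative (In p l)) as [Hp|Hp]; [|exists 0; tauto].
    destruct (Hprop p Hp) as [Pr [R8 [nm [np [Cn [G1 G2]]]]]].
    destruct (Hp0 nm p np ltac:(lra) Cn R8 G1 G2) as [lam [I1 [I2 I3]]].
    exists lam. intros _. split; [split; assumption|].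
    destruct Cn as [_ [_ [_ [O1 [O2 Gap]]]]].
    assert (Gp : Rpower (INR p) (1 / 100) <= INR p).
    { rewrite <- (Rpower_1 (INR p)) at 2 by lra. apply Rle_Rpower; lra. }
    apply lt_INR in O1. apply lt_INR in O2. split; [destruct I3; lra|].
    destruct I3 as [I3|I3]; [right|left]; (split; [lra|]); intros n Nn;
      destruct (Gap n Nn) as [G|[->|G]]; try apply le_INR in G; lra. }
  set (sel := fun p => proj1_sig (constructive_indefinite_description _ (Sel p))).
  assert (Hsel : forall p, In p l -> near_p p (sel p)).
  { intros p Hp. unfold sel. destruct (constructive_indefinite_description _ (Sel p)); simpl; auto. }
  set (right := fun p => if Rlt_dec (INR p) (sel p) then true else false).
  assert (NN : forall p, In p l -> in_N2 p).
  { intros p Hp. destruct (Hprop p Hp) as [_ [_ [nm [np [Cn _]]]]]. apply Cn. }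
  (* An eigenvalue can be selected by the primes at both ends of its gap. The primes are split by
     the side of their eigenvalue, and the larger class, on which [sel] is injective, is kept. *)
  assert (Half : exists l' : list nat, NoDup l' /\ incl l' l /\ (length l <= 2 * length l')%nat /\
     forall p q, In p l' -> In q l' -> sel p = sel q -> p = q).
  { pose proof (length_filter_negb right l) as E.
    assert (IR : forall p q, In p (filter right l) -> In q (filter right l) -> sel p = sel q -> p = q).
    { intros p q Hp Hq Epq. apply filter_In in Hp. apply filter_In in Hq.
      destruct Hp as [Hp Rp]. destruct Hq as [Hq Rq]. unfold right in Rp, Rq.
      destruct (Rlt_dec (INR p) (sel p)); [|discriminate]. destruct (Rlt_dec (INR q) (sel q)); [|discriminate].
      destruct (Hsel p Hp) as [_ [_ [[_ S1]|[S1 _]]]]; [|lra]. destruct (Hsel q Hq) as [_ [_ [[_ S2]|[S2 _]]]]; [|lra].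
      apply INR_eq. destruct (S1 q (NN q Hq)); [|lra]. destruct (S2 p (NN p Hp)); lra. }
    assert (IL : forall p q, In p (filter (fun p => negb (right p)) l) ->
       In q (filter (fun p => negb (right p)) l) -> sel p = sel q -> p = q).
    { intros p q Hp Hq Epq. apply filter_In in Hp. apply filter_In in Hq.
      destruct Hp as [Hp Rp]. destruct Hq as [Hq Rq]. unfold right in Rp, Rq.
      destruct (Rlt_dec (INR p) (sel p)); [discriminate|]. destruct (Rlt_dec (INR q) (sel q)); [discriminate|].
      destruct (Hsel p Hp) as [_ [_ [[S1 _]|[_ S1]]]]; [lra|]. destruct (Hsel q Hq) as [_ [_ [[S2 _]|[T2 S2]]]]; [lra|].
      apply INR_eq. destruct (S1 q (NN q Hq)); [lra|]. destruct (S2 p (NN p Hp)); lra. }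
    destruct (Nat.le_ge_cases (length (filter right l)) (length (filter (fun p => negb (right p)) l))).
    - exists (filter (fun p => negb (right p)) l). split; [now apply NoDup_filter|].
      split; [intros p Hp; apply filter_In in Hp; tauto|]. split; [lia|assumption].
    - exists (filter right l). split; [now apply NoDup_filter|].
      split; [intros p Hp; apply filter_In in Hp; tauto|]. split; [lia|assumption]. }
  destruct Half as [l' [H1 [H2 [H3 H4]]]].
  exists (map sel l'). split.
  { apply NoDup_map_NoDup_ForallPairs; [|assumption]. intros p q Hp Hq. now apply H4. }
  split.
  { intros lam Hlam. apply in_map_iff in Hlam. destruct Hlam as [p [<- Hp]].
    destruct (Hsel p (H2 p Hp)) as [S1 [S2 _]]. auto. }
  rewrite length_map. apply le_INR in H3. rewrite mult_INR in H3. simpl (INR 2) in H3.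
  assert (N3 : 3 <= INR N) by lra.
  assert (LN : 1 <= ln (INR N)).
  { rewrite <- (ln_exp 1). apply ln_mono; [apply exp_pos|]. pose proof exp_le_3. lra. }
  assert (Lx : ln (INR N) <= ln x) by (apply ln_mono; lra).
  assert (RP : Rpower (ln x) 2 = ln x ^ 2) by (rewrite <- Rpower_pow by lra; reflexivity).
  rewrite RP.
  (* The factor 1/2 comes from [Half]; then N >= x / 4 and 1 <= ln N <= ln x. *)
  apply Rle_trans with (K * INR N / ln (INR N) / 2); [|lra].
  apply Rle_trans with (K / 12 * x / ln x).
  - unfold Rdiv at 1 3. apply Rmult_le_compat_l; [nra|]. apply Rinv_le_contravar; nra.
  - apply Rle_trans with (K / 12 * x / ln (INR N)).
    + unfold Rdiv at 1 3. apply Rmult_le_compat_l; [nra|]. apply Rinv_le_contravar; lra.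
    + replace (K * INR N / ln (INR N) / 2) with (K * INR N / 2 / ln (INR N)) by (field; lra).
      unfold Rdiv at 1 3. apply Rmult_le_compat_r; [apply Rlt_le, Rinv_0_lt_compat; lra|]. nra.
Qed.
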